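(* Let $k$ be a finite field, let $n\ge 1$ be an integer, and let $\Omega(k^{n+1})\subset \mathbb{P}^n$ be the complement of the union of all $k$-rational hyperplanes in the projective space $\mathbb{P}^n$ over $k$. (1) Every separable dominant $k$-endomorphism $\psi$ of $\Omega(k^{n+1})$ is a $k$-automorphism and it extends to a $k$-automorphism of $\mathbb{P}^n$. (2) There exists a radicial $k$-endomorphism $\psi$ of $\Omega(k^{n+1})$ that does not extend to a $k$-endomorphism of $\mathbb{P}^n$.
   Context: A $k$-endomorphism of a $k$-scheme $U$ is a morphism $U\to U$ of $k$-schemes. A dominant endomorphism of an integral $k$-variety is separable if the induced extension of function fields is separable. A morphism is radicial if it is universally injective (injective on points with purely inseparable residue field extensions). The scheme $\Omega(k^{n+1})$ is called Drinfeld's half-space over $k$.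
   Formalization: Part (2) is stated only for n ≥ 2: for n = 1 it is false, because every k-morphism from the dense open Ω(k²) of the regular curve P¹ to the proper curve P¹ extends to P¹. Part (1) is stated for all n ≥ 1. *)

(* Defs.v *)
From HB Require Import structures.
From mathcomp Require Import all_boot all_order all_algebra all_field.
From mathcomp Require Import fraction ring_quotient.
From mathcomp Require Import mpoly.
From mathcomp Require Import boolp classical_sets functions cardinality.
From mathcomp Require Import topology_structure subspace_topology.

Set Implicit Arguments.
Unset Strict Implicit.
Unset Printing Implicit Defensive.

Import GRing.Theory.

Local Open Scope classical_set_scope.
Local Open Scope ring_scope.

Record opens (T : topologicalType) := Opens {
  opens_set :> T -> Prop;
  opensP : open opens_set }.

Definition opensI (T : topologicalType) (U V : opens T) : opens T :=
  Opens (openI (opensP U) (opensP V)).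

Definition opensT (T : topologicalType) : opens T := Opens (@openT T).

Section Preimage.
Variables (S T : topologicalType) (X : opens S) (f : S -> T).
Hypothesis fc : {within X, continuous f}.

Lemma preim_opens_open (V : opens T) : open (X `&` f @^-1` V).
Proof.
rewrite setIC; have /continuousP/(_ _ (opensP V)) := fc.
by rewrite open_setIS //; exact: opensP.
Qed.

(* The preimage of V under f viewed as a map on the open subspace X *)
Definition preim_opens (V : opens T) : opens S := Opens (preim_opens_open V).

End Preimage.

Section ProjectiveSpace.
Variables (k : fieldType) (n : nat).

Local Notation S := {mpoly k[n.+1]}.
Local Notation F := {fraction S}.
Local Notation "x %:F" := (@FracField.tofrac _ x).
Local Notation "d .-hom" := (@ishomog1 n.+1 k d mdeg) (at level 1).

Definition homogeneous_ideal (I : {pred S}) :=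
  forall f d, f \in I -> pihomog mdeg d f \in I.

(* The points of Proj k[X_0, ..., X_n]: homogeneous primes that do not contain
   the irrelevant ideal. *)
Record proj := Proj {
  proj_ideal :> S -> bool;
  proj_idealr : idealr_closed proj_ideal;
  proj_prime : prime_idealr_closed proj_ideal;
  proj_homog : homogeneous_ideal proj_ideal;
  proj_relevant : exists i : 'I_n.+1, 'X_i \notin proj_ideal }.

HB.instance Definition _ := gen_eqMixin proj.
HB.instance Definition _ := gen_choiceMixin proj.

Definition zeros (E : set S) : set proj :=
  [set p | forall f, E f -> f \in proj_ideal p].

Definition zariski_open (U : set proj) := exists2 E : set S,
  (forall f, E f -> exists d, f \is d.-hom) & U = ~` zeros E.

Let zariski_openT : zariski_open setT.
Proof.
exists [set 1] => [_ ->|]; first by exists 0%N; exact: dhomog1.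
apply/seteqP; split => // p _ /(_ 1 erefl).
by have [[_ /negP]] := proj_idealr p.
Qed.

Let zariski_openI : setI_closed zariski_open.
Proof.
move=> _ _ [E hE ->] [G hG ->].
exists [set h | exists f g, [/\ E f, G g & h = f * g]].
  move=> _ [f [g [/hE[d fd] /hG[e ge] ->]]].
  by exists (d + e)%N; exact: dhomogM.
have [idl prm] := (proj_idealr, proj_prime).
apply/seteqP; split => p /=.
  move=> [/existsNP[f /not_implyP[Ef /negP fp]]].
  move=> /existsNP[g /not_implyP[Gg /negP gp]].
  move=> /(_ (f * g)) fgp; have /fgp/prm : exists f' g',
    [/\ E f', G g' & f * g = f' * g'] by exists f, g.
  by rewrite (negbTE fp) (negbTE gp).
move=> /existsNP[_ /not_implyP[[f [g [Ef Gg ->]]] /negP fgp]].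
have [p0 _ pM] := idl p.
split=> /= [/(_ f Ef) fp|/(_ g Gg) gp]; case/negP: fgp.
  by rewrite mulrC -[_ * _]addr0; exact: pM.
by rewrite -[_ * _]addr0; exact: pM.
Qed.

Let zariski_open_bigcup (I : Type) (U : I -> set proj) :
  (forall i, zariski_open (U i)) -> zariski_open (\bigcup_i U i).
Proof.
move=> oU; exists [set f | exists i E, [/\ E f,
    forall g, E g -> exists d, g \is d.-hom & U i = ~` zeros E]].
  by move=> f [i [E [Ef hE _]]]; exact: hE.
apply/seteqP; split => p.
  move=> [i _]; have [E hE UE] := oU i; rewrite UE => Ep Zp; apply: Ep => f Ef.
  by apply: Zp; exists i, E.
move=> /existsNP[f /not_implyP[[i [E [Ef hE UE]]] fp]].
by exists i => //; rewrite UE => /(_ f Ef).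
Qed.

HB.instance Definition _ := isOpenTopological.Build proj
  zariski_openT zariski_openI zariski_open_bigcup.

(* The structure sheaf. All the stalks are subrings of the field of fractions
   of k[X_0, ..., X_n], so a section over U is a function on U, locally given
   by a fraction of two homogeneous polynomials of the same degree; it is
   extended by 0 outside U, and its value at p in U is its germ at p. *)
Definition stalk (p : proj) : set F := [set x | exists d (a b : S),
  [/\ a \is d.-hom, b \is d.-hom, b \notin proj_ideal p & x = a%:F / b%:F]].

Definition stalk_max (p : proj) : set F := [set x | exists d (a b : S),
  [/\ a \is d.-hom, b \is d.-hom, a \in proj_ideal p, b \notin proj_ideal p
    & x = a%:F / b%:F]].

Definition is_section (U : opens proj) (s : proj -> F) :=
  (forall p, ~ U p -> s p = 0) /\
  (forall p, U p -> exists V : opens proj, [/\ V p, V `<=` U &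
     exists d (a b : S), [/\ a \is d.-hom, b \is d.-hom &
       forall q, V q -> b \notin proj_ideal q /\ s q = a%:F / b%:F]]).

Record section (U : opens proj) := Section {
  section_fun :> proj -> F;
  sectionP : is_section U section_fun }.

Lemma section_eq (U : opens proj) (s t : section U) : s =1 t -> s = t.
Proof.
case: s t => [s Ps] [t Pt] /= /funext st; case: _ / st Pt => Pt.
by congr Section; exact: Prop_irrelevance.
Qed.

Section SectionRing.
Variable U : opens proj.

HB.instance Definition _ := gen_eqMixin (section U).
HB.instance Definition _ := gen_choiceMixin (section U).

Let notin0 (p : proj) (b : S) : b \notin proj_ideal p -> b%:F != 0.
Proof.
have [[p0 _ _] bp] := (proj_idealr p, @tofrac_eq0 _ b).
by rewrite bp; apply: contraNneq => ->.
Qed.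

Let notinM (p : proj) (a b : S) : a \notin proj_ideal p ->
  b \notin proj_ideal p -> a * b \notin proj_ideal p.
Proof.
move=> /negbTE ap /negbTE bp; apply/negP => /(@proj_prime p).
by rewrite ap bp.
Qed.

Lemma is_section_cst (c : k) :
  is_section U (fun p => if p \in (U : set proj) then (c%:MP)%:F else 0).
Proof.
split=> p Up; first by rewrite memNset.
exists U; split => //; exists 0%N, c%:MP, 1; split.
- by rewrite -[c%:MP]mul1r mulrC mul_mpolyC; apply: rpredZ; exact: dhomog1.
- exact: dhomog1.
move=> q Uq; rewrite mem_set // rmorph1 divr1; split => //.
by have [[]] := proj_idealr q.
Qed.

Let is_sectionD s t : is_section U s -> is_section U t ->
  is_section U (fun p => s p + t p).
Proof.
move=> [s0 s1] [t0 t1]; split => p Up; first by rewrite s0 // t0 // addr0.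
have [V [Vp VU [d [a [b [ad bd Vab]]]]]] := s1 p Up.
have [W [Wp WU [e [a' [b' [ae be Wab]]]]]] := t1 p Up.
exists (opensI V W); split => //=; first by move=> q [/VU].
exists (d + e)%N, (a * b' + a' * b), (b * b'); split.
- by apply: rpredD; [|rewrite addnC]; exact: dhomogM.
- exact: dhomogM.
move=> q [/Vab[bq ->] /Wab[b'q ->]]; split; first exact: notinM.
rewrite (addf_div _ _ (notin0 bq) (notin0 b'q)).
by rewrite tofracD (tofracM a b') (tofracM a' b) (tofracM b b').
Qed.

Let is_sectionM s t : is_section U s -> is_section U t ->
  is_section U (fun p => s p * t p).
Proof.
move=> [s0 s1] [t0 t1]; split => p Up; first by rewrite s0 // mul0r.
have [V [Vp VU [d [a [b [ad bd Vab]]]]]] := s1 p Up.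
have [W [Wp WU [e [a' [b' [ae be Wab]]]]]] := t1 p Up.
exists (opensI V W); split => //=; first by move=> q [/VU].
exists (d + e)%N, (a * a'), (b * b'); split; [exact: dhomogM..|].
move=> q [/Vab[bq ->] /Wab[b'q ->]]; split; first exact: notinM.
by rewrite !tofracM mulf_div.
Qed.

Let is_sectionN s : is_section U s -> is_section U (fun p => - s p).
Proof.
move=> [s0 s1]; split => p Up; first by rewrite s0 // oppr0.
have [V [Vp VU [d [a [b [ad bd Vab]]]]]] := s1 p Up.
exists V; split => //; exists d, (- a), b; split => //; first by rewrite rpredN.
by move=> q /Vab[bq ->]; rewrite tofracN mulNr.
Qed.

Definition section_cst c : section U := Section (is_section_cst c).
Definition section_add (s t : section U) : section U :=
  Section (is_sectionD (sectionP s) (sectionP t)).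
Definition section_mul (s t : section U) : section U :=
  Section (is_sectionM (sectionP s) (sectionP t)).
Definition section_opp (s : section U) : section U :=
  Section (is_sectionN (sectionP s)).

Let addA : associative section_add.
Proof. by move=> s t u; apply: section_eq => p /=; rewrite addrA. Qed.
Let addC : commutative section_add.
Proof. by move=> s t; apply: section_eq => p /=; rewrite addrC. Qed.
Let add0 : left_id (section_cst 0) section_add.
Proof.
by move=> s; apply: section_eq => p /=; rewrite !raddf0 if_same add0r.
Qed.
Let addN : left_inverse (section_cst 0) section_opp section_add.
Proof.
by move=> s; apply: section_eq => p /=; rewrite !raddf0 if_same addNr.
Qed.

HB.instance Definition _ := GRing.isZmodule.Build (section U)
  addA addC add0 addN.

Let mulA : associative section_mul.
Proof. by move=> s t u; apply: section_eq => p /=; rewrite mulrA. Qed.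
Let mulC : commutative section_mul.
Proof. by move=> s t; apply: section_eq => p /=; rewrite mulrC. Qed.
Let mul1 : left_id (section_cst 1) section_mul.
Proof.
move=> s; apply: section_eq => p /=; case: ifPn => [_|/negP Up].
  by rewrite !rmorph1 mul1r.
by rewrite (sectionP s).1 ?mulr0 // => /mem_set.
Qed.
Let mulDl : left_distributive section_mul section_add.
Proof. by move=> s t u; apply: section_eq => p /=; rewrite mulrDl. Qed.

HB.instance Definition _ := GRing.Zmodule_isComPzRing.Build (section U)
  mulA mulC mul1 mulDl.

Lemma is_section_res (V : opens proj) (s : section V) : U `<=` V ->
  is_section U (fun p => if p \in (U : set proj) then s p else 0).
Proof.
move=> UV; split=> p Up; first by rewrite memNset.
have [W [Wp WV [d [a [b [ad bd Wab]]]]]] := (sectionP s).2 p (UV p Up).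
exists (opensI U W); split => //=; exists d, a, b; split => //.
by move=> q [Uq /Wab]; rewrite mem_set.
Qed.

Definition section_res (V : opens proj) (UV : U `<=` V) (s : section V) :
  section U := Section (is_section_res s UV).

End SectionRing.

Definition projective_space : opens proj := opensT proj.

(* Morphisms of locally ringed spaces over k between the open subschemes X and
   Y of the projective space. The values of [base] outside X are irrelevant. *)
Record morphism (X Y : opens proj) := Morphism {
  base :> proj -> proj;
  base_fun : set_fun X Y base;
  base_cont : {within X, continuous base};
  comorph : forall V : opens proj, V `<=` Y ->
    {rmorphism section V -> section (preim_opens base_cont V)};
  comorph_res : forall (V W : opens proj) (VY : V `<=` Y) (WY : W `<=` Y)
    (WV : W `<=` V) (s : section V) (p : proj), X p -> W (base p) ->
    comorph WY (section_res WV s) p = comorph VY s p;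
  comorph_cst : forall (V : opens proj) (VY : V `<=` Y) (c : k),
    comorph VY (section_cst V c) = section_cst _ c;
  comorph_local : forall (V : opens proj) (VY : V `<=` Y) (s : section V)
    (p : proj), X p -> V (base p) ->
    stalk_max (base p) (s (base p)) -> stalk_max p (comorph VY s p) }.

Arguments base_fun {X Y} m.
Arguments base_cont {X Y} m.

Lemma preim_opens_sub (X Y : opens proj) (f : morphism X Y) (V : opens proj) :
  preim_opens (base_cont f) V `<=` X.
Proof. by move=> p []. Qed.

(* g \o f is the identity of X *)
Definition left_inverse_of (X Y : opens proj) (f : morphism X Y)
  (g : morphism Y X) :=
  (forall p, X p -> g (f p) = p) /\
  (forall (V : opens proj) (VX : V `<=` X) (s : section V) (p : proj), V p ->
    comorph f (@preim_opens_sub _ _ g V) (comorph g VX s) p = s p).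

Definition automorphism (X : opens proj) (f : morphism X X) :=
  exists g : morphism X X, left_inverse_of f g /\ left_inverse_of g f.

(* The equality of the two composites of f, g and the inclusion of X *)
Definition extends (X : opens proj) (g : morphism projective_space projective_space)
  (f : morphism X X) :=
  (forall p, X p -> g p = f p) /\
  (forall (V : opens proj) (s : section V) (p : proj), X p -> V (g p) ->
    comorph g (@subsetT _ V) s p =
    comorph f (V := opensI X V) (@subIsetl _ X V)
      (section_res (U := opensI X V) (@subIsetr _ X V) s) p).

Definition dominant (X Y : opens proj) (f : morphism X Y) :=
  Y `<=` closure (f @` X).

(* The image of the local homomorphism from the stalk at f p to the one at p *)
Definition stalk_image (X Y : opens proj) (f : morphism X Y) (p : proj) :
  set F :=
  [set x | exists (V : opens proj) (VY : V `<=` Y) (s : section V),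
    V (f p) /\ x = comorph f VY s p].

Definition generic_point : proj.
Proof.
exists (pred1 0).
- split; rewrite ?inE ?oner_neq0 // => a u v; rewrite !inE => /eqP-> /eqP->.
  by rewrite mulr0 addr0.
- by move=> u v; rewrite !inE mulf_eq0.
- by move=> f d; rewrite !inE => /eqP->; rewrite raddf0.
- by exists ord0; rewrite !inE -msize_poly_eq0 msizeX mdeg1.
Defined.

(* The stalk at the generic point is the function field, and a dominant
   morphism maps the generic point to itself. Since the transcendence degrees
   agree, the induced extension of function fields is algebraic. *)
Definition separable_morphism (X : opens proj) (f : morphism X X) :=
  forall x, stalk generic_point x -> exists p : {poly F},
    [/\ forall i, stalk_image f generic_point p`_i, separable_poly p & root p x].

(* The residue field at p is the quotient of [stalk p] by [stalk_max p]. *)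
Definition radicial (X Y : opens proj) (f : morphism X Y) :=
  (forall p q, X p -> X q -> f p = f q -> p = q) /\
  (forall p, X p -> forall x, stalk p x -> exists (e : nat) (y : F),
    [/\ [pchar k].-nat e, stalk_image f p y & stalk_max p (x ^+ e - y)]).

Definition linear_form (l : 'rV[k]_n.+1) : S := \sum_i l 0 i *: 'X_i.

Definition hyperplane (l : 'rV[k]_n.+1) : set proj :=
  [set p | linear_form l \in proj_ideal p].

End ProjectiveSpace.

Section HalfSpace.
Variables (k : finFieldType) (n : nat).

Lemma half_space_open :
  open (~` \bigcup_(l in [set l | l != 0]) @hyperplane k n l).
Proof.
apply: closed_openC; apply: closed_bigcup; first exact: finite_finset.
move=> l _; rewrite -openC; exists [set linear_form l].
  move=> _ ->; exists 1%N; apply: rpred_sum => i _; apply: rpredZ.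
  by rewrite dhomogX; apply/eqP; exact: mdeg1.
by apply/seteqP; split => p /= lp;
  [move/(_ _ erefl)|move=> lp'; apply: lp => _ ->].
Qed.

Definition half_space : opens (proj k n) := Opens half_space_open.

End HalfSpace.

(* Main.v *)
From HB Require Import structures.
Require Import Defs.
From mathcomp Require Import all_boot all_algebra fingroup perm all_field.
From mathcomp Require Import generic_quotient fraction ring_quotient mpoly.
From mathcomp Require pgroup abelian.
From mathcomp Require Import boolp classical_sets.
From mathcomp Require Import topology_structure subspace_topology.
From mathcomp Require Import zify ring.

Set Implicit Arguments.
Unset Strict Implicit.
Unset Printing Implicit Defensive.

(** Let S = k[X_0, ..., X_n], let q be the cardinal of k and let L(t) be the
    linear form with coefficient row t, so that the half-space Omega is the
    locus where no L(t) with t <> 0 vanishes.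

    Separable endomorphisms. A function which is regular on Omega becomes a
    polynomial after multiplication by a power of the product Delta of all the
    L(t): otherwise its denominators generate a homogeneous ideal that contains
    no power of Delta, hence lie in a point of Omega (denominators_Delta). As
    linear forms are prime, the units of Omega are therefore quotients of split
    forms, that is of products of linear forms over k (unit_split). Applied to
    the images of the units L(l) / X_0, this shows that an endomorphism of Omega
    is given by forms f_0, ..., f_n of one degree d such that every nonzero
    combination f_l = sum_i l_i f_i over k is split; when d is minimal, no L(t)
    divides all the f_i (exists_coprime_represents). If the endomorphism is
    separable, the Jacobian determinant J of f is not zero (jacobian_neq0), and
    this forces d = 1 by comparing two counts, as follows.

    Let v_t be the order of vanishing along L(t). The values v_t(f_l) filter
    the space of all l; let E_t be the sum of the v_t(f_l) over a basis adapted
    to this filtration. Only the derivative transversal to the hyperplane L(t)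
    lowers orders, and by one, so that v_t(J) >= E_t - 1: this is the fact that
    the pullback of a form with logarithmic poles has logarithmic poles
    (jacobian_dvd). Hence the degree of J bounds the sum of the E_t - 1 over
    all t. On the other hand the sum of all the v_t(f_l) is known, because the
    f_l are split of degree d. For fixed t, the sum of the v_t(f_l) over l is a
    sum of terms q^c - 1 where c runs through the dimensions of the layers of
    the filtration, whose sum is E_t, and the convexity of c |-> q^c relates
    the two (filtration_bound). The counts are compatible only if all these
    inequalities are equalities, which means d = 1 (degree_le1). The
    endomorphism is then a linear substitution, that is invertible because the
    f_l do not vanish, and it makes sense on the whole projective space.

    A radicial endomorphism. Let F be the q-power Frobenius map. Send a point x
    to the hyperplane spanned by x, F x, ..., F^(n-1) x; its coordinates are the
    maximal minors f_i of the matrix of the X_j^(q^s), s < n. By the product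
    formula of Moore (moore_recr) the combinations f_l are split, so that Omega
    is mapped to itself. The vector F^(n-1) x is orthogonal to f(x), F f(x),
    ..., F^(n-1) f(x), hence applying the map twice gives F^(n-1)
    (frob_minor_twice): this is the identity on points and a power of Frobenius
    on functions, so the map is radicial (dual_radicial). If n >= 2, all the f_i
    vanish at the rational point (1 : 0 : ... : 0), and no f_m divides the other
    f_i locally at that point, since setting X_i = 0 for i <> 0, m kills f_m and
    not f_i; thus the map does not extend there (dual_not_extends). *)

Import GRing.Theory.
Local Open Scope ring_scope.
Local Notation "x %:F" := (@FracField.tofrac _ x).

(** * Linear forms, divisibility and split polynomials *)

Section Substitution.
Variables (k : fieldType) (n : nat).
Local Notation S := {mpoly k[n]}.

Definition msubst (h : 'I_n -> S) : S -> S := mmap (@mpolyC n k) h.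
HB.instance Definition _ h := GRing.RMorphism.on (msubst h).

Lemma msubstX h i : msubst h 'X_i = h i.
Proof. by rewrite /msubst mmapX mmap1U. Qed.
Lemma msubstC h c : msubst h c%:MP = c%:MP.
Proof. exact: mmapC. Qed.
Lemma msubstZ h c p : msubst h (c *: p) = c *: msubst h p.
Proof. by rewrite /msubst mmapZ mul_mpolyC. Qed.
End Substitution.

Section LinearForms.
Variables (k : fieldType) (n : nat).
Local Notation S := {mpoly k[n.+1]}.
Local Notation L := (@linear_form k n).

(** Equalities between ring morphisms out of a polynomial ring, and closure
    properties of subrings, are all proved by this induction. *)
Lemma mpoly_ring_ind (P : S -> Prop) :
  (forall c, P c%:MP) -> (forall i, P 'X_i) -> (forall p q, P p -> P q -> P (p + q)) ->
  (forall p q, P p -> P q -> P (p * q)) -> forall p, P p.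
Proof.
move=> PC PX PD PM p; rewrite [p]mpolyE; elim/big_ind: _ => [||m _].
- by rewrite -mpolyC0.
- exact: PD.
rewrite -mul_mpolyC; apply: (PM) => //; rewrite mpolyXE_id.
elim/big_ind: _ => [||i _]; [by rewrite -mpolyC1|exact: PM|].
by elim: (m i) => [|j IH]; rewrite ?expr0 -?mpolyC1 // exprS; apply: PM.
Qed.

Lemma linear_form_is_linear : linear L.
Proof.
move=> a t u; rewrite /linear_form scaler_sumr -big_split /=.
by apply: eq_bigr => i _; rewrite !mxE scalerA scalerDl.
Qed.
HB.instance Definition _ := GRing.isLinear.Build k 'rV[k]_n.+1 S _ L linear_form_is_linear.

Lemma mcoeff_linear_form t i : (L t)@_U_(i) = t 0 i.
Proof.
rewrite /linear_form raddf_sum (bigD1 i) //= mcoeffZ mcoeffXU eqxx mulr1.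
by rewrite big1 ?addr0 // => j /negbTE ji; rewrite mcoeffZ mcoeffXU ji mulr0.
Qed.

Lemma linear_form_eq0 t : (L t == 0) = (t == 0).
Proof.
apply/eqP/eqP => [Lt|->]; last exact: linear0.
by apply/rowP => i; rewrite -mcoeff_linear_form Lt mcoeff0 mxE.
Qed.

Lemma linear_form_homog t : L t \is 1.-homog.
Proof.
apply: rpred_sum => i _; apply: rpredZ.
by rewrite dhomogX; apply/eqP; exact: mdeg1.
Qed.

Lemma msize_linear_form t : t != 0 -> msize (L t) = 2%N.
Proof.
rewrite -linear_form_eq0 => t0; have Lh := linear_form_homog t.
have := dhomog_uniq t0 Lh (dhomog_msize Lh); rewrite -msize_poly_eq0 in t0.
by case: (msize (L t)) t0 => //= m _ <-.
Qed.

Lemma msubst_linear_form h t : msubst h (L t) = \sum_i t 0 i *: h i.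
Proof.
by rewrite rmorph_sum /=; apply: eq_bigr => i _; rewrite msubstZ msubstX.
Qed.

Lemma linear_form_delta i : L (delta_mx 0 i) = 'X_i.
Proof.
rewrite /linear_form (bigD1 i) //= mxE !eqxx scale1r big1 ?addr0 // => j /negbTE ji.
by rewrite mxE ji scale0r.
Qed.

Definition mdvd (a b : S) : Prop := exists c, b = c * a.

Lemma mdvd0 a : mdvd a 0. Proof. by exists 0; rewrite mul0r. Qed.
Lemma mdvd1l b : mdvd 1 b. Proof. by exists b; rewrite mulr1. Qed.
Lemma mdvdD a b c : mdvd a b -> mdvd a c -> mdvd a (b + c).
Proof. by move=> [x ->] [y ->]; exists (x + y); rewrite mulrDl. Qed.
Lemma mdvd_mull a b c : mdvd a b -> mdvd a (c * b).
Proof. by move=> [x ->]; exists (c * x); rewrite mulrA. Qed.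
Lemma mdvd_mulr a b c : mdvd a b -> mdvd a (b * c).
Proof. by rewrite mulrC; exact: mdvd_mull. Qed.
Lemma mdvdZ a b c : mdvd a b -> mdvd a (c *: b).
Proof. by rewrite -mul_mpolyC; exact: mdvd_mull. Qed.
Lemma mdvd_trans a b c : mdvd a b -> mdvd b c -> mdvd a c.
Proof. by move=> [x ->] [y ->]; exists (y * x); rewrite mulrA. Qed.
Lemma mdvd_sum a (I : Type) (r : seq I) (P : pred I) (F : I -> S) :
  (forall i, P i -> mdvd a (F i)) -> mdvd a (\sum_(i <- r | P i) F i).
Proof. by move=> aF; elim/big_ind: _ => //; [exact: mdvd0 | exact: mdvdD]. Qed.
Lemma mdvd_exp a e1 e2 : (e1 <= e2)%N -> mdvd (a ^+ e1) (a ^+ e2).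
Proof. by move=> le12; exists (a ^+ (e2 - e1)); rewrite -exprD subnK. Qed.
Lemma mdvdMM a b c d : mdvd a b -> mdvd c d -> mdvd (a * c) (b * d).
Proof. by move=> [x ->] [y ->]; exists (x * y); rewrite mulrACA. Qed.

Section Elimination.
Variables (t : 'rV[k]_n.+1) (m : 'I_n.+1).
Hypothesis tm : t 0 m != 0.

(** The substitution that solves [L t = 0] for ['X_m]. Its kernel is the ideal
    generated by [L t], which makes this ideal prime. *)
Definition elim_var : S -> S :=
  msubst (fun i => if i == m then 'X_m - (t 0 m)^-1 *: L t else 'X_i).

Lemma elim_var_linear_form : elim_var (L t) = 0.
Proof.
rewrite /elim_var msubst_linear_form (bigD1 m) //= eqxx scalerBr scalerA divff // scale1r.
rewrite (eq_bigr (fun i => t 0 i *: 'X_i)) => [|i /negbTE->//].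
by rewrite addrAC -(bigD1 m (P := xpredT) (F := fun i => t 0 i *: 'X_i)) //= subrr.
Qed.

Lemma elim_var_mod p : mdvd (L t) (p - elim_var p).
Proof.
elim/mpoly_ring_ind: p => [c|i|p q IHp IHq|p q IHp IHq].
- by rewrite /elim_var msubstC subrr; exact: mdvd0.
- rewrite /elim_var msubstX; case: eqP => [->|_]; last by rewrite subrr; exact: mdvd0.
  by rewrite subKr -mul_mpolyC; exists (t 0 m)^-1%:MP.
- by rewrite /elim_var rmorphD /= opprD addrACA; exact: mdvdD.
- have -> : p * q - elim_var (p * q) = (p - elim_var p) * q + elim_var p * (q - elim_var q).
    by rewrite /elim_var rmorphM /=; ring.
  by apply: mdvdD; [exact: mdvd_mulr|exact: mdvd_mull].
Qed.

Lemma elim_var_eq0 p : elim_var p = 0 <-> mdvd (L t) p.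
Proof.
split=> [p0|[c ->]]; first by have := elim_var_mod p; rewrite p0 subr0.
by rewrite /elim_var rmorphM /= -/(elim_var _) -/(elim_var (L t)) elim_var_linear_form mulr0.
Qed.
End Elimination.

Lemma row_neq0P (t : 'rV[k]_n.+1) : t != 0 -> exists m, t 0 m != 0.
Proof.
move=> t0; apply/existsP; apply: contraNT t0 => /existsPn t0.
by apply/eqP/rowP => i; rewrite mxE; apply/eqP; have := t0 i; rewrite negbK.
Qed.

Lemma linear_form_prime t p q : t != 0 -> mdvd (L t) (p * q) -> mdvd (L t) p \/ mdvd (L t) q.
Proof.
case/row_neq0P => m tm /(elim_var_eq0 tm)/eqP.
rewrite /elim_var rmorphM /= mulf_eq0 => /orP[] /eqP h; [left|right];
  exact/(elim_var_eq0 tm).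
Qed.

(** The order of vanishing along the hyperplane of [t]. Bounding the exponent
    by the size of [f] makes this a maximum over a finite type. *)
Definition vord (t : 'rV[k]_n.+1) (f : S) : nat :=
  \max_(e < msize f | `[< mdvd (L t ^+ e) f >]) e.

Lemma vord_dvd t f : mdvd (L t ^+ vord t f) f.
Proof.
rewrite /vord; elim/big_ind: _ => [|e1 e2 h1 h2|e /asboolP//].
  by rewrite expr0; exact: mdvd1l.
by rewrite /maxn; case: ifP.
Qed.

Lemma msize_linear_formX t e : t != 0 -> msize (L t ^+ e) = e.+1.
Proof.
move=> t0; have Lt0 : L t != 0 by rewrite linear_form_eq0.
elim: e => [|e IH]; first by rewrite expr0 msize1.
by rewrite exprS msizeM ?expf_neq0 // IH msize_linear_form.
Qed.

Lemma dvd_vord t f e : t != 0 -> f != 0 -> mdvd (L t ^+ e) f -> (e <= vord t f)%N.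
Proof.
move=> t0 f0 ef.
have ef' : (e < msize f)%N.
  case: (ef) => c fE; have c0 : c != 0.
    by apply: contraNneq f0 => c0; rewrite fE c0 mul0r.
  rewrite fE msizeM // ?expf_neq0 ?linear_form_eq0 // msize_linear_formX //.
  by have := msize_poly_eq0 c; rewrite (negbTE c0) addnS /=; case: (msize c) => //= x _; rewrite addSn ltnS leq_addl.
by have := @leq_bigmax_cond _ (fun i : 'I_(msize f) => `[< mdvd (L t ^+ i) f >]) (fun i => val i) (Ordinal ef') => /= -> //; apply/asboolP.
Qed.

Lemma vord_unique t f e h : t != 0 -> f != 0 -> f = h * L t ^+ e -> ~ mdvd (L t) h ->
  vord t f = e.
Proof.
move=> t0 f0 fE Nh; apply/eqP; rewrite eqn_leq andbC dvd_vord //=; last by exists h.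
rewrite leqNgt; apply/negP => lt; apply: Nh.
have [c] := mdvd_trans (mdvd_exp (L t) lt) (vord_dvd t f).
rewrite fE exprSr mulrA mulrAC => /mulIf -> //; first by exists c.
by rewrite expf_neq0 // linear_form_eq0.
Qed.

Lemma vordE t f : t != 0 -> f != 0 -> exists2 h, f = h * L t ^+ vord t f & ~ mdvd (L t) h.
Proof.
move=> t0 f0; have [h fE] := vord_dvd t f; exists h => // -[c hE].
have := @dvd_vord t f (vord t f).+1 t0 f0; rewrite ltnn => H.
suff : is_true false by [].
by apply: H; exists c; rewrite {1}fE hE exprS mulrA.
Qed.

Lemma vordM t f g : t != 0 -> f != 0 -> g != 0 -> vord t (f * g) = (vord t f + vord t g)%N.
Proof.
move=> t0 f0 g0; have [f' fE Nf] := vordE t0 f0; have [g' gE Ng] := vordE t0 g0.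
apply: (@vord_unique _ _ _ (f' * g')) => //; rewrite ?mulf_neq0 //.
  by rewrite {1}fE {1}gE exprD mulrACA.
by move/(linear_form_prime t0) => [].
Qed.

Lemma vord_gt0 t f : t != 0 -> f != 0 -> (0 < vord t f)%N <-> mdvd (L t) f.
Proof.
move=> t0 f0; split=> [m0|]; last by rewrite -{1}[L t]expr1; exact: dvd_vord.
by apply: mdvd_trans (vord_dvd t f); rewrite -{1}[L t]expr1; exact: mdvd_exp.
Qed.

Lemma mdvd_linear_form t s : t != 0 -> s != 0 -> mdvd (L t) (L s) <-> exists c, s = c *: t.
Proof.
move=> t0 s0; split=> [[c LsE]|[c ->]]; last first.
  by rewrite linearZ /= -mul_mpolyC; exists c%:MP.
have c0 : c != 0.
  by apply: contraNneq s0 => c0; rewrite -linear_form_eq0 LsE c0 mul0r.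
have /eqP := msize_linear_form s0.
rewrite LsE msizeM ?linear_form_eq0 // msize_linear_form // addnC /= eqSS => /eqP/(@eq_leq _ _)/msize1_polyC cE.
exists c@_0; apply/eqP; rewrite -subr_eq0 -linear_form_eq0 linearB linearZ /= LsE {1}cE.
by rewrite mul_mpolyC subrr.
Qed.

Lemma vord_linear_form t s : t != 0 -> s != 0 -> vord t (L s) = `[< exists c, s = c *: t >].
Proof.
move=> t0 s0; have Ls0 : L s != 0 by rewrite linear_form_eq0.
case: asboolP => [[c sE]|N]; last first.
  apply/eqP; rewrite -leqn0 leqNgt; apply/negP => /(vord_gt0 t0 Ls0)/(mdvd_linear_form t0 s0).
  exact: N.
apply: (@vord_unique _ _ _ c%:MP) => //=.
  by rewrite sE linearZ expr1 mul_mpolyC.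
have c0 : c != 0 by apply: contraNneq s0 => c0; rewrite sE c0 scale0r.
move=> [h hE]; have h0 : h != 0.
  by apply: contraNneq c0 => h0; rewrite -(@mpolyC_eq0 n.+1) hE h0 mul0r.
have := msizeC n.+1 c; rewrite hE msizeM ?linear_form_eq0 // msize_linear_form // c0 addnC /=.
by move=> [] /eqP; rewrite msize_poly_eq0 (negbTE h0).
Qed.

Lemma vordC t c : t != 0 -> c != 0 -> vord t c%:MP = 0%N.
Proof.
move=> t0 c0; rewrite /vord big1 // => e _.
by case: e => [[|e] /=]; rewrite msizeC c0.
Qed.

(** Units of the half-space are quotients of such products. *)
Definition is_split (f : S) := exists (c : k) (s : seq 'rV[k]_n.+1),
  [/\ c != 0, all (fun t => t != 0) s & f = c *: \prod_(t <- s) L t].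

Lemma split_neq0 f : is_split f -> f != 0.
Proof.
move=> [c [s [c0 /allP s0 ->]]]; rewrite -mul_mpolyC mulf_neq0 ?mpolyC_eq0 //.
by rewrite prodf_seq_neq0; apply/allP => t /s0; rewrite linear_form_eq0.
Qed.

Lemma splitM f g : is_split f -> is_split g -> is_split (f * g).
Proof.
move=> [c [s [c0 s0 ->]]] [d [r [d0 r0 ->]]]; exists (c * d), (s ++ r).
split; rewrite ?mulf_neq0 ?all_cat ?s0 // big_cat /=.
by rewrite -scalerAl -scalerAr scalerA.
Qed.

Lemma splitC c : c != 0 -> is_split c%:MP.
Proof. by exists c, [::]; split => //; rewrite big_nil -mul_mpolyC mulr1. Qed.

Lemma is_split1 : is_split 1.
Proof. by rewrite -mpolyC1; apply: splitC; exact: oner_neq0. Qed.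

Lemma split_linear_form t : t != 0 -> is_split (L t).
Proof.
move=> t0; exists 1, [:: t]; rewrite oner_neq0 /= t0; split => //.
by rewrite big_seq1 scale1r.
Qed.

Lemma splitX f e : is_split f -> is_split (f ^+ e).
Proof.
by move=> sf; elim: e => [|e]; [exact: is_split1|rewrite exprS; exact: splitM].
Qed.

Lemma split_prod (I : Type) (r : seq I) (P : pred I) (F : I -> S) :
  (forall i, P i -> is_split (F i)) -> is_split (\prod_(i <- r | P i) F i).
Proof.
by move=> sF; elim/big_ind: _ => //; [exact: is_split1|exact: splitM].
Qed.

(** The linear factors of a split form are prime, so each of them can be
    cancelled from one of the two factors. *)
Lemma split_factor f g : is_split (f * g) -> is_split f.
Proof.
move=> [c [s]]; elim: s f g => [|t s IH] f g [c0 s0 fgE].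
  move: fgE; rewrite big_nil -mul_mpolyC mulr1 => fgE.
  have : msize (f * g) = 1%N by rewrite fgE msizeC c0.
  have fg0 : f * g != 0 by rewrite fgE mpolyC_eq0.
  move: (fg0); rewrite mulf_eq0 negb_or => /andP[f0 g0].
  rewrite msizeM // => e1.
  have /msize_poly1P[d d0 ->] : msize f == 1%N.
    move: e1; rewrite -msize_poly_eq0 in f0; rewrite -msize_poly_eq0 in g0.
    by case: (msize f) f0 => // -[|a]; case: (msize g) g0 => // b _ _; rewrite !addSn addnS.
  exact: splitC.
move: s0 => /= /andP[t0 s0].
rewrite big_cons in fgE.
have : mdvd (L t) (f * g).
  by rewrite fgE; apply: mdvdZ; apply: mdvd_mulr; exists 1; rewrite mul1r.
have Lt0 : L t != 0 by rewrite linear_form_eq0.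
case/(linear_form_prime t0) => -[h hE].
  rewrite hE; apply: splitM; last exact: split_linear_form.
  apply: (IH h g); split => //; apply: (mulIf Lt0).
  by rewrite mulrAC -hE fgE -scalerAl; congr (_ *: _); rewrite mulrC.
apply: (IH f h); split => //; apply: (mulIf Lt0).
by rewrite -mulrA -hE fgE -scalerAl; congr (_ *: _); rewrite mulrC.
Qed.

Lemma split_ind (P : S -> Prop) : (forall c, c != 0 -> P c%:MP) ->
  (forall t f, t != 0 -> is_split f -> P f -> P (L t * f)) -> forall f, is_split f -> P f.
Proof.
move=> PC PM _ [c [s [c0 s0 ->]]]; elim: s s0 => [_|t s IH /= /andP[t0 s0]].
  by rewrite big_nil -mul_mpolyC mulr1; exact: PC.
rewrite big_cons scalerAr; apply: PM => //; last exact: IH.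
by exists c, s.
Qed.

End LinearForms.

Section Counting.
Variables (k : finFieldType) (n : nat).
Local Notation S := {mpoly k[n.+1]}.
Local Notation L := (@linear_form k n).
Local Notation q := #|k|.

(** [L s] vanishes to order one along the [q - 1] rows proportional to [s]. The
    sums below thus count every hyperplane [q - 1] times, which saves choosing
    a representative for each of them. *)
Lemma sum_vord_linear_form s : s != 0 -> (\sum_(t : 'rV[k]_n.+1 | t != 0%R) vord t (L s) = q.-1)%N.
Proof.
move=> s0.
transitivity (\sum_(t : 'rV[k]_n.+1 | t != 0%R) `[< exists c : k, s = c *: t >])%N.
  by apply: eq_bigr => t t0; rewrite vord_linear_form.
rewrite -big_mkcondr /= sum1_card -(cardC1 (0 : k)).
rewrite -(fintype.card_image (f := fun c : k => c *: s)); last first.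
  move=> a b /eqP; rewrite -subr_eq0 -scalerBl scaler_eq0 (negbTE s0) orbF subr_eq0.
  by move/eqP.
apply: eq_card => t; rewrite -topredE /=.
apply/andP/fintype.imageP => [[t0 /asboolP[c sE]]|[c]].
  have c0 : c != 0 by apply: contraNneq s0 => c0; rewrite sE c0 scale0r.
  by exists c^-1; rewrite ?inE ?invr_eq0 // sE scalerA mulVf // scale1r.
rewrite inE => c0 ->; rewrite scaler_eq0 negb_or c0 s0; split => //.
by apply/asboolP; exists c^-1; rewrite scalerA mulVf // scale1r.
Qed.

Lemma sum_vordM f g : f != 0 -> g != 0 -> (\sum_(t : 'rV[k]_n.+1 | t != 0%R) vord t (f * g) =
  \sum_(t : 'rV[k]_n.+1 | t != 0%R) vord t f + \sum_(t : 'rV[k]_n.+1 | t != 0%R) vord t g)%N.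
Proof.
by move=> f0 g0; rewrite -big_split; apply: eq_bigr => t t0; rewrite vordM.
Qed.

(** By induction on the degree, dividing by one linear form at a time. *)
Lemma sum_vord_le f : f != 0 -> (\sum_(t : 'rV[k]_n.+1 | t != 0%R) vord t f <= q.-1 * (msize f).-1)%N.
Proof.
have [d] := ubnP (msize f); elim: d f => // d IH f ltd f0.
have [/existsP[t /andP[t0 /asboolP[h fE]]]|/existsPn N] :=
   boolP [exists t, (t != 0) && `[< mdvd (L t) f >]].
  have Lt0 : L t != 0 by rewrite linear_form_eq0.
  have h0 : h != 0 by apply: contraNneq f0 => h0; rewrite fE h0 mul0r.
  have sE : msize f = (msize h).+1.
    by rewrite fE msizeM // msize_linear_form // addnC.
  rewrite fE sum_vordM // sum_vord_linear_form // -fE sE /=.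
  have := IH h _ h0; rewrite -msize_poly_eq0 in h0.
  have : (msize h < d)%N by rewrite -ltnS -sE.
  case: (msize h) h0 => //= m _ lt /(_ lt); rewrite mulnS addnC leq_add2l; exact.
rewrite big1 // => t t0; apply/eqP; rewrite -leqn0 leqNgt; apply/negP => /(vord_gt0 t0 f0) dv.
by have := N t; rewrite t0 /= => /asboolP.
Qed.

Lemma sum_vord_split f : is_split f -> (\sum_(t : 'rV[k]_n.+1 | t != 0%R) vord t f = q.-1 * (msize f).-1)%N.
Proof.
elim/split_ind => [c c0|t {}f t0 sf IH].
  by rewrite msizeC c0 muln0 big1 // => t t0; rewrite vordC.
have f0 := split_neq0 sf.
have Lt0 : L t != 0 by rewrite linear_form_eq0.
rewrite sum_vordM // IH sum_vord_linear_form // msizeM // msize_linear_form //=.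
by rewrite -msize_poly_eq0 in f0; case: (msize f) f0 => //= m _; rewrite mulnS.
Qed.

End Counting.

(** * An inequality between powers *)

Section PowerInequality.
Local Open Scope nat_scope.

Lemma bernoulli q k : 2 <= q -> 1 + k * q.-1 <= q ^ k.
Proof.
case: q => // q _; elim: k => // k IH; rewrite expnS /=.
apply: leq_trans (leq_mul (leqnn _) IH) => /=; nia.
Qed.

Lemma bernoulli_lt q k : 2 <= q -> 2 <= k -> 1 + k * q.-1 < q ^ k.
Proof.
case: q => // q q2; case: k => // -[//|k] _; rewrite expnS.
apply: leq_trans (leq_mul (leqnn _) (bernoulli k.+1 q2)) => /=; nia.
Qed.

(** The extreme case of the next lemma. The induction on [k] multiplies the
    inequality by [q] and closes the gap with the inequality of Bernoulli. *)
Lemma power_gap_diag q k : 2 <= q -> 2 <= k ->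
  k.+1 * q ^ k + k.-1 < k.-1 * q ^ k.+1 + k.+1 * q.
Proof.
move=> q2; case: k => // -[//|k _].
elim: k => [|k IH].
  rewrite /= !expnS expn0 !muln1; case: q q2 => // -[//|q] _; nia.
have := bernoulli k.+3 q2; move: IH; rewrite /= [q ^ k.+4]expnS [q ^ k.+3]expnS.
set P := q ^ k.+2; case: q q2 @P => // q q2 P IH.
rewrite /= => B.
have : q * (1 + k.+3 * q) <= q * (q.+1 * P) by rewrite leq_mul.
have : q.+1 * (k.+3 * P + k.+1) < q.+1 * (k.+1 * (q.+1 * P) + k.+3 * q.+1) by rewrite ltn_mul2l.
nia.
Qed.

(** Convexity: the mean of q, ..., q^(k-1) is less than the mean of
    1, ..., q^n when k <= n; here both are multiplied by [q - 1]. *)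
Lemma power_gap q k n : 2 <= q -> 2 <= k <= n ->
  n.+1 * q ^ k + k.-1 < k.-1 * q ^ n.+1 + n.+1 * q.
Proof.
move=> q2 /andP[k2 kn]; rewrite -(subnK kn); elim: (n - k) => [|r IH].
  exact: power_gap_diag.
move: IH; rewrite !addSn; set m := (r + k).+1; set A := q ^ k.
have : A <= q ^ m by rewrite /A /m leq_exp2l //; lia.
rewrite [q ^ m.+1]expnS; set P := q ^ m.
case: k k2 kn A m P => // -[//|k] _ kn A m P /= AP IH.
nia.
Qed.

(** [N] is the number of nonzero vectors of a subspace of dimension at most [k]
    in a space of dimension [n + 1]. The summand [0 < N] records that the
    inequality is strict unless the subspace vanishes. *)
Lemma layer_bound q k n N : 2 <= q -> 0 < n -> k <= n -> N < q ^ k ->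
  n.+1 * N + (0 < N) <= (q ^ n.+1).-1 * k.
Proof.
move=> q2 n0 kn Nk; case: N Nk => [|N] Nk; first by rewrite muln0.
case: k kn Nk => [|[|k]] kn Nk; first by rewrite expn0 in Nk.
  have := @bernoulli_lt q n.+1 q2 n0; rewrite expn1 in Nk; nia.
have := @power_gap q k.+2 n q2 kn.
have := @bernoulli_lt q n.+1 q2 n0.
move: Nk; set A := q ^ k.+2; set B := q ^ n.+1 => /=; nia.
Qed.

(** For the largest layer, one of its [k] dimensions is traded for [q - 1] vectors;
    the inequality is then strict unless the layer is a line. *)
Lemma first_layer_bound q k n N : 2 <= q -> 0 < k <= n -> N < q ^ k ->
  n.+1 * N + (q.-1 < N) <= (q ^ n.+1).-1 * k.-1 + n.+1 * q.-1.
Proof.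
move=> q2 /andP[k0 kn] Nk.
case: k k0 kn Nk => [|[|k]] // _ kn Nk.
  rewrite expn1 in Nk; have -> : (q.-1 < N) = false by lia.
  rewrite /=; nia.
have := @power_gap q k.+2 n q2 kn.
have := @bernoulli q n.+1 q2.
move: Nk; set A := q ^ k.+2; set B := q ^ n.+1 => /=; case: (q.-1 < N); nia.
Qed.

End PowerInequality.

(** * Filtrations of a vector space over a finite field *)

Section RowReplacement.
Variables (k : fieldType) (n : nat).

(** The identity matrix with row [i] replaced by [a], written as a perturbation
    of rank one because the inverse is then explicit. *)
Definition replace_row (i : 'I_n) (a : 'rV[k]_n) : 'M[k]_n :=
  1%:M + delta_mx i (0 : 'I_1) *m (a - delta_mx 0 i).

Lemma row_replace_row i (a : 'rV[k]_n) j : row j (replace_row i a) = if j == i then a else delta_mx 0 j.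
Proof.
rewrite rowE /replace_row mulmxDr mulmx1 mulmxA mul_delta_mx_cond.
case: eqP => [->|_]; last by rewrite mulr0n mul0mx addr0.
by rewrite mulr1n mulmxBr -rowE !rowE !mul_delta_mx addrC -rowE row_id subrK.
Qed.

Lemma replace_row_unit i (a : 'rV[k]_n) : a 0 i != 0 -> replace_row i a \in unitmx.
Proof.
move=> ai; set b := a - delta_mx 0 i.
have bE : b *m delta_mx i (0 : 'I_1) = (a 0 i - 1)%:M.
  apply/matrixP => x y; rewrite !ord1 mxE (bigD1 i) //= !mxE !eqxx mulr1.
  by rewrite big1 ?addr0 // => j /negbTE ji; rewrite !mxE ji mulr0.
suff : replace_row i a *m (1%:M - (a 0 i)^-1 *: (delta_mx i (0 : 'I_1) *m b)) = 1%:M.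
  by case/mulmx1_unit.
rewrite /replace_row -/b; set Y := _ *m b.
have YY : Y *m Y = (a 0 i - 1) *: Y.
  by rewrite /Y -mulmxA [b *m (_ *m _)]mulmxA bE mul_scalar_mx -scalemxAr.
have aY : Y + (a 0 i - 1) *: Y = a 0 i *: Y by rewrite scalerBl scale1r addrC subrK.
by rewrite mulmxBr mulmx1 -scalemxAr mulmxDl mul1mx YY aY scalerA mulVf // scale1r addrK.
Qed.

Lemma unitmx_row_delta (v : 'rV[k]_n) i : v 0 i != 0 ->
  exists2 h : 'M[k]_n, h \in unitmx & v *m h = delta_mx 0 i.
Proof.
move=> vi; exists (invmx (replace_row i v)); first by rewrite unitmx_inv replace_row_unit.
apply: (canLR (mulmxK (replace_row_unit vi))).
by rewrite -rowE row_replace_row eqxx.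
Qed.

End RowReplacement.

Lemma card_row_support (k : finFieldType) n (K : pred 'I_n) :
  (#|[pred a : 'rV[k]_n | [forall j, (a 0%R j != 0%R) ==> K j]]| <= #|k| ^ #|K|)%N.
Proof.
rewrite -(card_pffun_on 0 K (pred_of_simpl (@predT k))).
set F := fun a : 'rV[k]_n => [ffun j => a 0 j].
have injF : injective F.
  by move=> a b /ffunP ab; apply/rowP => j; have := ab j; rewrite !ffunE.
rewrite -(fintype.card_image injF); apply: subset_leq_card.
apply/fintype.subsetP => g /fintype.imageP[a]; rewrite inE => /forallP aK ->.
apply/pffun_onP; split=> [|x /fintype.imageP[j _ ->]]; last by [].
by apply/supportP => j jK; rewrite ffunE; apply: contraNeq jK => /(implyP (aK j)).
Qed.

Section Filtration.
Variables (k : finFieldType) (n : nat) (mu : 'rV[k]_n.+1 -> nat).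
Local Notation q := #|k|.

(** The value of [mu] at the zero vector is arbitrary, whereas each step of the
    filtration has to be a subspace. *)
Definition level s v := (v == 0) || (s <= mu v)%N.
Hypothesis levelD : forall s u v, level s u -> level s v -> level s (u + v).
Hypothesis levelZ : forall s c v, level s v -> level s (c *: v).

Definition row_weight (G : 'M[k]_n.+1) := (\sum_j mu (row j G))%N.

(** A basis of maximal weight is adapted to the filtration: this is an exchange
    argument, see [heaviest_adapted]. *)
Definition heaviest : 'M[k]_n.+1 := [arg max_(G > 1%:M in unitmx) row_weight G].

Lemma heaviest_unit : heaviest \in unitmx.
Proof. by rewrite /heaviest; case: arg_maxnP => //; exact: unitmx1. Qed.

Lemma heaviestP G : G \in unitmx -> (row_weight G <= row_weight heaviest)%N.
Proof. by rewrite /heaviest; case: arg_maxnP => [|? _]; [exact: unitmx1|exact]. Qed.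

(** If a basis vector outside the layer were needed to express a vector of the
    layer, exchanging the two would give a heavier basis. *)
Lemma heaviest_adapted s (a : 'rV_n.+1) j :
  level s (a *m heaviest) -> a 0 j != 0 -> (s <= mu (row j heaviest))%N.
Proof.
move=> sa aj; rewrite leqNgt; apply/negP => lt.
set G := replace_row j a *m heaviest.
have uG : G \in unitmx by rewrite unitmx_mul replace_row_unit // heaviest_unit.
have rG i : row i G = if i == j then a *m heaviest else row i heaviest.
  by rewrite row_mul row_replace_row; case: eqP => // _; rewrite -rowE.
have := heaviestP uG; rewrite leqNgt => /negP; apply.
rewrite /row_weight (bigD1 j) //= [X in (_ < X)%N](bigD1 j) //= rG eqxx.
under [X in (_ < _ + X)%N]eq_bigr => i /negbTE ij do rewrite rG ij.
rewrite ltn_add2r (leq_trans lt) //; case/orP: sa => // /eqP a0.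
have : a = 0 by rewrite -[a](mulmxK heaviest_unit) a0 mul0mx.
by move/rowP/(_ j)/eqP; rewrite mxE (negbTE aj).
Qed.

(** The dimension of the layer [s < mu], computed in the adapted basis. *)
Definition jumps (s : nat) := #|[pred j | (s < mu (row j heaviest))%N]|.

Lemma card_level s : (#|[pred v | (v != 0%R) && (s < mu v)]| < q ^ jumps s)%N.
Proof.
pose A := [pred a : 'rV[k]_n.+1 | [forall j, (a 0 j != 0%R) ==> (s < mu (row j heaviest))%N]].
apply: leq_trans (card_row_support k [pred j | (s < mu (row j heaviest))%N]).
rewrite -/A.
have injF : injective (fun v : 'rV[k]_n.+1 => v *m invmx heaviest).
  by apply: (can_inj (g := fun v => v *m heaviest)) => v; rewrite mulmxKV // heaviest_unit.
rewrite [X in (_ < X)%N](cardD1 0) /A inE; have -> /= : [forall j, ((0 : 'rV[k]_n.+1) 0 j != 0) ==> (s < mu (row j heaviest))%N].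
  by apply/forallP => j; rewrite mxE eqxx.
rewrite add1n ltnS -(fintype.card_image injF); apply: subset_leq_card.
apply/fintype.subsetP => w /fintype.imageP[v]; rewrite !inE => /andP[v0 sv] ->.
apply/andP; split.
  apply: contraNneq v0 => /(congr1 (mulmx^~ heaviest)).
  by rewrite mulmxKV ?heaviest_unit // mul0mx => ->.
apply/forallP => j; apply/implyP; apply: heaviest_adapted.
by rewrite mulmxKV ?heaviest_unit // /level sv orbT.
Qed.

Lemma sum_layers (I : finType) (P : pred I) (F : I -> nat) B : (forall i, P i -> F i <= B)%N ->
  (\sum_(i | P i) F i = \sum_(s < B) #|[pred i | P i && (s < F i)]|)%N.
Proof.
move=> FB; transitivity (\sum_(i | P i) \sum_(s < B) (s < F i))%N.
  apply: eq_bigr => i Pi; rewrite -big_mkcond /= sum1_card.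
  rewrite -[LHS]card_ord -(fintype.card_image (f := widen_ord (FB i Pi))); last first.
    by move=> x y /(congr1 val) /= /val_inj.
  apply: eq_card => s; apply/fintype.imageP/idP => [[x _ ->]|si].
    exact: (ltn_ord x).
  by exists (Ordinal si) => //; apply: val_inj.
rewrite exchange_big; apply: eq_bigr => s _.
by rewrite -big_mkcondr sum1_card.
Qed.

(** Both sides are sums over the layers. The first layer is bounded by
    [first_layer_bound] and the others by [layer_bound]; the summand [q - 1 < T]
    keeps track of strictness, and it is what determines the degree later on.
    A vector of order 0 guarantees that the layers are proper subspaces. *)
Lemma filtration_bound : (2 <= q)%N -> (0 < n)%N -> (exists2 v, v != 0 & mu v = 0%N) ->
  let T := (\sum_(v | v != 0%R) mu v)%N in
  (n.+1 * T + (q.-1 < T) <= (q ^ n.+1).-1 * (row_weight heaviest).-1 + n.+1 * q.-1)%N.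
Proof.
move=> q2 n0 [v0 v0n mu0] /=; set T := (\sum_(v | _) _)%N.
pose B := (\sum_v mu v).+1%N.
have leB v : (mu v <= B)%N by rewrite /B (bigD1 v) //= ltnW // ltnS leq_addr.
have kn s : (jumps s <= n)%N.
  have [j /eqP j0] : exists j, mu (row j heaviest) == 0%N.
    apply/existsP; apply: contraT => /existsPn N.
    suff : level 1 v0 by rewrite /level (negbTE v0n) mu0.
    rewrite -(mulmxKV heaviest_unit v0) mulmx_sum_row.
    elim/big_ind: _ => [|u v|j _]; first by rewrite /level eqxx.
      exact: levelD.
    by apply: levelZ; rewrite /level lt0n N orbT.
  rewrite /jumps -ltnS -[X in (_ < X)%N]card_ord.
  apply: proper_card; apply/properP; split; first exact/fintype.subsetP.
  by exists j; rewrite ?inE ?j0.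
have TE : T = (\sum_(s < B) #|[pred v | (v != 0%R) && (s < mu v)]|)%N by exact: sum_layers.
have WE : row_weight heaviest = (\sum_(s < B) jumps s)%N by exact: sum_layers.
have Nk s := card_level s.
move: TE WE; rewrite /B !big_ord_recl; set N0 := #|_|; set T' := (\sum_(i < _) _)%N.
set W' := (\sum_(i < _) _)%N => TE WE.
have bound : (n.+1 * T' + (0 < T') <= (q ^ n.+1).-1 * W')%N.
  apply: (big_rec2 (fun a b => n.+1 * a + (0 < a) <= (q ^ n.+1).-1 * b)%N) => [|i N W _ IH].
    by rewrite muln0.
  have := layer_bound q2 n0 (kn (bump 0 i)) (Nk (bump 0 i)).
  set N1 := #|_|; rewrite !mulnDr -/(jumps (bump 0 i)) => H.
  have -> : (0 < N1 + N)%N = ((0 < N1) || (0 < N))%N by lia.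
  move: H IH; case: (0 < N1)%N; case: (0 < N)%N => /=; lia.
have N0E : (N0 < q ^ jumps 0)%N by exact: Nk.
have [k0|k0] := posnP (jumps 0).
  have W0 : W' = 0%N.
    rewrite /W' big1 // => i _; apply/eqP; rewrite -leqn0 -[X in (_ <= X)%N]k0.
    apply: subset_leq_card; by apply/fintype.subsetP => j; rewrite !inE; exact: leq_trans.
  have T'0 : T' = 0%N by move: bound; rewrite W0 muln0; case: (T').
  by move: N0E; rewrite k0 TE T'0 expn0 ltnS leqn0 => /eqP->; rewrite muln0.
have := @first_layer_bound q (jumps 0) n N0 q2 _ N0E; rewrite k0 kn => /(_ isT).
rewrite WE TE; set J := jumps 0 in k0 *; set Q := (q ^ _).-1 in bound *.
have -> : ((jumps (@ord0 (\sum_v mu v)%N) + W').-1 = J.-1 + W')%N.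
  by rewrite -/J; case: (J) k0.
rewrite !mulnDr => H.
have : ((q.-1 < N0 + T') <= (q.-1 < N0) + (0 < T'))%N by lia.
move: H bound; move: (n.+1 * N0)%N (n.+1 * T')%N (Q * W')%N (Q * J.-1)%N (n.+1 * q.-1)%N.
move: (nat_of_bool _) (nat_of_bool _) (nat_of_bool _); lia.
Qed.
End Filtration.

(** * The Jacobian of a system of forms *)

Section Jacobian.
Variables (k : fieldType) (n : nat).
Local Notation S := {mpoly k[n.+1]}.
Local Notation L := (@linear_form k n).

Definition comb (f : 'I_n.+1 -> S) (l : 'rV[k]_n.+1) : S := \sum_i l 0 i *: f i.

Lemma combD f l l' : comb f (l + l') = comb f l + comb f l'.
Proof. by rewrite -big_split; apply: eq_bigr => i _; rewrite mxE scalerDl. Qed.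
Lemma combZ f c l : comb f (c *: l) = c *: comb f l.
Proof. by rewrite scaler_sumr; apply: eq_bigr => i _; rewrite mxE scalerA. Qed.
Lemma comb0 f : comb f 0 = 0.
Proof. by rewrite /comb big1 // => i _; rewrite mxE scale0r. Qed.

Definition dirderiv (c : 'cV[k]_n.+1) (f : S) : S := \sum_r c r 0 *: f^`M(r).

Lemma dirderivD c f g : dirderiv c (f + g) = dirderiv c f + dirderiv c g.
Proof. by rewrite -big_split; apply: eq_bigr => r _; rewrite mderivD scalerDr. Qed.
Lemma dirderiv0 c : dirderiv c 0 = 0.
Proof. by rewrite /dirderiv big1 // => r _; rewrite mderiv0 scaler0. Qed.
Lemma dirderivZ c a f : dirderiv c (a *: f) = a *: dirderiv c f.
Proof.
by rewrite scaler_sumr; apply: eq_bigr => r _; rewrite mderivZ !scalerA mulrC.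
Qed.
Lemma dirderiv_sum c (I : Type) (r : seq I) (P : pred I) (F : I -> S) :
  dirderiv c (\sum_(i <- r | P i) F i) = \sum_(i <- r | P i) dirderiv c (F i).
Proof. exact: (big_morph _ (dirderivD c) (dirderiv0 c)). Qed.
Lemma dirderivM c f g : dirderiv c (f * g) = dirderiv c f * g + f * dirderiv c g.
Proof.
rewrite mulr_suml mulr_sumr -big_split; apply: eq_bigr => r _.
by rewrite mderivM scalerDr scalerAl scalerAr.
Qed.

Lemma dirderivX c f e : dirderiv c (f ^+ e.+1) = e.+1%:R * f ^+ e * dirderiv c f.
Proof.
elim: e => [|e IH]; first by rewrite !expr1 expr0 !mul1r.
rewrite exprS dirderivM IH exprS -[e.+2]addn1 natrD; ring.
Qed.

Lemma dirderiv_linear_form c t : dirderiv c (L t) = ((t *m c) 0 0)%:MP.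
Proof.
rewrite mxE rmorph_sum /=; apply: eq_bigr => r _.
have -> : (L t)^`M(r) = (t 0 r)%:MP.
  rewrite raddf_sum (bigD1 r) //= mderivZ mderivX mnm1E eqxx scale1r big1 ?addr0.
    by rewrite -[(_ - _)%MM]/(U_(r) - U_(r))%MM -{1}[U_(r)%MM]add0m addmK mpolyX0 -mul_mpolyC mulr1.
  by move=> j /negbTE jr; rewrite mderivZ mderivX mnm1E jr scale0r scaler0.
by rewrite -mul_mpolyC -mpolyCM mulrC.
Qed.

(** A derivative lowers the order along [L t] by at most one. *)
Lemma dvd_mul_dirderiv t c e h : mdvd (L t ^+ e) (L t * dirderiv c (h * L t ^+ e)).
Proof.
rewrite dirderivM; case: e => [|e]; first by rewrite expr0; exact: mdvd1l.
rewrite dirderivX exprS.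
exists (L t * dirderiv c h + h * e.+1%:R * dirderiv c (L t)); ring.
Qed.

(** A derivative in a direction tangent to the hyperplane does not lower the
    order: it kills [L t]. *)
Lemma dvd_dirderiv t c e h : (t *m c) 0 0 = 0 -> mdvd (L t ^+ e) (dirderiv c (h * L t ^+ e)).
Proof.
move=> tc; rewrite dirderivM; case: e => [|e]; first by rewrite expr0; exact: mdvd1l.
by rewrite dirderivX dirderiv_linear_form tc mpolyC0 !mulr0 addr0; exists (dirderiv c h).
Qed.

(** The columns of [C] are directions. The first column contains the forms
    themselves: up to a power of f_0, the determinant is the Jacobian of the affine
    coordinates f_j / f_0 with respect to the directions of [C]. The determinant
    of all partial derivatives would not do, since by the identity of Euler it
    vanishes as soon as the characteristic divides the degree. *)
Definition jac_mx (f : 'I_n.+1 -> S) (C : 'M[k]_(n.+1, n)) : 'M[S]_(1 + n) :=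
  row_mx (\col_j f j) (\matrix_(j, i) dirderiv (col i C) (f j)).

Definition jacobian f C := \det (jac_mx f C).

Lemma jacobian_comb (G : 'M[k]_n.+1) f C :
  jacobian (fun j => comb f (row j G)) C = (\det G)%:MP * jacobian f C.
Proof.
rewrite -det_map_mx -det_mulmx; congr (\det _).
apply: etrans (esym (@mul_mx_row _ n.+1 n.+1 1 n _ _ _)); congr row_mx; apply/matrixP => j i; rewrite !mxE.
  by apply: eq_bigr => r _; rewrite !mxE mul_mpolyC.
rewrite dirderiv_sum; apply: eq_bigr => r _; by rewrite !mxE mul_mpolyC dirderivZ.
Qed.

Lemma jacobian_mulmx f C (h : 'M[k]_n) :
  jacobian f (C *m h) = jacobian f C * (\det h)%:MP.
Proof.
have -> : (\det h)%:MP = \det (block_mx (1%:M : 'M_1) 0 0 (map_mx (@mpolyC n.+1 k) h)) :> S.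
  by rewrite det_ublock det1 mul1r det_map_mx.
rewrite -det_mulmx; congr (\det _).
rewrite /jac_mx mul_row_block mulmx1 !mulmx0 addr0 add0r; congr row_mx.
apply/matrixP => j i; rewrite !mxE.
under [RHS]eq_bigr => s _ do rewrite !mxE mulrC mul_mpolyC scaler_sumr.
rewrite exchange_big; apply: eq_bigr => r _ /=.
rewrite !mxE scaler_suml; apply: eq_bigr => s _.
by rewrite !mxE scalerA mulrC.
Qed.

(** Every term of the determinant contains exactly one entry of column [i0]. *)
Lemma dvd_det (m : nat) (a : 'I_m -> S) (A : 'M[S]_m) (b : S) (i0 : 'I_m) :
  (forall j i, i != i0 -> mdvd (a j) (A j i)) -> (forall j, mdvd (a j) (b * A j i0)) ->
  mdvd (\prod_j a j) (b * \det A).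
Proof.
move=> aA aA0; rewrite /determinant mulr_sumr; apply: mdvd_sum => s _.
rewrite mulrCA; apply: mdvd_mull.
have sj0 : s ((s^-1)%g i0) = i0 by rewrite permKV.
rewrite (bigD1 ((s^-1)%g i0)) //= [X in mdvd _ (b * X)](bigD1 ((s^-1)%g i0)) //= mulrA sj0.
apply: mdvdMM; first exact: aA0.
elim/big_ind2: _ => [|x y z w h1 h2|j jn]; [exact: mdvd1l|exact: mdvdMM|].
apply: aA; apply: contraNneq jn => /(congr1 (fun i => (s^-1)%g i)).
by rewrite permK => ->.
Qed.

Lemma dvd_det_all (m : nat) (a : 'I_m -> S) (A : 'M[S]_m) :
  (forall j i, mdvd (a j) (A j i)) -> mdvd (\prod_j a j) (\det A).
Proof.
move=> aA; rewrite /determinant; apply: mdvd_sum => s _; apply: mdvd_mull.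
by elim/big_ind2: _ => [|x y z w h1 h2|j jn]; [exact: mdvd1l|exact: mdvdMM|].
Qed.

Lemma jacobian_dvd_tangent f C t (e : 'I_n.+1 -> nat) : t *m C = 0 ->
  (forall j, mdvd (L t ^+ e j) (f j)) -> mdvd (L t ^+ (\sum_j e j)) (jacobian f C).
Proof.
move=> tC ef; have [h hE] := choice ef; rewrite -prodrXr.
apply: (dvd_det_all (m := n.+1)) => j i; rewrite -[X in _ X](_ : jac_mx f C j i = _) //.
rewrite mxE; case: splitP => i' _; rewrite !mxE; first exact: ef.
rewrite hE; apply: dvd_dirderiv.
by rewrite colE mulmxA -colE tC !mxE.
Qed.

(** The directions of [C] can be changed to a basis of their span in which only
    one of them is transversal to the hyperplane of [t]. *)
Lemma jacobian_dvd f C t (e : 'I_n.+1 -> nat) :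
  (forall j, mdvd (L t ^+ e j) (f j)) -> mdvd (L t ^+ (\sum_j e j)) (L t * jacobian f C).
Proof.
move=> ef; have [tC|/eqP tC] := eqVneq (t *m C) 0.
  by apply: mdvd_mull; exact: jacobian_dvd_tangent.
have [i0 ti0] : exists i, (t *m C) 0 i != 0.
  apply/existsP; apply: contra_notT tC => /existsPn N; apply/rowP => i; rewrite [RHS]mxE.
  by apply/eqP; have := N i; rewrite negbK.
have [h uh hE] := unitmx_row_delta ti0.
have dh : \det h != 0 by rewrite -unitfE -unitmxE.
suff : mdvd (L t ^+ (\sum_j e j)) (L t * jacobian f (C *m h)).
  rewrite jacobian_mulmx [X in L t * X]mulrC mulrCA mul_mpolyC => /(mdvdZ ((\det h)^-1)).
  by rewrite scalerA mulVf // scale1r.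
have [g gE] := choice ef; rewrite -prodrXr.
apply: (dvd_det (m := n.+1) (i0 := rshift 1 i0)) => [j i ii0|j].
  rewrite -[X in _ X](_ : jac_mx f (C *m h) j i = _) //.
  rewrite mxE; case: splitP => i' iE; rewrite !mxE; first exact: ef.
  rewrite gE; apply: dvd_dirderiv; rewrite colE mulmxA -colE mulmxA hE !mxE eqxx /=.
  suff -> : (i' == i0) = false by [].
  by apply: contraNF ii0 => /eqP ii0; apply/eqP/val_inj; rewrite /= iE ii0.
rewrite -[X in mdvd _ (_ * X)](_ : jac_mx f (C *m h) j (rshift 1 i0) = _) //.
by rewrite row_mxEr mxE gE; exact: dvd_mul_dirderiv.
Qed.

Lemma mderiv_homog i d (f : S) : f \is d.-homog -> f^`M(i) \is d.-1.-homog.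
Proof.
move=> /dhomogP fd; apply/dhomogP => m; rewrite mcoeff_msupp mcoeff_deriv => m0.
have : (m + U_(i))%MM \in msupp f.
  by rewrite mcoeff_msupp; apply: contraNneq m0 => ->; rewrite mul0rn.
by move/fd => /=; rewrite mdegD mdeg1 addn1 => <-.
Qed.

Lemma prod_homog (I : Type) (r : seq I) (F : I -> S) (w : I -> nat) :
  (forall i, F i \is (w i).-homog) -> \prod_(i <- r) F i \is (\sum_(i <- r) w i).-homog.
Proof.
move=> Fw; elim/big_rec2: _ => [|i d f _ fd]; first exact: dhomog1.
exact: dhomogM.
Qed.

Lemma det_homog m (A : 'M[S]_m) (w : 'I_m -> nat) :
  (forall j i, A j i \is (w i).-homog) -> \det A \is (\sum_i w i).-homog.
Proof.
move=> Aw; apply: rpred_sum => s _.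
have H : \prod_i A i (s i) \is (\sum_i w i).-homog.
  have -> : (\sum_i w i = \sum_i w (s i))%N by rewrite (reindex_inj (@perm_inj _ s)).
  exact: prod_homog.
by case: (odd_perm s); rewrite ?expr0 ?expr1 ?mul1r ?mulN1r ?rpredN.
Qed.

Lemma jacobian_homog f C d : (forall j, f j \is d.-homog) ->
  jacobian f C \is (d + n * d.-1).-homog.
Proof.
move=> fd; pose w (i : 'I_(1 + n)) := if fintype.split i is inl _ then d else d.-1.
have -> : (d + n * d.-1 = \sum_i w i)%N.
  rewrite big_split_ord big_ord1 /w (unsplitK (inl _)) /=; congr (_ + _)%N.
  rewrite (eq_bigr (fun=> d.-1)) ?sum_nat_const ?card_ord // => i _.
  by rewrite (unsplitK (inr _)).
apply: det_homog => j i; rewrite mxE /w; case: splitP => i' _; rewrite mxE //.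
by apply: rpred_sum => r _; apply: rpredZ; exact: mderiv_homog.
Qed.
End Jacobian.

(** * The degree bound *)

Lemma homog_msize (k : fieldType) n d (f : {mpoly k[n]}) : f != 0 -> f \is d.-homog -> (msize f).-1 = d.
Proof. by move=> f0 fd; apply/esym/(dhomog_uniq f0 fd); exact: dhomog_msize fd. Qed.

Section DegreeBound.
Variables (k : finFieldType) (n : nat).
Local Notation S := {mpoly k[n.+1]}.
Local Notation L := (@linear_form k n).
Local Notation q := #|k|.
Variables (f : 'I_n.+1 -> S) (d : nat) (C : 'M[k]_(n.+1, n)) (t0 : 'rV[k]_n.+1).
Hypothesis n_gt0 : (0 < n)%N.
Hypothesis f_homog : forall j, f j \is d.-homog.
Hypothesis f_split : forall l, l != 0 -> is_split (comb f l).
Hypothesis f_coprime : forall t, t != 0 -> exists j, ~ mdvd (L t) (f j).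
Hypothesis t0_neq0 : t0 != 0.
Hypothesis t0C : t0 *m C = 0.
Hypothesis t0f : exists2 l, l != 0 & mdvd (L t0) (comb f l).
Hypothesis J_neq0 : jacobian f C != 0.

(** The order of the combination [comb f l] along [L t]; it defines a filtration
    of the space of all [l]. *)
Let mu t l := vord t (comb f l).

Lemma comb_neq0 l : l != 0 -> comb f l != 0.
Proof. by move/f_split; exact: split_neq0. Qed.

Lemma comb_delta j : comb f (delta_mx 0 j) = f j.
Proof.
rewrite /comb (bigD1 j) //= mxE !eqxx scale1r big1 ?addr0 // => i /negbTE ij.
by rewrite mxE ij scale0r.
Qed.

Lemma levelE t s l : t != 0 -> level (mu t) s l <-> mdvd (L t ^+ s) (comb f l).
Proof.
move=> tn0; rewrite /level; have [->|l0] := eqVneq l 0.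
  by rewrite comb0; split => // _; exact: mdvd0.
split=> /= [sl|]; last exact: dvd_vord (comb_neq0 l0).
exact: mdvd_trans (mdvd_exp _ sl) (vord_dvd _ _).
Qed.

Lemma mu_levelD t s u v : t != 0 -> level (mu t) s u -> level (mu t) s v ->
  level (mu t) s (u + v).
Proof.
move=> tn0 /(levelE _ _ tn0) su /(levelE _ _ tn0) sv; apply/(levelE _ _ tn0).
by rewrite combD; exact: mdvdD.
Qed.

Lemma mu_levelZ t s c v : t != 0 -> level (mu t) s v -> level (mu t) s (c *: v).
Proof.
move=> tn0 /(levelE _ _ tn0) sv; apply/(levelE _ _ tn0).
by rewrite combZ; exact: mdvdZ.
Qed.

Let W t := row_weight (mu t) (heaviest (mu t)).

Lemma det_heaviest_neq0 t : \det (heaviest (mu t)) != 0.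
Proof. by rewrite -unitfE -unitmxE heaviest_unit. Qed.

(** The basis [heaviest] only changes the Jacobian by a nonzero constant. *)
Lemma jacobian_vord t : t != 0 -> ((W t).-1 <= vord t (jacobian f C))%N.
Proof.
move=> tn0; have Lt0 : L t != 0 by rewrite linear_form_eq0.
have : mdvd (L t ^+ W t) (L t * jacobian f C).
  have := @jacobian_dvd _ _ (fun j => comb f (row j (heaviest (mu t)))) C t
     (fun j => mu t (row j (heaviest (mu t)))) (fun j => vord_dvd _ _).
  rewrite jacobian_comb mulrCA mul_mpolyC => /(mdvdZ (\det (heaviest (mu t)))^-1).
  by rewrite scalerA mulVf ?det_heaviest_neq0 // scale1r.
move/(dvd_vord tn0); rewrite mulf_neq0 // => /(_ isT).
rewrite vordM // vord_linear_form //; case: asboolP => _; lia.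
Qed.

Lemma jacobian_vord_tangent t : t *m C = 0 -> t != 0 -> (W t <= vord t (jacobian f C))%N.
Proof.
move=> tC tn0; apply: dvd_vord => //.
have := @jacobian_dvd_tangent _ _ (fun j => comb f (row j (heaviest (mu t)))) C t
   (fun j => mu t (row j (heaviest (mu t)))) tC (fun j => vord_dvd _ _).
rewrite jacobian_comb mul_mpolyC => /(mdvdZ (\det (heaviest (mu t)))^-1).
by rewrite scalerA mulVf ?det_heaviest_neq0 // scale1r.
Qed.

Lemma weight_gt0 t l : t != 0 -> l != 0 -> mdvd (L t) (comb f l) -> (0 < W t)%N.
Proof.
move=> tn0 l0 tl.
have [j aj] : exists j, (l *m invmx (heaviest (mu t))) 0 j != 0.
  apply: row_neq0P; apply: contraNneq l0 => /(congr1 (mulmx^~ (heaviest (mu t)))).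
  by rewrite mulmxKV ?heaviest_unit // mul0mx => ->.
have : (1 <= mu t (row j (heaviest (mu t))))%N.
  apply: heaviest_adapted aj; rewrite mulmxKV ?heaviest_unit //.
  by apply/levelE => //; rewrite expr1.
by rewrite /W /row_weight (bigD1 j) //= => h; rewrite ltn_addr.
Qed.

(** For [t] proportional to [t0] all directions of [C] are tangent to the
    hyperplane, and no order is lost. These [q - 1] rows provide the summand
    [q - 1], without which the final count would not be sharp. *)
Lemma sum_weight_le : (\sum_(t : 'rV[k]_n.+1 | t != 0%R) (W t).-1 + q.-1 <= q.-1 * (d + n * d.-1))%N.
Proof.
rewrite -(homog_msize J_neq0 (jacobian_homog C f_homog)).
apply: leq_trans (sum_vord_le J_neq0).
rewrite -(sum_vord_linear_form t0_neq0) -big_split /=; apply: leq_sum => t tn0.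
rewrite vord_linear_form //; case: asboolP => [[c t0E]|_]; last first.
  by rewrite addn0 jacobian_vord.
have c0 : c != 0 by apply: contraNneq t0_neq0 => c0; rewrite t0E c0 scale0r.
have tE : t = c^-1 *: t0 by rewrite t0E scalerA mulVf // scale1r.
have [l l0 t0l] := t0f; have W0 : (0 < W t)%N.
  apply: (weight_gt0 tn0 l0); apply: mdvd_trans t0l.
  by rewrite t0E linearZ; apply: mdvdZ; exists 1; rewrite mul1r.
rewrite addn1 prednK //; apply: jacobian_vord_tangent => //.
by rewrite tE -scalemxAl t0C scaler0.
Qed.

Let T t := (\sum_(l : 'rV[k]_n.+1 | l != 0%R) mu t l)%N.

Lemma card_row_neq0 : (#|[pred l : 'rV[k]_n.+1 | l != 0%R]| = (q ^ n.+1).-1)%N.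
Proof. by rewrite (cardC1 (0 : 'rV[k]_n.+1)) card_mx mul1n. Qed.

Lemma sum_vord_comb : (\sum_(t : 'rV[k]_n.+1 | t != 0%R) T t = (q ^ n.+1).-1 * (q.-1 * d))%N.
Proof.
rewrite exchange_big -card_row_neq0 -sum_nat_const /=; apply: eq_bigr => l l0.
rewrite sum_vord_split; last exact: f_split.
rewrite (@homog_msize _ _ d) ?comb_neq0 //.
rewrite /comb; apply: rpred_sum => i _; apply: rpredZ. exact: f_homog.
Qed.

(** Summing [filtration_bound] over all [t <> 0], the known total order of the
    split forms exhausts the bound on the Jacobian, so that no inequality is
    strict: the total order along each [L t] is at most [q - 1], and summing
    once more gives the bound on [d]. *)
Lemma degree_le1 : (d <= 1)%N.
Proof.
have q2 : (2 <= q)%N by exact: card_finNzRing_gt1.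
rewrite leqNgt; apply/negP => d2.
have bound t : t != 0 ->
    (n.+1 * T t + (q.-1 < T t) <= (q ^ n.+1).-1 * (W t).-1 + n.+1 * q.-1)%N.
  move=> tn0; apply: filtration_bound => // [s u v|s c v|].
  - exact: mu_levelD.
  - exact: mu_levelZ.
  have [j Nj] := f_coprime tn0; exists (delta_mx 0 j).
    apply/eqP => /matrixP/(_ 0 j)/eqP; by rewrite !mxE !eqxx oner_eq0.
  apply/eqP; rewrite -leqn0 leqNgt; apply/negP => /vord_gt0 H.
  apply: Nj; rewrite -comb_delta; apply: H => //; apply: comb_neq0.
  apply/eqP => /matrixP/(_ 0 j)/eqP; by rewrite !mxE !eqxx oner_eq0.
have Q0 : (0 < (q ^ n.+1).-1)%N.
  have := @bernoulli q n.+1 q2; nia.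
have := @leq_sum _ (index_enum _) (fun t : 'rV[k]_n.+1 => t != 0) _ _ bound.
rewrite !big_split /= -!big_distrr /= sum_vord_comb sum_nat_const card_row_neq0.
have := sum_weight_le.
set X := (\sum_(t | _) (W t).-1)%N; set Y := (\sum_(t | _) (_ < _))%N => HX HY.
have Y0 : Y = 0%N.
  move: HX HY Q0; set Q := (_ ^ _).-1; set r := q.-1; case: d d2 => // d' _ /= HX HY Q0.
  have : (Q * (X + r) <= Q * (r * (d'.+1 + n * d')))%N by rewrite leq_mul2l HX orbT.
  nia.
have T_le t : t != 0 -> (T t <= q.-1)%N.
  move=> tn0; rewrite leqNgt; apply/negP => lt; move: Y0.
  by rewrite /Y (bigD1 t) //= lt.
have := @leq_sum _ (index_enum _) (fun t : 'rV[k]_n.+1 => t != 0) _ _ T_le.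
rewrite sum_vord_comb sum_nat_const card_row_neq0 leq_pmul2l // -[X in (_ <= X)%N]muln1 leq_pmul2l; last lia.
by rewrite leqNgt d2.
Qed.
End DegreeBound.

(** * Derivations of fraction fields and separability *)

Section QuotientRule.
Variable K : fieldType.
Implicit Types A B N E a b c d : K.

Lemma quotient_rule_eq A B N E a b c d : B != 0 -> E != 0 -> N * B = A * E ->
  c * B + N * b = a * E + A * d -> (c * E - N * d) / E ^+ 2 = (a * B - A * b) / B ^+ 2.
Proof.
move=> B0 E0 e eD.
have -> : c = (a * E + A * d - N * b) / B by rewrite -eD addrK mulfK.
have -> : N = A * E / B by rewrite -e mulfK.
by field; rewrite B0 E0.
Qed.

Lemma quotient_ruleD A B N E a b c d : B != 0 -> E != 0 ->
  ((a * E + A * d + (c * B + N * b)) * (B * E) - (A * E + N * B) * (b * E + B * d)) / (B * E) ^+ 2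
  = (a * B - A * b) / B ^+ 2 + (c * E - N * d) / E ^+ 2.
Proof. by move=> B0 E0; field; rewrite B0 E0. Qed.

Lemma quotient_ruleM A B N E a b c d : B != 0 -> E != 0 ->
  ((a * N + A * c) * (B * E) - A * N * (b * E + B * d)) / (B * E) ^+ 2
  = (a * B - A * b) / B ^+ 2 * (N / E) + A / B * ((c * E - N * d) / E ^+ 2).
Proof. by move=> B0 E0; field; rewrite B0 E0. Qed.
End QuotientRule.

Section FractionField.
Variable R : idomainType.
Implicit Types x y : {fraction R}.

Definition fnum x : R := \n_(repr x).
Definition fden x : R := \d_(repr x).

Lemma fden_neq0 x : fden x != 0. Proof. exact: denom_ratioP. Qed.

Lemma fracE x : x = (fnum x)%:F / (fden x)%:F.
Proof.
have d0 : (fden x)%:F != 0 by rewrite tofrac_eq0 fden_neq0.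
apply: (mulIf d0); rewrite mulfVK //.
rewrite -[X in X * _](reprK x) /fnum /fden; unlock FracField.tofrac.
rewrite -[LHS]FracField.pi_mul.
apply/eqmodP; rewrite /= FracField.equivfE /FracField.mulf.
by rewrite !numden_Ratio ?(oner_eq0, mulr1, denom_ratioP) // mulrC.
Qed.

Lemma eq_frac (a b c d : R) : b != 0 -> d != 0 ->
  (a%:F / b%:F == c%:F / d%:F) = (a * d == c * b).
Proof. by move=> b0 d0; rewrite eqr_div ?tofrac_eq0 // -!tofracM tofrac_eq. Qed.

Section Extension.
Variables (K : fieldType) (phi : {rmorphism R -> K}).
Hypothesis phi_neq0 : forall a, a != 0 -> phi a != 0.

(** The extension to the field of fractions, computed on a representative. It is
    meaningful when [phi] does not kill any nonzero element. *)
Definition frac_ext x : K := phi (fnum x) / phi (fden x).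

Lemma frac_extE a b : b != 0 -> frac_ext (a%:F / b%:F) = phi a / phi b.
Proof.
move=> b0; have := fracE (a%:F / b%:F); rewrite /frac_ext.
set x := a%:F / b%:F => /eqP; rewrite eq_frac ?fden_neq0 // => /eqP/(congr1 phi).
rewrite !rmorphM => e; apply/eqP.
by rewrite eqr_div ?phi_neq0 ?fden_neq0 // e.
Qed.

Lemma frac_ext_tofrac a : frac_ext a%:F = phi a.
Proof. by rewrite -[a%:F]divr1 -tofrac1 frac_extE ?oner_eq0 // rmorph1 divr1. Qed.

Lemma frac_extD : {morph frac_ext : x y / x + y}.
Proof.
move=> x y; rewrite [in LHS](fracE x) [in LHS](fracE y) addf_div ?tofrac_eq0 ?fden_neq0 //.
rewrite -!tofracM -tofracD frac_extE ?mulf_neq0 ?fden_neq0 //.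
by rewrite rmorphD !rmorphM -addf_div ?phi_neq0 ?fden_neq0.
Qed.

Lemma frac_extM : {morph frac_ext : x y / x * y}.
Proof.
move=> x y; rewrite [in LHS](fracE x) [in LHS](fracE y) mulf_div.
rewrite -!tofracM frac_extE ?mulf_neq0 ?fden_neq0 //.
by rewrite !rmorphM -mulf_div.
Qed.

Lemma frac_ext0 : frac_ext 0 = 0.
Proof. by rewrite -tofrac0 frac_ext_tofrac rmorph0. Qed.
Lemma frac_ext1 : frac_ext 1 = 1.
Proof. by rewrite -tofrac1 frac_ext_tofrac rmorph1. Qed.
End Extension.

Section Derivation.
Variable D : R -> {fraction R}.
Hypothesis DD : {morph D : a b / a + b}.
Hypothesis DM : forall a b, D (a * b) = D a * b%:F + a%:F * D b.

Definition frac_der x : {fraction R} :=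
  (D (fnum x) * (fden x)%:F - (fnum x)%:F * D (fden x)) / (fden x)%:F ^+ 2.

Lemma frac_derE a b : b != 0 ->
  frac_der (a%:F / b%:F) = (D a * b%:F - a%:F * D b) / b%:F ^+ 2.
Proof.
move=> b0; have := fracE (a%:F / b%:F); rewrite /frac_der.
set x := a%:F / b%:F => /eqP; rewrite eq_frac ?fden_neq0 // => /eqP e.
have eF := congr1 (fun z => z%:F) e; rewrite /= !tofracM in eF.
have eD := congr1 D e; rewrite !DM in eD.
by apply: quotient_rule_eq; rewrite ?tofrac_eq0 ?fden_neq0.
Qed.

Lemma deriv_one : D 1 = 0.
Proof.
have := DM 1 1; rewrite mulr1 tofrac1 mulr1 mul1r => /eqP.
by rewrite -subr_eq0 opprD addrA subrr add0r oppr_eq0 => /eqP.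
Qed.

Lemma frac_der_tofrac a : frac_der a%:F = D a.
Proof.
rewrite -[a%:F]divr1 -tofrac1 frac_derE ?oner_eq0 // deriv_one mulr0 subr0.
by rewrite tofrac1 mulr1 expr1n divr1.
Qed.

Lemma frac_derD : {morph frac_der : x y / x + y}.
Proof.
move=> x y; rewrite [in LHS](fracE x) [in LHS](fracE y) addf_div ?tofrac_eq0 ?fden_neq0 //.
rewrite -!tofracM -tofracD frac_derE ?mulf_neq0 ?fden_neq0 // /frac_der.
by rewrite DD !DM !tofracD !tofracM quotient_ruleD // tofrac_eq0 fden_neq0.
Qed.

Lemma frac_derM x y : frac_der (x * y) = frac_der x * y + x * frac_der y.
Proof.
rewrite [in LHS](fracE x) [in LHS](fracE y) mulf_div -!tofracM frac_derE ?mulf_neq0 ?fden_neq0 //.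
rewrite !DM !tofracM quotient_ruleM ?tofrac_eq0 ?fden_neq0 //.
by rewrite -!fracE.
Qed.
End Derivation.
End FractionField.

Section Constants.
Variables (K : fieldType) (D : K -> K).
Hypothesis DD : {morph D : x y / x + y}.
Hypothesis DM : forall x y, D (x * y) = D x * y + x * D y.

Lemma der0 : D 0 = 0.
Proof. by have /eqP := DD 0 0; rewrite addr0 -subr_eq0 opprD addrA subrr add0r oppr_eq0 => /eqP. Qed.

Lemma der_horner (p : {poly K}) x : (forall i, D p`_i = 0) -> D p.[x] = p^`().[x] * D x.
Proof.
elim/poly_ind: p => [|p c IH] Dp; first by rewrite deriv0 !horner0 der0 mul0r.
rewrite derivMXaddC !hornerE DD !DM IH => [|i].
  by have := Dp 0%N; rewrite coefD coefMX coefC /= add0r => ->; ring.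
by have := Dp i.+1; rewrite coefD coefMX coefC /= addr0.
Qed.

(** Deriving the equation [p.[x] = 0], whose coefficients are constants, gives
    [p^`().[x] * D x = 0]. *)
Lemma der_separable (p : {poly K}) x : (forall i, D p`_i = 0) ->
  separable_poly p -> root p x -> D x = 0.
Proof.
move=> Dp sp /eqP px; have /eqP := der_horner x Dp.
rewrite px der0 eq_sym mulf_eq0 => /orP[|/eqP //].
move: sp; rewrite separable_poly.unlock => /Bezout_coprimepP [u /eqpP [c /andP[c1 c2] +]].
move=> /(congr1 (fun r => r.[x])); rewrite !hornerE px mulr0 add0r => + /eqP p'x.
by rewrite p'x !mulr0 => /esym/eqP; rewrite (negbTE c2).
Qed.
End Constants.

Section JacobianNonzero.
Variables (k : fieldType) (n : nat).
Local Notation S := {mpoly k[n.+1]}.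
Local Notation F := {fraction S}.
Local Notation L := (@linear_form k n).

Definition feval (u : 'I_n.+1 -> F) : S -> F := mmap (@FracField.tofrac S \o @mpolyC n.+1 k) u.
HB.instance Definition _ u := GRing.RMorphism.on (feval u).

Lemma fevalX u i : feval u 'X_i = u i.
Proof. by rewrite /feval mmapX mmap1U. Qed.
Lemma fevalC u c : feval u c%:MP = (c%:MP)%:F.
Proof. exact: mmapC. Qed.

Variables (f : 'I_n.+1 -> S) (t0 : 'rV[k]_n.+1) (C : 'M[k]_(n.+1, n)) (C' : 'M[k]_(n, n.+1)).
Hypothesis t0_neq0 : t0 != 0.
Hypothesis t0C : t0 *m C = 0.
Hypothesis C'C : C' *m C = 1%:M.
Hypothesis f0 : f 0 != 0.
Let u i := (f i)%:F / (f 0)%:F.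
Hypothesis separable_over_image : forall i, exists p : {poly F},
  [/\ forall j, exists a b, feval u b != 0 /\ p`_j * feval u b = feval u a,
      separable_poly p & root p (('X_i)%:F / ('X_0)%:F)].

(** A linear relation between the columns of a singular Jacobian matrix is a
    nonzero derivation [D] of the field of fractions which multiplies all the
    [f j] by the same factor, hence kills their quotients and everything that is
    separable algebraic over these, in particular the quotients of variables. So
    [D] is a multiple of the Euler derivation; being tangent to the hyperplane
    of [t0] it is zero, a contradiction. *)
Lemma jacobian_neq0 : jacobian f C != 0.
Proof.
apply/negP => J0.
have : \det (map_mx (@FracField.tofrac S) (jac_mx f C))^T == 0.
  by rewrite det_tr det_map_mx tofrac_eq0.
case/det0P => v v0 vJ.
have rel j : v 0 0 * (f j)%:F + \sum_i v 0 (rshift 1 i) * (dirderiv (col i C) (f j))%:F = 0.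
  have /rowP/(_ j) := vJ; rewrite !mxE big_split_ord big_ord1 /= => e; apply: etrans e; congr (_ + _).
    by rewrite !mxE (unsplitK (inl _)) mxE; congr (v _ _ * _); apply: val_inj.
  by apply: eq_bigr => i _; rewrite !mxE (unsplitK (inr _)) mxE.
pose c r : F := \sum_i v 0 (rshift 1 i) * ((C r i)%:MP)%:F.
pose D (g : S) : F := \sum_r c r * (g^`M(r))%:F.
have DE g : D g = \sum_i v 0 (rshift 1 i) * (dirderiv (col i C) g)%:F.
  rewrite /D /c; under eq_bigr => r _ do rewrite mulr_suml.
  rewrite exchange_big; apply: eq_bigr => i _ /=.
  rewrite /dirderiv rmorph_sum mulr_sumr; apply: eq_bigr => r _ /=.
  by rewrite mxE -mul_mpolyC tofracM mulrA.
have DD : {morph D : a b / a + b}.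
  move=> a b; rewrite /D -big_split; apply: eq_bigr => r _.
  by rewrite mderivD tofracD mulrDr.
have DM a b : D (a * b) = D a * b%:F + a%:F * D b.
  rewrite /D mulr_suml mulr_sumr -big_split; apply: eq_bigr => r _ /=.
  by rewrite mderivM tofracD !tofracM; ring.
have DC x : D x%:MP = 0.
  by rewrite /D big1 // => r _; rewrite mderivC tofrac0 mulr0.
have DX i : D 'X_i = c i.
  rewrite /D (bigD1 i) //= big1 ?addr0 => [|r ri].
    rewrite mderivX mnm1E eqxx scale1r -{1}[U_(i)%MM]add0m addmK mpolyX0.
    by rewrite tofrac1 mulr1.
  by rewrite mderivX mnm1E eq_sym (negbTE ri) scale0r tofrac0 mulr0.
pose d := frac_der D.
have dD := frac_derD DD DM; have dM := frac_derM DM; have dF := frac_der_tofrac DM.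
have Df j : D (f j) = - v 0 0 * (f j)%:F.
  by have /eqP := rel j; rewrite -DE addrC addr_eq0 => /eqP->; rewrite mulNr.
have du j : d (u j) = 0.
  rewrite /d /u frac_derE // !Df (_ : _ - _ = 0) ?mul0r //; ring.
have deval a : d (feval u a) = 0.
  elim/mpoly_ring_ind: a => [x|i|a b IHa IHb|a b IHa IHb].
  - by rewrite fevalC /d dF DC.
  - by rewrite fevalX.
  - by rewrite rmorphD /= /d dD -/d IHa IHb addr0.
  - by rewrite rmorphM /= /d dM -/d IHa IHb mul0r mulr0 addr0.
have X0F : ('X_0 : S)%:F != 0 by rewrite tofrac_eq0 -linear_form_delta linear_form_eq0 -linear_form_eq0 linear_form_delta -msize_poly_eq0 msizeX.
have cX i : c i * ('X_0)%:F = ('X_i)%:F * c 0.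
  have [p [pK sp px]] := separable_over_image i.
  have dp j : d p`_j = 0.
    have [a [b [b0 e]]] := pK j; have := deval a; rewrite -e /d dM -/d deval mulr0 addr0.
    by move/eqP; rewrite mulf_eq0 (negbTE b0) orbF => /eqP.
  have X0n : ('X_0 : S) != 0 by rewrite -tofrac_eq0.
  have : d (('X_i)%:F / ('X_0)%:F) = 0 := der_separable dD dM dp sp px.
  rewrite /d (frac_derE DM _ X0n) !DX => /eqP.
  by rewrite mulf_eq0 invr_eq0 expf_eq0 (negbTE X0F) orbF subr_eq0 => /eqP.
(* By [cX], [D] multiplies every variable by [c 0 / 'X_0]; but it kills [L t0]. *)
have c0 : c 0 = 0.
  have t0c : \sum_i ((t0 0 i)%:MP)%:F * c i = 0.
    rewrite /c; under eq_bigr => r _ do rewrite mulr_sumr.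
    rewrite exchange_big big1 // => i _ /=.
    have : (t0 *m C) 0 i = 0 by rewrite t0C mxE.
    rewrite mxE => /(congr1 (fun z => (z%:MP_[n.+1])%:F)) /=.
    rewrite mpolyC0 tofrac0 !rmorph_sum /= => e.
    rewrite -[RHS](mulr0 (v 0 (rshift 1 i))) -[X in _ = _ * X]e mulr_sumr; apply: eq_bigr => r _.
    by rewrite mpolyCM tofracM; ring.
  have : (L t0)%:F * c 0 = 0.
    rewrite /linear_form rmorph_sum mulr_suml /=.
    rewrite -[RHS](mul0r ('X_0)%:F) -[X in _ = X * _]t0c mulr_suml; apply: eq_bigr => i _.
    by rewrite -mulrA cX mulrA -tofracM mul_mpolyC.
  move/eqP; rewrite mulf_eq0 tofrac_eq0 linear_form_eq0 (negbTE t0_neq0) /=.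
  by move/eqP.
have cz i : c i = 0.
  by apply/eqP; have /eqP := cX i; rewrite c0 mulr0 mulf_eq0 (negbTE X0F) orbF.
have vz i : v 0 (rshift 1 i) = 0.
  have : \sum_r ((C' i r)%:MP)%:F * c r = 0 by rewrite big1 // => r _; rewrite cz mulr0.
  rewrite /c; under eq_bigr => r _ do rewrite mulr_sumr.
  rewrite exchange_big (bigD1 i) //= [X in _ + X]big1 ?addr0 => [|j ji].
    move=> vi; apply: etrans _ vi; have : (C' *m C) i i = 1 by rewrite C'C mxE eqxx.
    rewrite mxE => /(congr1 (fun z => (z%:MP_[n.+1])%:F)) /=.
    rewrite mpolyC1 tofrac1 !rmorph_sum /= => e.
    rewrite -[LHS]mulr1 -[X in _ * X = _]e mulr_sumr; apply: eq_bigr => r _.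
    by rewrite mpolyCM tofracM; ring.
  have : (C' *m C) i j = 0 by rewrite C'C mxE eq_sym (negbTE ji).
  rewrite mxE => /(congr1 (fun z => (z%:MP_[n.+1])%:F)) /=.
  rewrite mpolyC0 tofrac0 !rmorph_sum /= => e.
  rewrite -[RHS](mulr0 (v 0 (rshift 1 j))) -[X in _ = _ * X]e mulr_sumr; apply: eq_bigr => r _.
  by rewrite mpolyCM tofracM; ring.
have /eqP := rel 0; rewrite big1 ?addr0 => [|i _]; last by rewrite vz mul0r.
rewrite mulf_eq0 tofrac_eq0 (negbTE f0) orbF => /eqP v00.
move/eqP: v0; apply; apply/rowP => i; rewrite [RHS]mxE.
by case: (split_ordP i) => j ->; rewrite ?vz // (ord1 j) -[RHS]v00; congr (v _ _); apply: val_inj.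
Qed.

End JacobianNonzero.

Section TangentFrame.
Variables (k : fieldType) (n : nat).

(** The columns of [C] are a basis of the hyperplane of [t], and [C'] witnesses
    their independence over every extension of [k]. *)
Lemma tangent_frame (t : 'rV[k]_n.+1) : t != 0 ->
  exists (C : 'M[k]_(n.+1, n)) (C' : 'M[k]_(n, n.+1)), t *m C = 0 /\ C' *m C = 1%:M.
Proof.
case/row_neq0P => i ti; have [h uh hE] := unitmx_row_delta ti.
exists (col' i h), (row' i (invmx h)); split.
  apply/rowP => j; have /rowP/(_ (lift i j)) := hE; rewrite !mxE eq_sym (negbTE (neq_lift _ _)).
  by rewrite andbF => e; rewrite -[RHS]e; apply: eq_bigr => r _; rewrite mxE.
apply/matrixP => x y; have /matrixP/(_ (lift i x) (lift i y)) := mulVmx uh.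
rewrite !mxE (inj_eq (@lift_inj _ i)) => <-.
by apply: eq_bigr => r _; rewrite !mxE.
Qed.
End TangentFrame.

(** * Points of the projective space *)

Local Open Scope classical_set_scope.
Local Open Scope ring_scope.

Section HomogeneousParts.
Variables (k : fieldType) (n : nat).
Local Notation S := {mpoly k[n]}.
Implicit Types a b c : S.

Lemma pihomogM_homog d e c a : a \is e.-homog ->
  pihomog mdeg (d + e) (c * a) = pihomog mdeg d c * a.
Proof.
move=> ae; rewrite [in LHS](mpolyE c) [in RHS](mpolyE c) mulr_suml !raddf_sum mulr_suml.
apply: eq_bigr => m _ /=; rewrite -scalerAl !linearZ /= -scalerAl; congr (_ *: _).
have ma : 'X_[m] * a \is (mdeg m + e).-homog by apply: dhomogM ae; rewrite dhomogX.
rewrite pihomogX; case: (eqVneq (mdeg m) d) => [<-|md]; first by rewrite pihomog_dE.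
by rewrite mul0r (pihomog_ne0 _ ma) // eqn_add2r.
Qed.

Lemma pihomogM_homog_lt d e c a : a \is e.-homog -> (d < e)%N ->
  pihomog mdeg d (c * a) = 0.
Proof.
move=> ae de; rewrite (mpolyE c) mulr_suml !raddf_sum big1 // => m _ /=.
have ma : 'X_[m] * a \is (mdeg m + e).-homog by apply: dhomogM ae; rewrite dhomogX.
by rewrite -scalerAl linearZ /= (pihomog_ne0 _ ma) ?scaler0 //; lia.
Qed.

Lemma pihomog_partition a : a = \sum_(d < msize a) pihomog mdeg d a.
Proof. exact: pihomog_partitionE. Qed.

Lemma homog_of_parts d a : (forall e, e != d -> pihomog mdeg e a = 0) -> a \is d.-homog.
Proof.
move=> ad; rewrite (pihomog_partition a); apply: rpred_sum => e _.
by case: (eqVneq (e : nat) d) => [->|/ad->]; [exact: pihomogP|exact: rpred0].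
Qed.

Lemma homog_factor d e c a : a != 0 -> a \is e.-homog -> c * a \is (d + e).-homog ->
  c \is d.-homog.
Proof.
move=> a0 ae cad; apply: homog_of_parts => i id; apply: (mulIf a0).
by rewrite mul0r -(pihomogM_homog _ _ ae) (pihomog_ne0 _ cad) // eqn_add2r eq_sym.
Qed.

Lemma msize_homog d a : a \is d.-homog -> (msize a <= d.+1)%N.
Proof.
move=> ad; have [->|a0] := eqVneq a 0; first by rewrite msize0.
have := dhomog_uniq a0 ad (dhomog_msize ad) => ->; exact: leqSpred.
Qed.

Lemma pihomog_ge d a : (msize a <= d)%N -> pihomog mdeg d a = 0.
Proof.
move=> ad; rewrite (pihomog_partition a) raddf_sum big1 // => e _ /=.
apply: (pihomog_ne0 _ (pihomogP mdeg e a)).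
by rewrite neq_ltn (leq_trans (ltn_ord e) ad).
Qed.

Lemma top_partE a : a != 0 ->
  exists2 a', a = a' + pihomog mdeg (msize a).-1 a & (msize a' <= (msize a).-1)%N.
Proof.
rewrite -msize_poly_eq0 => a0; exists (\sum_(d < (msize a).-1) pihomog mdeg d a).
  rewrite {1}(pihomog_partition a); case: (msize a) a0 => // m _.
  by rewrite big_ord_recr.
apply: leq_trans (msize_sum _ _ _) _; apply/bigmax_leqP => d _.
by apply: leq_trans (msize_homog (pihomogP _ _ _)) _.
Qed.

(** Used to reduce primality of a homogeneous ideal to homogeneous elements. *)
Lemma top_partM a b : a != 0 -> b != 0 ->
  pihomog mdeg ((msize a).-1 + (msize b).-1) (a * b) =
  pihomog mdeg (msize a).-1 a * pihomog mdeg (msize b).-1 b.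
Proof.
move=> a0 b0; have [a' aE a'le] := top_partE a0; have [b' bE b'le] := top_partE b0.
rewrite {2}bE mulrDr pihomogD (pihomogM_homog _ _ (pihomogP _ _ _)).
rewrite -[RHS]add0r; congr (_ + _); apply: pihomog_ge.
have [->|b'0] := eqVneq b' 0; first by rewrite mulr0 msize0.
rewrite msizeM //; rewrite -msize_poly_eq0 in a0.
by case: (msize a) a0 => // s _; rewrite addSn leq_add2l.
Qed.
End HomogeneousParts.

Section Points.
Variables (k : fieldType) (n : nat).
Local Notation S := {mpoly k[n.+1]}.
Implicit Types (p q : proj k n) (a b c : S).

(** The fields of [proj] other than the ideal are propositions. *)
Lemma proj_eq p q : (forall a, (a \in proj_ideal p) = (a \in proj_ideal q)) -> p = q.
Proof.
case: p q => [I I1 I2 I3 I4] [J J1 J2 J3 J4] /= IJ.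
have e : I = J by apply: funext => a; exact: IJ.
by case: _ / e in J1 J2 J3 J4 IJ *; congr Proj; exact: Prop_irrelevance.
Qed.

Lemma ideal0 p : 0 \in proj_ideal p. Proof. by have [] := proj_idealr p. Qed.
Lemma ideal1 p : 1 \notin proj_ideal p. Proof. by have [] := proj_idealr p. Qed.
Lemma idealMl p a b : b \in proj_ideal p -> a * b \in proj_ideal p.
Proof. by have [p0 _ pM] := proj_idealr p => bp; rewrite -[_ * _]addr0; exact: pM. Qed.
Lemma idealD p a b : a \in proj_ideal p -> b \in proj_ideal p -> a + b \in proj_ideal p.
Proof. by have [p0 _ pM] := proj_idealr p => ap bp; rewrite -[a]mul1r; exact: pM. Qed.
Lemma idealMr p a b : a \in proj_ideal p -> a * b \in proj_ideal p.
Proof. by rewrite mulrC; exact: idealMl. Qed.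
Lemma idealZ p (c : k) a : a \in proj_ideal p -> c *: a \in proj_ideal p.
Proof. by rewrite -mul_mpolyC; exact: idealMl. Qed.
Lemma idealM p a b : (a * b \in proj_ideal p) = (a \in proj_ideal p) || (b \in proj_ideal p).
Proof.
apply/idP/orP => [/(@proj_prime _ _ p)/orP //|[]]; [exact: idealMr|exact: idealMl].
Qed.
Lemma idealX p a e : (0 < e)%N -> (a ^+ e \in proj_ideal p) = (a \in proj_ideal p).
Proof.
case: e => // e _; elim: e => [|e IH]; first by rewrite expr1.
by rewrite exprS idealM IH orbb.
Qed.
Lemma notin_idealX p a e : a \notin proj_ideal p -> a ^+ e \notin proj_ideal p.
Proof.
by case: e => [|e]; rewrite ?expr0 ?idealX // => _; exact: ideal1.
Qed.
Lemma ideal_sum p (I : Type) (r : seq I) (P : pred I) (G : I -> S) :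
  (forall i, P i -> G i \in proj_ideal p) -> \sum_(i <- r | P i) G i \in proj_ideal p.
Proof. by move=> Gp; elim/big_ind: _ => //; [exact: ideal0|exact: idealD]. Qed.
Lemma notin_ideal_neq0 p a : a \notin proj_ideal p -> a != 0.
Proof. by apply: contraNneq => ->; exact: ideal0. Qed.
Lemma ideal_partsP p a : reflect (forall d, pihomog mdeg d a \in proj_ideal p) (a \in proj_ideal p).
Proof.
apply: (iffP idP) => [ap d|ap]; first exact: proj_homog.
by rewrite (pihomog_partition a); apply: ideal_sum.
Qed.

Lemma proj_eq_homog p q : (forall a d, a \is d.-homog ->
  (a \in proj_ideal p) = (a \in proj_ideal q)) -> p = q.
Proof.
move=> pq; apply: proj_eq => a.
by apply/ideal_partsP/ideal_partsP => H d; have := H d; rewrite (pq _ d) // pihomogP.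
Qed.

Section PrimeAvoidance.
Variables (I : set S) (delta : S).
Hypothesis I0 : I 0.
Hypothesis ID : forall c a b, I a -> I b -> I (c * a + b).
Hypothesis Ihomog : forall d a, I a -> I (pihomog mdeg d a).
Hypothesis Idelta : forall m, ~ I (delta ^+ m).
(* In other words [delta] lies in the irrelevant ideal. *)
Hypothesis delta_relevant : forall p : S -> bool, (forall c a b, p a -> p b -> p (c * a + b)) ->
  p 0 -> (forall i, p 'X_i) -> p delta.

Let good (J : set S) := [/\ I `<=` J, forall c a b, J a -> J b -> J (c * a + b),
  forall d a, J a -> J (pihomog mdeg d a) & forall m, ~ J (delta ^+ m)].

(** The empty set is admitted in order that the union of the empty chain be
    harmless. *)
Lemma exists_maximal_good : exists2 J, good J & forall J', good J' -> J `<=` J' -> J' = J.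
Proof.
have [|J [PJ Jmax]] := @Zorn_bigcup S [set J | good J \/ J = set0].
  move=> G GP tot; have [[J0 [GJ0 gJ0]]|N] := pselect (exists J0, G J0 /\ good J0); last first.
    right; apply/seteqP; split => // a [J GJ Ja].
    by have [gJ|J0] := GP _ GJ; [case: N; exists J | rewrite J0 in Ja].
  have good_of J a : G J -> J a -> good J.
    by move=> GJ Ja; have [//|J_0] := GP _ GJ; rewrite J_0 in Ja.
  left; split.
  - by move=> a Ia; exists J0 => //; case: gJ0 => + _ _ _; exact.
  - move=> c a b [J1 G1 J1a] [J2 G2 J2b].
    have [J12|J21] := tot _ _ G1 G2; [exists J2|exists J1] => //.
      by have [_ + _ _] := good_of _ _ G2 J2b; apply => //; exact: (J12 _ J1a).
    by have [_ + _ _] := good_of _ _ G1 J1a; apply => //; exact: (J21 _ J2b).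
  - by move=> d a [J1 G1 J1a]; exists J1 => //; have [_ _ + _] := good_of _ _ G1 J1a; exact.
  - move=> m [J1 G1 J1a]; have [_ _ _ H] := good_of _ _ G1 J1a; exact: (H m).
have gI : good I by split.
case: PJ => [gJ|J0].
  exists J => // J' gJ' JJ'; apply: contrapT => ne; apply: (Jmax J'); last by left.
  by split => // J'J; apply: ne; apply/seteqP.
case: (Jmax I); last by left.
by rewrite J0; split => // /(_ 0 I0).
Qed.

(** A homogeneous ideal that is maximal among those that contain [I] and no
    power of [delta] is prime. For homogeneous elements this is the usual
    argument: two powers of [delta] would be multiples of [a] and of [b] modulo
    the ideal, and their product a multiple of [a * b]. The general case follows
    by induction on the degrees, comparing top homogeneous parts. *)
Lemma exists_prime_avoiding : exists p : proj k n,
  (forall a, I a -> a \in proj_ideal p) /\ delta \notin proj_ideal p.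
Proof.
have [J [IJ JD Jh Jd] Jmax] := exists_maximal_good.
have J0 : J 0 by exact: IJ.
have JMl c a : J a -> J (c * a) by move=> Ja; rewrite -[_ * _]addr0; exact: JD.
have JDD a b : J a -> J b -> J (a + b) by move=> Ja; rewrite -[a]mul1r; exact: JD.
(* Adjoining [a] to the maximal ideal must produce a power of [delta]. *)
have escape a e : a \is e.-homog -> ~ J a -> exists m c, J (delta ^+ m - c * a).
  move=> ae Na; apply: contrapT => N; apply: Na.
  suff <- : [set x | exists c, J (x - c * a)] = J by exists 1; rewrite mul1r subrr.
  apply: Jmax; last by move=> x Jx; exists 0; rewrite mul0r subr0.
  split.
  - by move=> x Ix; exists 0; rewrite mul0r subr0; exact: IJ.
  - move=> c x y [cx Jx] [cy Jy]; exists (c * cx + cy).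
    by rewrite (_ : _ - _ = c * (x - cx * a) + (y - cy * a)); [exact: JD|ring].
  - move=> d x [c Jx]; have [de|de] := ltnP d e.
      exists 0; rewrite mul0r subr0; have := Jh d _ Jx.
      by rewrite pihomogB (pihomogM_homog_lt _ ae de) subr0.
    exists (pihomog mdeg (d - e) c); rewrite -(pihomogM_homog _ _ ae) subnK //.
    by rewrite -pihomogB; exact: Jh.
  - by move=> m [c Jm]; apply: N; exists m, c.
have prime_homog a b e e' : a \is e.-homog -> b \is e'.-homog -> J (a * b) -> J a \/ J b.
  move=> ae be Jab; apply: contrapT => /not_orP[Na Nb].
  have [m [c Jm]] := escape _ _ ae Na; have [m' [c' Jm']] := escape _ _ be Nb.
  apply: (Jd (m + m')%N); rewrite exprD.
  rewrite (_ : _ * _ = delta ^+ m' * (delta ^+ m - c * a) + (c * a * (delta ^+ m' - c' * b) + c * c' * (a * b))); last by ring.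
  by apply: (JD) => //; apply: (JD) => //; exact: JMl.
have prime_J : forall N a b, (msize a + msize b < N)%N -> J (a * b) -> J a \/ J b.
  elim=> // N IH a b ltN Jab.
  have [->|a0] := eqVneq a 0; first by left.
  have [->|b0] := eqVneq b 0; first by right.
  have := Jh ((msize a).-1 + (msize b).-1)%N _ Jab; rewrite top_partM //.
  have [a' aE a'le] := top_partE a0; have [b' bE b'le] := top_partE b0.
  rewrite -msize_poly_eq0 in a0; rewrite -msize_poly_eq0 in b0.
  case/(prime_homog _ _ _ _ (pihomogP _ _ _) (pihomogP _ _ _)) => [Ja|Jb].
    have : J (a' * b).
      have -> : a' * b = - b * pihomog mdeg (msize a).-1 a + a * b by rewrite {3}aE; ring.
      exact: JD.
    case/(IH a' b) => [|Ja'|]; [|by left; rewrite aE; exact: JDD|by right].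
    by rewrite -ltnS (leq_trans _ ltN) // ltnS -addSn leq_add2r -(prednK (n := msize a)) ?lt0n.
  have : J (a * b').
    have -> : a * b' = - a * pihomog mdeg (msize b).-1 b + a * b by rewrite {3}bE; ring.
    exact: JD.
  case/(IH a b') => [|Ja'|]; [|by left|by right; rewrite bE; exact: JDD].
  by rewrite -ltnS (leq_trans _ ltN) // ltnS -addnS leq_add2l -(prednK (n := msize b)) ?lt0n.
pose P a := `[< J a >].
have P1 : idealr_closed P.
  split; [exact/asboolP|apply/asboolP; exact: (Jd 0%N)|].
  by move=> c a b /asboolP Ja /asboolP Jb; apply/asboolP; exact: JD.
have P2 : prime_idealr_closed P.
  by move=> a b /asboolP/(prime_J _ a b (leqnn _))[] J1; apply/orP; [left|right]; exact/asboolP.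
have P3 : homogeneous_ideal P.
  by move=> a d /asboolP Ja; apply/asboolP; exact: Jh.
have P4 : exists i : 'I_n.+1, 'X_i \notin P.
  apply/existsP; apply: contraT => /existsPn N.
  case: (Jd 1%N); rewrite expr1; apply/asboolP; apply: (delta_relevant (p := P)).
  - by move=> c a b /asboolP Ja /asboolP Jb; apply/asboolP; exact: JD.
  - exact/asboolP.
  - by move=> i; have := N i; rewrite negbK.
exists (Proj P1 P2 P3 P4); split => [a Ia|]; first by apply/asboolP; exact: IJ.
by apply/asboolP => Jdelta; apply: (Jd 1%N).
Qed.
End PrimeAvoidance.
End Points.

(** * Sections, and units of the half-space *)

Section Sections.
Variables (k : fieldType) (n : nat).
Local Notation S := {mpoly k[n.+1]}.
Local Notation F := {fraction S}.
Local Notation eta := (generic_point k n).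
Implicit Types (p q : proj k n) (a b c : S) (V W : opens (proj k n)).

Lemma in_generic a : (a \in proj_ideal eta) = (a == 0).
Proof. by []. Qed.

(** The space is irreducible: the value of a section can be read off at the
    generic point, wherever the section is defined. *)
Lemma open_generic V p : V p -> V eta.
Proof.
case: V => U oU /=; have [E _ ->] := oU.
move=> /existsNP[f /not_implyP[Ef fp]]; apply/existsNP; exists f.
apply/not_implyP; split => //; rewrite in_generic => /eqP f0.
by apply: fp; rewrite f0; exact: ideal0.
Qed.

Lemma nonvanishing_open a d : a \is d.-homog -> open [set p : proj k n | a \notin proj_ideal p].
Proof.
move=> ad; exists [set a] => [_ ->|]; first by exists d.
apply/seteqP; split => p /= ap.
  by move/(_ _ erefl); exact/negP.
by apply/negP => ap'; apply: ap => _ ->.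
Qed.

Definition nonvanishing a d (ad : a \is d.-homog) : opens (proj k n) :=
  Opens (nonvanishing_open ad).

Lemma section_generic V (s : section V) p : V p -> s p = s eta.
Proof.
move=> Vp; have [W [Wp WV [d [a [b [_ _ Wab]]]]]] := (sectionP s).2 p Vp.
by rewrite (Wab p Wp).2 (Wab _ (open_generic Wp)).2.
Qed.

Lemma section_stalk V (s : section V) p : V p -> stalk p (s p).
Proof.
move=> Vp; have [W [Wp WV [d [a [b [ad bd Wab]]]]]] := (sectionP s).2 p Vp.
by exists d, a, b; have [bp sp] := Wab p Wp.
Qed.

Lemma section_val1 V p : V p -> (1 : section V) p = 1.
Proof. by move=> Vp; rewrite /= mem_set // mpolyC1 tofrac1. Qed.

Lemma section_cst_val V (c : k) p : V p -> section_cst V c p = (c%:MP)%:F.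
Proof. by move=> Vp; rewrite /= mem_set. Qed.

Section Fraction.
Variables (V : opens (proj k n)) (d : nat) (a b : S).
Hypotheses (ad : a \is d.-homog) (bd : b \is d.-homog).
Hypothesis bV : forall p, V p -> b \notin proj_ideal p.

Lemma is_section_frac : is_section V (fun p => if p \in (V : set _) then a%:F / b%:F else 0).
Proof.
split=> p Vp; first by rewrite memNset.
exists V; split => //; exists d, a, b; split => // q Vq.
by rewrite mem_set //; split => //; exact: bV.
Qed.

Definition section_frac : section V := Section is_section_frac.

Lemma section_fracE p : V p -> section_frac p = a%:F / b%:F.
Proof. by move=> Vp; rewrite /= mem_set. Qed.
End Fraction.

Lemma stalk_homog p (a b : S) (u : F) d : b != 0 -> b \is d.-homog ->
  stalk p u -> a%:F = b%:F * u -> a \is d.-homog.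
Proof.
move=> b0 bd [e [a' [b' [a'e b'e b'p ->]]]] ab.
have b'0 := notin_ideal_neq0 b'p.
have eab : a * b' = b * a'.
  apply/eqP; rewrite -tofrac_eq !tofracM ab -mulrA divfK ?tofrac_eq0 //.
apply: (homog_factor b'0 b'e); rewrite eab; exact: dhomogM.
Qed.
End Sections.

Section Units.
Variables (k : finFieldType) (n : nat).
Local Notation S := {mpoly k[n.+1]}.
Local Notation F := {fraction S}.
Local Notation L := (@linear_form k n).
Local Notation eta := (generic_point k n).

Lemma half_spaceP p : half_space k n p <-> forall l, l != 0 -> L l \notin proj_ideal p.
Proof.
split=> [pO l l0|H [l l0 lp]]; last by have := H l l0; rewrite lp.
by apply/negP => lp; apply: pO; exists l.
Qed.

Definition Delta : S := \prod_(l : 'rV[k]_n.+1 | l != 0) L l.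

Lemma Delta_split : is_split Delta.
Proof. by apply: split_prod => l; exact: split_linear_form. Qed.

Lemma half_space_generic : half_space k n eta.
Proof. by apply/half_spaceP => l l0; rewrite in_generic linear_form_eq0. Qed.

Lemma half_space_X p i : half_space k n p -> 'X_i \notin proj_ideal p.
Proof.
move/half_spaceP => H; rewrite -linear_form_delta; apply: H.
by rewrite -linear_form_eq0 linear_form_delta -msize_poly_eq0 msizeX.
Qed.

Lemma split_half_space a p : is_split a -> half_space k n p -> a \notin proj_ideal p.
Proof.
move=> sa /half_spaceP H; elim/split_ind: sa => [c c0|t f t0 _ fp].
  apply: contra (ideal1 p) => /(idealZ c^-1).
  by rewrite -mul_mpolyC -mpolyCM mulVf // mpolyC1.
by rewrite idealM negb_or H.
Qed.

Lemma Delta_half_space p : Delta \notin proj_ideal p -> half_space k n p.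
Proof.
move=> Dp; apply/half_spaceP => l l0; apply: contra Dp => lp.
by rewrite /Delta (bigD1 l) // idealM lp.
Qed.

(** The denominators [b] of [u] form a homogeneous ideal. If it contained no power
    of [Delta], it would be contained in a point where [Delta] does not vanish,
    that is in a point of the half-space; but [u] has a denominator there. *)
Lemma denominators_Delta (u : F) : (forall p, half_space k n p -> stalk p u) ->
  exists m (a : S), a%:F = (Delta ^+ m)%:F * u.
Proof.
move=> us; pose I : set S := [set b | exists a : S, a%:F = b%:F * u].
apply: contrapT => N.
have [e [a' [b' [a'e b'e b'0 uE]]]] := us _ half_space_generic.
rewrite in_generic in b'0.
have b'F : b'%:F != 0 by rewrite tofrac_eq0.
have IE b : I b <-> exists a : S, a * b' = b * a'.
  split=> -[a aE]; exists a.
    by apply/eqP; rewrite -tofrac_eq !tofracM aE uE -mulrA divfK.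
  by rewrite uE mulrA -tofracM -aE tofracM mulfK.
have [|c a b [x xE] [y yE]|d b|m [a aE]|P PD P0 PX|p [Ip Dp]] := @exists_prime_avoiding _ _ I Delta.
- by exists 0; rewrite tofrac0 mul0r.
- by exists (c * x + y); rewrite !tofracD !tofracM xE yE mulrDl mulrA.
- case/IE => a aE; apply/IE; exists (pihomog mdeg d a).
  by rewrite -!(pihomogM_homog _ _ b'e) -(pihomogM_homog _ _ a'e) aE.
- by apply: N; exists m, a.
- have [l l0] : exists l : 'rV[k]_n.+1, l != 0.
    exists (delta_mx 0 0); rewrite -linear_form_eq0 linear_form_delta.
    by rewrite -msize_poly_eq0 msizeX.
  rewrite /Delta (bigD1 l) //= mulrC -[_ * _]addr0; apply: (PD) => //.
  rewrite /linear_form; elim/big_ind: _ => // [x y Px Py|i _].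
    by rewrite -[x]mul1r; exact: PD.
  by rewrite -mul_mpolyC -[_ * _]addr0; exact: PD.
have [d [a [b [_ _ bp uab]]]] := us p (Delta_half_space Dp).
have b0 := notin_ideal_neq0 bp.
move/negP: bp; apply; apply: Ip; exists a.
by rewrite uab mulrC divfK ?tofrac_eq0.
Qed.

(** The numerators of [u] and of its inverse multiply to a power of [Delta]. *)
Lemma unit_split (u : F) : u != 0 -> (forall p, half_space k n p -> stalk p u) ->
  (forall p, half_space k n p -> stalk p u^-1) ->
  exists m (a : S), is_split a /\ a%:F = (Delta ^+ m)%:F * u.
Proof.
move=> u0 /denominators_Delta[m [a aE]] /denominators_Delta[m' [b bE]].
exists m, a; split => //; apply: (@split_factor _ _ a b).
have -> : a * b = Delta ^+ (m + m').
  apply/eqP; rewrite -tofrac_eq tofracM aE bE exprD [in X in _ == X]tofracM.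
  by rewrite mulrACA divff // mulr1.
by apply: splitX; exact: Delta_split.
Qed.
End Units.

(** * Morphisms given by graded substitutions *)

Section GradedSubstitution.
Variables (k : fieldType) (n : nat).
Local Notation S := {mpoly k[n.+1]}.
Local Notation F := {fraction S}.
Local Notation eta := (generic_point k n).

(** A substitution of forms of one degree for the variables is a rational map of
    the projective space to itself. The degree is positive so that homogeneous
    components pull back to homogeneous components. *)
Record gsub := Gsub {
  gsub_fun :> 'I_n.+1 -> S;
  gsub_deg : nat;
  gsub_deg_gt0 : (0 < gsub_deg)%N;
  gsub_homog : forall i, gsub_fun i \is gsub_deg.-homog }.

Section OneSubstitution.
Variable f : gsub.
Local Notation d := (gsub_deg f).
Local Notation phi := (msubst f).

Lemma msubst_monomial_homog m : phi 'X_[m] \is (d * mdeg m).-homog.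
Proof.
rewrite /msubst mmapX mdegE big_distrr /=; apply: prod_homog => i.
by apply: dhomogMn; exact: gsub_homog.
Qed.

Lemma msubst_homog e a : a \is e.-homog -> phi a \is (d * e).-homog.
Proof.
move/dhomogP => ae; rewrite [a]mpolyE rmorph_sum /= big_seq; apply: rpred_sum => m ma.
rewrite msubstZ; apply: rpredZ; rewrite -(ae m ma); exact: msubst_monomial_homog.
Qed.

Lemma pihomog_msubst e a : pihomog mdeg (d * e) (phi a) = phi (pihomog mdeg e a).
Proof.
transitivity (\sum_(m <- msupp a) pihomog mdeg (d * e) (phi (a@_m *: 'X_[m]))).
  by rewrite {1}(mpolyE a) rmorph_sum raddf_sum.
have -> : pihomog mdeg e a = \sum_(m <- msupp a) pihomog mdeg e (a@_m *: 'X_[m]).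
  by rewrite {1}(mpolyE a) raddf_sum.
rewrite [RHS]rmorph_sum /=.
apply: eq_bigr => m _; rewrite msubstZ !linearZ /= msubstZ; congr (_ *: _).
rewrite pihomogX; case: (eqVneq (mdeg m) e) => [<-|me].
  by rewrite pihomog_dE // msubst_monomial_homog.
rewrite (pihomog_ne0 _ (msubst_monomial_homog m)) ?rmorph0 //.
by rewrite eqn_pmul2l ?gsub_deg_gt0.
Qed.

Definition defined_at (p : proj k n) := exists i, f i \notin proj_ideal p.

Lemma pull_idealr p : idealr_closed (fun a => phi a \in proj_ideal p).
Proof.
split; first by change (is_true (phi 0 \in proj_ideal p)); rewrite rmorph0 ideal0.
  by change (is_true (phi 1 \notin proj_ideal p)); rewrite rmorph1 ideal1.
move=> c a b ap bp; change (is_true (phi (c * a + b) \in proj_ideal p)).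
by rewrite rmorphD rmorphM; apply: idealD => //; exact: idealMl.
Qed.

Lemma pull_prime p : prime_idealr_closed (fun a => phi a \in proj_ideal p).
Proof.
move=> a b ab; change (is_true (phi (a * b) \in proj_ideal p)) in ab.
by move: ab; rewrite rmorphM idealM.
Qed.

Lemma pull_homog p : homogeneous_ideal (fun a => phi a \in proj_ideal p).
Proof.
move=> a e ap; change (is_true (phi (pihomog mdeg e a) \in proj_ideal p)).
by rewrite -pihomog_msubst; exact: proj_homog.
Qed.

Lemma pull_relevant p : defined_at p -> exists i : 'I_n.+1, 'X_i \notin (fun a => phi a \in proj_ideal p).
Proof.
by move=> [i fi]; exists i; change (is_true (phi 'X_i \notin proj_ideal p)); rewrite msubstX.
Qed.

(** The image of a point is the inverse image of its ideal. Where the rational map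
    is not defined, the generic point is a default value. *)
Definition pull p : proj k n :=
  if pselect (defined_at p) is left h
  then Proj (@pull_idealr p) (@pull_prime p) (@pull_homog p) (pull_relevant h)
  else eta.

Lemma pullE p a : defined_at p -> (a \in proj_ideal (pull p)) = (phi a \in proj_ideal p).
Proof. by rewrite /pull; case: pselect. Qed.

(** All stalks are subrings of one field, so the comorphisms of a dominant
    rational map are restrictions of a single endomorphism of that field. *)
Definition fsubst : F -> F := frac_ext (@FracField.tofrac S \o phi).

Hypothesis phi_inj : forall a, a != 0 -> phi a != 0.

Lemma tofrac_phi_neq0 a : a != 0 -> (@FracField.tofrac S \o phi) a != 0.
Proof. by rewrite /= tofrac_eq0; exact: phi_inj. Qed.

Lemma fsubst_frac a b : b != 0 -> fsubst (a%:F / b%:F) = (phi a)%:F / (phi b)%:F.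
Proof. exact: (frac_extE tofrac_phi_neq0). Qed.
Lemma fsubst_tofrac a : fsubst a%:F = (phi a)%:F.
Proof. exact: (frac_ext_tofrac tofrac_phi_neq0). Qed.
Lemma fsubstD : {morph fsubst : x y / x + y}.
Proof. exact: (frac_extD tofrac_phi_neq0). Qed.
Lemma fsubstM : {morph fsubst : x y / x * y}.
Proof. exact: (frac_extM tofrac_phi_neq0). Qed.
Lemma fsubst0 : fsubst 0 = 0.
Proof. exact: (frac_ext0 tofrac_phi_neq0). Qed.
Lemma fsubst1 : fsubst 1 = 1.
Proof. exact: (frac_ext1 tofrac_phi_neq0). Qed.

Section Morphism.
Variables (X Y : opens (proj k n)).
Hypothesis Xdef : forall p, X p -> defined_at p.
Hypothesis XY : forall p, X p -> Y (pull p).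

Lemma pull_cont : {within X, continuous pull}.
Proof.
apply/continuousP => _ [E Eh ->]; apply/open_subspaceP.
exists (~` zeros [set phi a | a in E]).
  exists [set phi a | a in E] => // _ [a Ea <-].
  by have [e ae] := Eh a Ea; exists (d * e)%N; exact: msubst_homog.
apply/seteqP; split => p [Vp Xp]; split => //= Z; apply: Vp.
  by move=> _ [a Ea <-]; rewrite -pullE; [exact: Z | exact: Xdef].
by move=> a Ea; rewrite pullE; [apply: Z; exists a | exact: Xdef].
Qed.

Section Comorphism.
Variable V : opens (proj k n).
Local Notation U := (preim_opens pull_cont V).

Lemma is_section_pull (s : section V) :
  is_section U (fun p => if p \in (U : set _) then fsubst (s (pull p)) else 0).
Proof.
split=> p Up; first by rewrite memNset.
have [Xp Vp] := Up.
have [W [Wp WV [e [a [b [ae be Wab]]]]]] := (sectionP s).2 _ Vp.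
exists (preim_opens pull_cont W); split => //=; first by move=> q [Xq Wq]; split => //; exact: WV.
exists (d * e)%N, (phi a), (phi b); split; [exact: msubst_homog..|].
move=> q [Xq Wq]; have [bq sq] := Wab _ Wq.
rewrite -pullE //; last exact: Xdef.
split=> //; rewrite mem_set; last by split => //; exact: WV.
by rewrite sq fsubst_frac //; exact: notin_ideal_neq0 bq.
Qed.

Definition pull_section (s : section V) : section U := Section (is_section_pull s).

Lemma pull_sectionE s p : X p -> V (pull p) -> pull_section s p = fsubst (s (pull p)).
Proof. by move=> Xp Vp /=; rewrite mem_set. Qed.

Lemma pull_section_zmod : zmod_morphism pull_section.
Proof.
move=> s t; apply: section_eq => p; rewrite /=.
case: ifP => _; last by rewrite oppr0 addr0.
rewrite fsubstD; congr (_ + _); apply/eqP; rewrite -addr_eq0.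
by rewrite -fsubstD addNr fsubst0.
Qed.

Lemma pull_section_monoid : monoid_morphism pull_section.
Proof.
split=> [|s t]; apply: section_eq => p; rewrite /=.
  case: (pselect (U p)) => [Up|Up]; last by rewrite memNset.
  have [Xp Vp] := Up.
  by rewrite !mem_set // mpolyC1 tofrac1 fsubst1.
by case: ifP => _; rewrite ?mulr0 // fsubstM.
Qed.

HB.instance Definition _ := GRing.isZmodMorphism.Build _ _ pull_section pull_section_zmod.
HB.instance Definition _ := GRing.isMonoidMorphism.Build _ _ pull_section pull_section_monoid.

Definition pull_comorph : {rmorphism section V -> section U} := pull_section.
End Comorphism.

Definition subst_morphism : morphism X Y.
Proof.
refine (@Morphism _ _ X Y pull XY pull_cont (fun V _ => pull_comorph V) _ _ _).
- move=> V W VY WY WV s p Xp Wp.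
  rewrite !pull_sectionE //; last exact: WV.
  by rewrite /= mem_set.
- move=> V VY c; apply: section_eq => p /=.
  case: (pselect (preim_opens pull_cont V p)) => [Up|Up]; last by rewrite !memNset.
  by rewrite !mem_set //; [rewrite fsubst_tofrac msubstC | case: Up].
- move=> V VY s p Xp Vp; rewrite pull_sectionE // => -[e [a [b [ae be ap bp ->]]]].
  exists (d * e)%N, (phi a), (phi b); split; [exact: msubst_homog..| | |].
  + by rewrite -pullE //; exact: Xdef.
  + by rewrite -pullE //; exact: Xdef.
  + by rewrite fsubst_frac //; exact: notin_ideal_neq0 bp.
Defined.
End Morphism.
End OneSubstitution.

(** [psi] is the restriction of the rational map [f]. *)
Definition induced (f : gsub) (X Y : opens (proj k n)) (psi : morphism X Y) :=
  (forall p, X p -> defined_at f p) /\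
  (forall p, X p -> psi p = pull f p) /\
  (forall (V : opens (proj k n)) (VY : V `<=` Y) (s : section V) p, X p -> V (psi p) ->
    comorph psi VY s p = fsubst f (s (psi p))).

Lemma subst_morphism_induced (f : gsub) (X Y : opens (proj k n)) inj (Xdef : forall p, X p -> defined_at f p) XY :
  induced f (@subst_morphism f inj X Y Xdef XY).
Proof.
by split => //; split => // V VY s p Xp Vp; rewrite /= mem_set.
Qed.

Lemma induced_left_inverse (f g : gsub) (X Y : opens (proj k n)) (psi : morphism X Y) (chi : morphism Y X) :
  (forall a, a != 0 -> msubst f a != 0) -> (forall a, a != 0 -> msubst g a != 0) ->
  (forall i, msubst f (g i) = 'X_i) -> induced f psi -> induced g chi ->
  left_inverse_of psi chi.
Proof.
move=> finj ginj fg [fdef [fpt fco]] [gdef [gpt gco]].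
have fgK a : msubst f (msubst g a) = a.
  elim/mpoly_ring_ind: a => [c|i|a b IHa IHb|a b IHa IHb].
  - by rewrite !msubstC.
  - by rewrite msubstX.
  - by rewrite !rmorphD /= IHa IHb.
  - by rewrite !rmorphM /= IHa IHb.
have psiY p : X p -> Y (psi p) by exact: base_fun.
have ptK p : X p -> chi (psi p) = p.
  move=> Xp; apply: proj_eq => a; rewrite gpt; last exact: psiY.
  rewrite pullE; last by apply: gdef; exact: psiY.
  by rewrite fpt // pullE ?fgK //; exact: fdef.
split => // V VX s p Vp; have Xp := VX p Vp.
rewrite fco //; last by split; [exact: psiY | rewrite /= ptK].
rewrite gco //; [|exact: psiY|by rewrite ptK].
rewrite ptK // (fracE (s p)) fsubst_frac ?fden_neq0 //.
by rewrite fsubst_frac ?ginj ?fden_neq0 // !fgK.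
Qed.

End GradedSubstitution.

(** * Separable endomorphisms of the half-space are linear *)

Section Dehomogenization.
Variables (k : fieldType) (n : nat).
Local Notation S := {mpoly k[n.+1]}.
Local Notation F := {fraction S}.

Lemma mpolyX_neq0 (i : 'I_n.+1) : ('X_i : S) != 0.
Proof. by rewrite -msize_poly_eq0 msizeX. Qed.

(** A form of degree [e] evaluated at g_i / z is its value at g divided by z^e. *)
Lemma feval_dehomog (g : 'I_n.+1 -> S) (z : S) e a : a \is e.-homog -> z != 0 ->
  feval (fun i => (g i)%:F / z%:F) a = (msubst g a)%:F / (z ^+ e)%:F.
Proof.
move/dhomogP => ae z0; have zF : z%:F != 0 by rewrite tofrac_eq0.
have -> : msubst g a = \sum_(m <- msupp a) msubst g (a@_m *: 'X_[m]).
  by rewrite {1}(mpolyE a) rmorph_sum.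
rewrite [in LHS](mpolyE a) (rmorph_sum (@FracField.tofrac S)) rmorph_sum /= mulr_suml.
apply: eq_big_seq => m /ae <- /=.
rewrite -!mul_mpolyC !rmorphM /= fevalC msubstC -mulrA; congr (_ * _).
rewrite /feval mmapX /msubst mmapX /mmap1 mdegE.
rewrite !rmorphXn /= -prodrXr rmorph_prod /= -prodf_div; apply: eq_bigr => i _.
by rewrite rmorphXn /= expr_div_n.
Qed.

Lemma msubst_id (a : S) : msubst (fun i => 'X_i) a = a.
Proof.
elim/mpoly_ring_ind: a => [c|i|a b IHa IHb|a b IHa IHb].
- by rewrite msubstC.
- by rewrite msubstX.
- by rewrite rmorphD /= IHa IHb.
- by rewrite rmorphM /= IHa IHb.
Qed.

Lemma feval_linear_form (u : 'I_n.+1 -> F) l :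
  feval u (linear_form l) = \sum_i ((l 0 i)%:MP)%:F * u i.
Proof.
rewrite /linear_form rmorph_sum /=; apply: eq_bigr => i _.
by rewrite -mul_mpolyC rmorphM /= fevalC fevalX.
Qed.

Lemma homog1_linear_form (f : S) : f \is 1.-homog -> f = linear_form (\row_i f@_U_(i)).
Proof.
move=> f1; apply/mpolyP => m; have [/eqP/mdeg1P[i /eqP->]|m1] := eqVneq (mdeg m) 1%N.
  by rewrite mcoeff_linear_form mxE.
by rewrite (dhomog_nemf_coeff f1 m1) (dhomog_nemf_coeff (linear_form_homog _) m1).
Qed.
End Dehomogenization.

Section Endomorphism.
Variables (k : finFieldType) (n : nat).
Local Notation S := {mpoly k[n.+1]}.
Local Notation F := {fraction S}.
Local Notation L := (@linear_form k n).
Local Notation eta := (generic_point k n).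
Local Notation Omega := (half_space k n).
Variable psi : morphism Omega Omega.

Lemma psi_half_space p : Omega p -> Omega (psi p).
Proof. exact: (base_fun psi). Qed.

Lemma comorph_generic (V : opens (proj k n)) (VY : V `<=` Omega) (s : section V) p : Omega p -> V (psi p) ->
  comorph psi VY s p = comorph psi VY s eta.
Proof. by move=> Op Vp; apply: section_generic; split. Qed.

Lemma comorph_stalk (V : opens (proj k n)) (VY : V `<=` Omega) (s : section V) p : Omega p -> V (psi p) ->
  stalk p (comorph psi VY s p).
Proof. by move=> Op Vp; apply: section_stalk; split. Qed.

Lemma X_homog (i : 'I_n.+1) : ('X_i : S) \is 1.-homog.
Proof. by rewrite dhomogX; apply/eqP; exact: mdeg1. Qed.

Definition affine_coord i : section Omega :=
  section_frac (X_homog i) (X_homog 0) (fun p => @half_space_X _ _ p 0).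

Definition coord_image i : F := comorph psi (@subset_refl _ Omega) (affine_coord i) eta.

Lemma Omega_generic : (preim_opens (@base_cont _ _ _ _ psi) Omega) eta.
Proof. by split; [|apply: psi_half_space]; exact: (@half_space_generic k n). Qed.

Lemma coord_image0 : coord_image 0 = 1.
Proof.
rewrite /coord_image (_ : affine_coord 0 = 1).
  by rewrite rmorph1 section_val1 //; exact: Omega_generic.
apply: section_eq => p /=; case: ifP => // _.
by rewrite divff ?mpolyC1 ?tofrac1 // tofrac_eq0 mpolyX_neq0.
Qed.

(** The comorphism is only given as a ring morphism; this identifies its values
    on polynomials in the affine coordinates. *)
Lemma evaluation_section a : exists s : section Omega,
  (forall p, Omega p -> s p = feval (fun i => ('X_i)%:F / ('X_0)%:F) a) /\
  comorph psi (@subset_refl _ Omega) s eta = feval coord_image a.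
Proof.
elim/mpoly_ring_ind: a => [c|i|a b [s [sE sv]] [t [tE tv]]|a b [s [sE sv]] [t [tE tv]]].
- exists (section_cst Omega c); split => [p Op|]; first by rewrite section_cst_val // fevalC.
  by rewrite comorph_cst section_cst_val ?fevalC //; exact: Omega_generic.
- exists (affine_coord i); rewrite !fevalX; split => // p Op.
  by rewrite section_fracE // fevalX.
- have fD r : feval r (a + b) = feval r a + feval r b by rewrite rmorphD.
  exists (s + t); rewrite (fD coord_image) -sv -tv; split => [p Op|]; last by rewrite rmorphD.
  by rewrite fD -(sE _ Op) -(tE _ Op).
- have fM r : feval r (a * b) = feval r a * feval r b by rewrite rmorphM.
  exists (s * t); rewrite (fM coord_image) -sv -tv; split => [p Op|]; last by rewrite rmorphM.
  by rewrite fM -(sE _ Op) -(tE _ Op).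
Qed.

Lemma feval_homog e a : a \is e.-homog ->
  feval (fun i => ('X_i)%:F / ('X_0)%:F) a = a%:F / ('X_0 ^+ e)%:F :> F.
Proof. by move=> ae; rewrite (feval_dehomog _ ae) ?mpolyX_neq0 // msubst_id. Qed.

Lemma comorph_frac (V : opens (proj k n)) (VO : V `<=` Omega) e (a b : S)
    (ae : a \is e.-homog) (be : b \is e.-homog)
    (bV : forall p, V p -> b \notin proj_ideal p) p : Omega p -> V (psi p) ->
  comorph psi VO (section_frac ae be bV) p * feval coord_image b = feval coord_image a.
Proof.
move=> Op Vp; have [s [sE sv]] := evaluation_section a; have [t [tE tv]] := evaluation_section b.
have OO : Omega `<=` Omega by [].
have Ores (r : section Omega) : comorph psi VO (section_res VO r) p =
    comorph psi (@subset_refl _ Omega) r eta.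
  by rewrite (comorph_res (@subset_refl _ Omega)) // comorph_generic //; exact: VO.
rewrite -tv -sv -!Ores.
have -> : section_res VO s = section_frac ae be bV * section_res VO t.
  apply: section_eq => q /=; case: (pselect (V q)) => Vq; last by rewrite !memNset // mul0r.
  have Oq := VO q Vq.
  rewrite !mem_set // (sE _ Oq) (tE _ Oq) (feval_homog ae) (feval_homog be).
  have b0 : b%:F != 0 by rewrite tofrac_eq0; exact: notin_ideal_neq0 (bV _ Vq).
  by rewrite mulrA (divfK b0).
by rewrite (rmorphM (comorph psi VO)).
Qed.

(** Locally at [psi p] a section is a fraction [a / b]; multiplying it by the
    section [b / X_0 ^ e], where [e] is the degree of [b], gives a section to
    which [evaluation_section] applies. *)
Lemma comorph_value (V : opens (proj k n)) (VO : V `<=` Omega) (s : section V) e (a b : S) p :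
  a \is e.-homog -> b \is e.-homog -> Omega p -> V (psi p) ->
  b \notin proj_ideal (psi p) -> s (psi p) = a%:F / b%:F ->
  feval coord_image b != 0 /\ comorph psi VO s p * feval coord_image b = feval coord_image a.
Proof.
move=> ae be Op Vp bp sab.
pose W := opensI V (nonvanishing be).
have WV : W `<=` V by move=> q [].
have WO : W `<=` Omega by move=> q /WV/VO.
have bW q : W q -> b \notin proj_ideal q by move=> [].
have Wp : W (psi p) by [].
have Xe : ('X_0 : S) ^+ e \is e.-homog by have := dhomogMn e (X_homog 0); rewrite mul1n.
split.
  have := comorph_frac WO Xe be bW Op Wp.
  rewrite rmorphXn /= fevalX coord_image0 expr1n => /eqP; apply: contraTneq => ->.
  by rewrite mulr0 eq_sym oner_eq0.
rewrite -(comorph_frac WO ae be bW Op Wp) -(comorph_res VO WO WV) //; congr (comorph _ _ _ _ * _).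
apply: section_eq => q; rewrite /=; case: (pselect (W q)) => Wq; last by rewrite !memNset.
by rewrite !mem_set // (section_generic s (WV _ Wq)) -sab; apply/esym; exact: section_generic.
Qed.

(** [L l / X_0] is invertible on the half-space, hence so is its image. *)
Lemma feval_linear_unit l : l != 0 -> feval coord_image (L l) != 0 /\
  (forall p, Omega p -> stalk p (feval coord_image (L l)) /\ stalk p (feval coord_image (L l))^-1).
Proof.
move=> l0; have lO q : Omega q -> L l \notin proj_ideal q by move/half_spaceP; apply.
have H q (Oq : Omega q) := comorph_frac (@subset_refl _ Omega)
  (X_homog 0) (linear_form_homog l) lO Oq (psi_half_space Oq).
have v0 : feval coord_image (L l) != 0.
  have := H _ (@half_space_generic k n); rewrite fevalX coord_image0 => /eqP; apply: contraTneq => ->.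
  by rewrite mulr0 eq_sym oner_eq0.
split => // p Op; split.
  have := comorph_frac (@subset_refl _ Omega) (linear_form_homog l) (X_homog 0)
    (fun q => @half_space_X _ _ q 0) Op (psi_half_space Op).
  by rewrite fevalX coord_image0 mulr1 => <-; apply: comorph_stalk => //; exact: psi_half_space.
have := H _ Op; rewrite fevalX coord_image0 => /(canRL (mulfK v0)); rewrite mul1r => <-.
by apply: comorph_stalk => //; exact: psi_half_space.
Qed.

(** The rational map [psi] in homogeneous coordinates. *)
Definition represents d (f : 'I_n.+1 -> S) := [/\ forall j, f j \is d.-homog, f 0 != 0,
  forall j, coord_image j = (f j)%:F / (f 0)%:F & forall l, l != 0 -> is_split (comb f l)].

Lemma comb_frac (f : 'I_n.+1 -> S) (z : F) l : (forall j, (f j)%:F = z * coord_image j) ->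
  (comb f l)%:F = z * feval coord_image (L l).
Proof.
move=> fE; rewrite feval_linear_form rmorph_sum mulr_sumr; apply: eq_bigr => i _ /=.
by rewrite -mul_mpolyC tofracM fE mulrCA.
Qed.

Lemma delta_row_neq0 i : delta_mx 0 i != 0 :> 'rV[k]_n.+1.
Proof. by rewrite -linear_form_eq0 linear_form_delta mpolyX_neq0. Qed.

Lemma exists_represents : exists d f, represents d f.
Proof.
have /choice [ma maE] : forall j, exists ma : nat * S, ma.2%:F = (Delta k n ^+ ma.1)%:F * coord_image j.
  move=> j; have [v0 vs] := feval_linear_unit (delta_row_neq0 j).
  have [|m [a aE]] := @denominators_Delta k n (coord_image j).
    by move=> p Op; have [+ _] := vs p Op; rewrite linear_form_delta fevalX.
  by exists (m, a).
pose M := (\sum_j (ma j).1)%N.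
pose f j := Delta k n ^+ (M - (ma j).1) * (ma j).2.
have fE j : (f j)%:F = (Delta k n ^+ M)%:F * coord_image j.
  rewrite /f tofracM maE mulrA -tofracM -exprD subnK //.
  by rewrite /M (bigD1 j) //= leq_addr.
have [D Dh] : exists D, Delta k n \is D.-homog.
  exists (\sum_(l : 'rV[k]_n.+1 | l != 0%R) 1)%N.
  rewrite /Delta; elim/big_rec2: _ => [|l e x _ xe]; first exact: dhomog1.
  by apply: dhomogM => //; exact: linear_form_homog.
have Dn m : Delta k n ^+ m != 0 by rewrite expf_neq0 //; exact: split_neq0 (Delta_split k n).
have f0E : f 0 = Delta k n ^+ M.
  by apply/eqP; rewrite -tofrac_eq fE coord_image0 mulr1.
exists (D * M)%N, f; split.
- move=> j; have [v0 vs] := feval_linear_unit (delta_row_neq0 j).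
  have [+ _] := vs _ (@half_space_generic k n); rewrite linear_form_delta fevalX => uj.
  by apply: (stalk_homog (Dn M) (dhomogMn M Dh) uj (fE j)).
- by rewrite f0E.
- move=> j; rewrite fE f0E.
  have DF : (Delta k n ^+ M)%:F != 0 by rewrite tofrac_eq0.
  by rewrite mulrAC (divff DF) mul1r.
move=> l l0; have [v0 vs] := feval_linear_unit l0.
have [|p Op|m [a [sa aE]]] := @unit_split k n (feval coord_image (L l)) v0.
- by move=> p /vs[].
- by have [] := vs p Op.
apply: (@split_factor _ _ _ (Delta k n ^+ m)).
have -> : comb f l * Delta k n ^+ m = Delta k n ^+ M * a.
  apply/eqP; rewrite -tofrac_eq !tofracM aE (comb_frac _ fE).
  by rewrite -!mulrA [_%:F * feval _ _]mulrC.
by apply: splitM => //; apply: splitX; exact: Delta_split.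
Qed.

(** Constants [f 0], [f 1] would be linearly dependent over [k]. *)
Lemma represents_deg_gt0 d f : (0 < n)%N -> represents d f -> (0 < d)%N.
Proof.
move=> n0 [fd f0 _ fs]; rewrite lt0n; apply/negP => /eqP d0.
have cst j : exists c, f j = c%:MP.
  have : (msize (f j) <= 1)%N by have := msize_homog (fd j); rewrite d0.
  by move/msize1_polyC => ->; exists (f j)@_0.
have [c0 c0E] := cst 0; have [c1 c1E] := cst (Ordinal (n0 : (1 < n.+1)%N)).
set i1 := Ordinal _ in c1E.
(* The combination [c1 * f 0 - c0 * f 1] of the two constants is zero. *)
pose l : 'rV[k]_n.+1 := c1 *: delta_mx 0 0 - c0 *: delta_mx 0 i1.
have c0n : c0 != 0 by apply: contraNneq f0 => c00; rewrite c0E c00 mpolyC0.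
have l0 : l != 0.
  apply/eqP => /matrixP/(_ 0 i1)/eqP; rewrite !mxE !eqxx mulr0 sub0r mulr1 oppr_eq0.
  by rewrite (negbTE c0n).
have := split_neq0 (fs l l0); apply/negP; rewrite negbK.
rewrite /l combD combZ -scaleNr combZ !comb_delta c0E c1E scaleNr.
by rewrite -!mul_mpolyC -!mpolyCM mulrC subrr.
Qed.

(** A representation of minimal degree: a common linear factor can be divided
    out. *)
Lemma exists_coprime_represents : (0 < n)%N -> exists d f, represents d f /\
  (forall t, t != 0 -> exists j, ~ mdvd (L t) (f j)).
Proof.
move=> n0; pose P d := `[< exists f, represents d f >].
have exP : exists d, P d.
  by have [d [f rf]] := exists_represents; exists d; apply/asboolP; exists f.
case: (ex_minnP exP) => d /asboolP[f rf] dmin; exists d, f; split => // t t0.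
apply: contrapT => N.
have dv j : mdvd (L t) (f j) by apply: contrapT => Nj; apply: N; exists j.
have [h hE] := choice dv.
have d0 := represents_deg_gt0 n0 rf; have [fd f0 uf fs] := rf.
have Lt0 : L t != 0 by rewrite linear_form_eq0.
have : P d.-1.
  apply/asboolP; exists h; split.
  - move=> j; apply: (homog_factor Lt0 (linear_form_homog t)).
    by rewrite -hE addn1 prednK.
  - by apply: contraNneq f0 => h0; rewrite hE h0 mul0r.
  - move=> j; have LF : (L t)%:F != 0 by rewrite tofrac_eq0.
    by rewrite uf !hE !tofracM -mulf_div (divff LF) mulr1.
  - move=> l l0; apply: (@split_factor _ _ _ (L t)).
    have -> : comb h l * L t = comb f l.
      by rewrite mulr_suml; apply: eq_bigr => i _; rewrite hE scalerAl.
    exact: fs.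
by move/dmin; rewrite leqNgt prednK // leqnn.
Qed.

Lemma split_has_factor (a : S) d : is_split a -> a \is d.-homog -> (0 < d)%N ->
  exists2 t, t != 0 & mdvd (L t) a.
Proof.
elim/split_ind => [c c0 ch|t b t0 _ _ _ _]; last by exists t => //; exists b; rewrite mulrC.
have c0h : (c%:MP : S) \is 0.-homog.
  by rewrite -[c%:MP]mulr1 mul_mpolyC; apply: rpredZ; exact: dhomog1.
by have <- := dhomog_uniq _ c0h ch; rewrite ?mpolyC_eq0.
Qed.

Lemma represents_jacobian d f (t : 'rV[k]_n.+1) (C : 'M[k]_(n.+1, n)) (C' : 'M[k]_(n, n.+1)) : represents d f -> separable_morphism psi ->
  t != 0 -> t *m C = 0 -> C' *m C = 1%:M -> jacobian f C != 0.
Proof.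
move=> [fd f0 uf fs] sep t0 tC C'C.
apply: (jacobian_neq0 t0 tC C'C f0) => i.
have [|p [pK sp px]] := sep (('X_i)%:F / ('X_0)%:F).
  exists 1%N, 'X_i, 'X_0; split => //; [exact: X_homog|exact: X_homog|].
  by rewrite in_generic mpolyX_neq0.
exists p; split => // j; have [V [VO [s [Vp ->]]]] := pK j.
have [e [a [b [ae be bp sE]]]] := section_stalk s Vp.
have [b0 sab] := comorph_value VO ae be (@half_space_generic k n) Vp bp sE.
by exists a, b; rewrite -(funext uf).
Qed.

Lemma separable_represents_linear d f : (0 < n)%N -> separable_morphism psi ->
  represents d f -> (forall t, t != 0 -> exists j, ~ mdvd (L t) (f j)) -> d = 1%N.
Proof.
move=> n0 sep rf cop; have d0 := represents_deg_gt0 n0 rf.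
have [fd f0 uf fs] := rf.
have ch l : comb f l \is d.-homog by rewrite /comb; apply: rpred_sum => i _; apply: rpredZ; exact: fd.
have [t t0 tf] := split_has_factor (fs _ (delta_row_neq0 0)) (ch _) d0.
have [C [C' [tC C'C]]] := tangent_frame t0.
have J0 := represents_jacobian rf sep t0 tC C'C.
apply/eqP; rewrite eqn_leq d0 andbT.
by apply: (degree_le1 n0 fd fs cop t0 tC _ J0); exists (delta_mx 0 0) => //; exact: delta_row_neq0.
Qed.

(** Since the comorphisms are local, they determine the map on points: a form
    vanishes at [psi p] exactly if its pullback vanishes at [p]. *)
Lemma represents_induced (f : gsub k n) d : represents d f ->
  (forall a, a != 0 -> msubst f a != 0) -> induced f psi.
Proof.
move=> [fd f0 uf fs] finj.
have f0O p : Omega p -> f 0 \notin proj_ideal p.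
  by move=> Op; rewrite -comb_delta; apply: split_half_space Op; apply: fs; exact: delta_row_neq0.
have fdef p : Omega p -> defined_at f p by move=> Op; exists 0; exact: f0O.
have uE e a : a \is e.-homog -> feval coord_image a = (msubst f a)%:F / (f 0 ^+ e)%:F.
  by move=> ae; rewrite (funext uf); exact: feval_dehomog.
have f0X e : (f 0 ^+ e)%:F != 0 by rewrite tofrac_eq0 expf_neq0.
split => //; split => [p Op|V VO s p Op Vp].
  apply: proj_eq_homog => a e ae; rewrite pullE; last exact: fdef.
  have Xe : ('X_0 : S) ^+ e \is e.-homog by have := dhomogMn e (X_homog 0); rewrite mul1n.
  have uX : feval coord_image ('X_0 ^+ e) = 1 by rewrite rmorphXn /= fevalX coord_image0 expr1n.
  have Opsi := psi_half_space Op.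
  have [ap|ap] := boolP (a \in proj_ideal (psi p)); apply/esym.
    have XO q : Omega q -> ('X_0 : S) ^+ e \notin proj_ideal q.
      by move=> Oq; apply: notin_idealX; exact: half_space_X.
    have [|e' [a' [b' [_ _ a'p b'p vE]]]] := comorph_local (m := psi) (@subset_refl _ Omega)
       (s := section_frac ae Xe XO) Op Opsi.
      by exists e, a, ('X_0 ^+ e); split => //; [exact: XO|exact: section_fracE].
    have := comorph_frac (@subset_refl _ Omega) ae Xe XO Op Opsi.
    rewrite vE uX mulr1 (uE e) // => /eqP.
    rewrite eq_frac ?expf_neq0 //; last exact: notin_ideal_neq0 b'p.
    move=> /eqP E; have : a' * f 0 ^+ e \in proj_ideal p by rewrite idealM a'p.
    by rewrite E idealM (negbTE b'p) orbF.
  pose W := opensI Omega (nonvanishing ae).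
  have WO : W `<=` Omega by move=> q [].
  have Wa q : W q -> a \notin proj_ideal q by move=> [].
  have Wp : W (psi p) by [].
  have [e' [a' [b' [_ _ b'p vE]]]] := comorph_stalk WO (section_frac Xe ae Wa) Op Wp.
  have := comorph_frac WO Xe ae Wa Op Wp.
  rewrite vE uX (uE e) // => E; apply/negbTE/negP => ap'.
  have : a' * msubst f a = b' * f 0 ^+ e.
    have b'0 : b'%:F != 0 by rewrite tofrac_eq0; exact: notin_ideal_neq0 b'p.
    apply/eqP; rewrite -tofrac_eq !tofracM; apply/eqP.
    move: E; rewrite mulf_div => /(canRL (divfK (mulf_neq0 b'0 (f0X e)))).
    by rewrite mul1r.
  move=> E'; have : b' * f 0 ^+ e \in proj_ideal p by rewrite -E'; exact: idealMl.
  by rewrite idealM (negbTE b'p) (negbTE (notin_idealX e (f0O p Op))).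
have [e [a [b [ae be bp sE]]]] := section_stalk s Vp.
have [b0 sab] := comorph_value VO ae be Op Vp bp sE.
have b0' := notin_ideal_neq0 bp.
rewrite sE (fsubst_frac finj) // -[LHS](mulfK b0) sab !(uE e) //.
by rewrite invf_div mulrA (divfK (f0X e)).
Qed.
End Endomorphism.

(** * Linear substitutions *)

Section LinearSubstitution.
Variables (k : fieldType) (n : nat) (A : 'M[k]_n.+1).
Hypothesis uA : A \in unitmx.
Local Notation S := {mpoly k[n.+1]}.
Local Notation L := (@linear_form k n).

Definition linear_gsub : gsub k n :=
  @Gsub k n (fun j => L (row j A)) 1 isT (fun j => linear_form_homog (row j A)).

Lemma msubst_linear_gsub l : msubst linear_gsub (L l) = L (l *m A).
Proof.
by rewrite msubst_linear_form mulmx_sum_row linear_sum; apply: eq_bigr => i _; rewrite linearZ.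
Qed.

Lemma linear_gsub_row_neq0 (l : 'rV[k]_n.+1) : l != 0 -> l *m A != 0.
Proof.
apply: contraNneq => /(congr1 (mulmx^~ (invmx A))) /=.
by rewrite mulmxK // mul0mx => ->.
Qed.
End LinearSubstitution.

Section LinearAutomorphism.
Variables (k : fieldType) (n : nat).
Local Notation S := {mpoly k[n.+1]}.
Local Notation L := (@linear_form k n).

Lemma linear_gsubK (A : 'M[k]_n.+1) : A \in unitmx -> forall i,
  msubst (linear_gsub A) (linear_gsub (invmx A) i) = 'X_i.
Proof.
move=> uA i; rewrite -[linear_gsub _ i]/(L (row i (invmx A))) msubst_linear_gsub.
by rewrite -row_mul mulVmx // row1 linear_form_delta.
Qed.

Lemma linear_gsub_comp (A : 'M[k]_n.+1) : A \in unitmx ->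
  cancel (msubst (linear_gsub (invmx A))) (msubst (linear_gsub A)).
Proof.
move=> uA a; elim/mpoly_ring_ind: a => [c|i|a b IHa IHb|a b IHa IHb].
- by rewrite !msubstC.
- by rewrite msubstX linear_gsubK.
- by rewrite !rmorphD /= IHa IHb.
- by rewrite !rmorphM /= IHa IHb.
Qed.

Lemma linear_gsub_inj (A : 'M[k]_n.+1) : A \in unitmx ->
  forall a, a != 0 -> msubst (linear_gsub A) a != 0.
Proof.
move=> uA a; apply: contraNneq => /(congr1 (msubst (linear_gsub (invmx A)))).
have uA' : invmx A \in unitmx by rewrite unitmx_inv.
have := linear_gsub_comp uA' a; rewrite invmxK => ->.
by rewrite rmorph0 => ->.
Qed.

Lemma linear_gsub_defined (A : 'M[k]_n.+1) : A \in unitmx -> forall p, defined_at (linear_gsub A) p.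
Proof.
move=> uA p; apply: contrapT => N.
have [i Xi] := proj_relevant p; move/negP: Xi; apply.
have -> : 'X_i = \sum_j (invmx A) i j *: linear_gsub A j.
  rewrite -[LHS](linear_gsubK uA) -[linear_gsub (invmx A) i]/(L (row i (invmx A))).
  by rewrite msubst_linear_form; apply: eq_bigr => j _; rewrite mxE.
apply: ideal_sum => j _; apply: idealZ; apply: contrapT => /negP Nj.
by apply: N; exists j.
Qed.

Definition linear_morphism (A : 'M[k]_n.+1) (uA : A \in unitmx) (X Y : opens (proj k n))
  (XY : forall p, X p -> Y (pull (linear_gsub A) p)) : morphism X Y :=
  subst_morphism (linear_gsub_inj uA) (fun p _ => linear_gsub_defined uA p) XY.

Lemma linear_morphism_induced (A : 'M[k]_n.+1) (uA : A \in unitmx) (X Y : opens (proj k n)) XY :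
  induced (linear_gsub A) (@linear_morphism A uA X Y XY).
Proof. exact: subst_morphism_induced. Qed.

Lemma linear_left_inverse (A : 'M[k]_n.+1) (X Y : opens (proj k n)) (psi : morphism X Y)
    (chi : morphism Y X) : A \in unitmx -> induced (linear_gsub A) psi ->
  induced (linear_gsub (invmx A)) chi -> left_inverse_of psi chi.
Proof.
move=> uA; apply: induced_left_inverse; first exact: linear_gsub_inj.
  by apply: linear_gsub_inj; rewrite unitmx_inv.
exact: linear_gsubK.
Qed.

Lemma linear_automorphism (A : 'M[k]_n.+1) (X : opens (proj k n)) (psi : morphism X X) :
  A \in unitmx -> induced (linear_gsub A) psi ->
  (forall p, X p -> X (pull (linear_gsub (invmx A)) p)) -> automorphism psi.
Proof.
move=> uA ipsi XX; have uA' : invmx A \in unitmx by rewrite unitmx_inv.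
exists (linear_morphism uA' XX); split.
  by apply: (linear_left_inverse uA) => //; exact: linear_morphism_induced.
apply: (linear_left_inverse uA'); last by rewrite invmxK.
exact: linear_morphism_induced.
Qed.
End LinearAutomorphism.

Section SeparablePart.
Variables (k : finFieldType) (n : nat).
Local Notation S := {mpoly k[n.+1]}.
Local Notation L := (@linear_form k n).
Local Notation Omega := (half_space k n).

Lemma linear_half_space (A : 'M[k]_n.+1) p : A \in unitmx -> Omega p ->
  Omega (pull (linear_gsub A) p).
Proof.
move=> uA /half_spaceP Op; apply/half_spaceP => l l0.
rewrite pullE; last exact: linear_gsub_defined.
by rewrite msubst_linear_gsub Op // linear_gsub_row_neq0.
Qed.

(** The rows of coefficients of the linear forms that represent [psi] make up an
    invertible matrix, because no nonzero combination of these forms vanishes. *)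
Lemma separable_linear (psi : morphism Omega Omega) : (0 < n)%N -> separable_morphism psi ->
  exists2 A : 'M[k]_n.+1, A \in unitmx & induced (linear_gsub A) psi.
Proof.
move=> n0 sep; have [d [f [rf cop]]] := exists_coprime_represents psi n0.
have d1 := separable_represents_linear n0 sep rf cop; rewrite d1 in rf.
have [fd f0 uf fs] := rf.
pose A : 'M[k]_n.+1 := \matrix_(j, i) (f j)@_U_(i).
have fE : f = linear_gsub A.
  apply: funext => j; rewrite /= [LHS]homog1_linear_form //; congr (L _).
  by apply/rowP => i; rewrite !mxE.
have uA : A \in unitmx.
  rewrite -row_free_unit -kermx_eq0; apply/rowV0P => l /sub_kermxP lA.
  apply/eqP; apply: contraT => l0; have := split_neq0 (fs l l0).
  have -> : comb f l = L (l *m A).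
    by rewrite fE -msubst_linear_gsub msubst_linear_form.
  by rewrite lA linear0 eqxx.
by exists A => //; apply: (represents_induced (d := 1%N)); [rewrite -fE|exact: linear_gsub_inj].
Qed.

Theorem separable_endomorphism (psi : morphism Omega Omega) : (0 < n)%N ->
  separable_morphism psi -> automorphism psi /\
    exists Psi : morphism (projective_space k n) (projective_space k n),
      automorphism Psi /\ extends Psi psi.
Proof.
move=> n0 sep; have [A uA ipsi] := separable_linear n0 sep.
have uA' : invmx A \in unitmx by rewrite unitmx_inv.
split; first by apply: (linear_automorphism uA ipsi) => p; exact: linear_half_space.
pose PP p : projective_space k n p -> projective_space k n (pull (linear_gsub A) p) := fun=> I.
have iPsi := @linear_morphism_induced _ _ _ uA _ _ PP.
exists (linear_morphism uA PP); split; first exact: (linear_automorphism uA iPsi).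
have [_ [ppt pco]] := ipsi; have [_ [Ppt Pco]] := iPsi.
have ptE p : Omega p -> linear_morphism uA PP p = psi p by move=> Op; rewrite Ppt // ppt.
split => // V s p Op Vp.
have Vp' : V (psi p) by rewrite -ptE.
have Op' : Omega (psi p) by exact: (base_fun psi).
transitivity (fsubst (linear_gsub A) (s (psi p))).
  by rewrite -(ptE p Op); exact: Pco.
have := pco (opensI Omega V) (@subIsetl _ Omega V)
  (section_res (U := opensI Omega V) (@subIsetr _ Omega V) s) p Op (conj Op' Vp').
by move=> ->; congr fsubst; rewrite /= mem_set.
Qed.
End SeparablePart.

(** * Moore determinants *)

Lemma finField_pnat_card (k : finFieldType) : exists2 p, p \in [pchar k] & p.-nat #|k|.
Proof.
have [p _ pk] := finPcharP k; exists p => //.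
have := abelian.abelem_pgroup (abelian.fin_ring_pchar_abelem pk).
by rewrite /pgroup.pgroup cardsT.
Qed.

Section Frobenius.
Variables (k : finFieldType) (R : comNzRingType) (iota : {rmorphism k -> R}).
Local Notation q := #|k|.

Lemma pchar_nat_card_exp e : [pchar R].-nat (q ^ e)%N.
Proof.
have [p pk qp] := finField_pnat_card k; rewrite pnatX; apply/orP; left.
apply: sub_in_pnat qp => r _; rewrite !inE => /eqP->.
by have := rmorph_pchar iota pk; rewrite inE.
Qed.

Lemma frobeniusD e (x y : R) : (x + y) ^+ (q ^ e) = x ^+ (q ^ e) + y ^+ (q ^ e).
Proof. exact: exprDn_pchar (pchar_nat_card_exp e). Qed.

Lemma frobenius_scalar e (c : k) : iota c ^+ (q ^ e) = iota c.
Proof.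
rewrite -rmorphXn; congr (iota _); elim: e => [|e IH]; first by rewrite expr1.
by rewrite expnSr exprM IH expf_card.
Qed.

Lemma frobenius_sum e (I : Type) (r : seq I) (P : pred I) (G : I -> R) :
  (\sum_(i <- r | P i) G i) ^+ (q ^ e) = \sum_(i <- r | P i) G i ^+ (q ^ e).
Proof.
apply: (big_morph (fun x => x ^+ (q ^ e))) => [x y|]; first exact: frobeniusD.
have q0 : (0 < q ^ e)%N by rewrite expn_gt0 ltnW // card_finNzRing_gt1.
by rewrite expr0n gtn_eqF.
Qed.

Definition moore r (y : 'I_r -> R) : R := \det (\matrix_(i < r, j < r) y j ^+ (q ^ i)).
End Frobenius.

Section MooreFormula.
Variables (k : finFieldType) (K : fieldType) (iota : {rmorphism k -> K}).
Local Notation q := #|k|.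
Local Notation moore := (@moore k K).

Definition kcomb r (y : 'I_r -> K) (c : 'rV[k]_r) : K := \sum_j iota (c 0 j) * y j.

Lemma kcombB r (y : 'I_r -> K) c c' : kcomb y (c - c') = kcomb y c - kcomb y c'.
Proof.
rewrite /kcomb -sumrB; apply: eq_bigr => j _; by rewrite !mxE rmorphB mulrBl.
Qed.

Definition kfree r (y : 'I_r -> K) := forall c, kcomb y c = 0 -> c = 0.

Lemma kfree_lift r (y : 'I_r.+1 -> K) : kfree y -> kfree (fun j => y (lift ord_max j)).
Proof.
move=> fy c c0; have /matrixP cz : \row_j (if unlift ord_max j is Some j' then c 0 j' else 0) = 0 :> 'rV[k]_r.+1.
  apply: fy; rewrite /kcomb -[RHS]c0 (bigD1_ord ord_max) //= mxE unlift_none rmorph0 mul0r add0r.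
  by apply: eq_bigr => j _; rewrite mxE liftK.
by apply/rowP => j; have := cz 0 (lift ord_max j); rewrite !mxE liftK.
Qed.

(** As a function of the last argument the Moore determinant is a polynomial of
    degree [q ^ r], whose leading coefficient is the Moore determinant of the
    other arguments. It vanishes at the [q ^ r] combinations of these over [k],
    for which the last column depends on the others by additivity of Frobenius. *)
Lemma moore_recr r (y : 'I_r.+1 -> K) : kfree (fun j => y (lift ord_max j)) ->
  moore (fun j => y (lift ord_max j)) != 0 ->
  moore y = moore (fun j => y (lift ord_max j)) *
    \prod_(c : 'rV[k]_r) (y ord_max - kcomb (fun j => y (lift ord_max j)) c).
Proof.
set y' := fun j => _; move=> fy' m'0.
have q2 : (1 < q)%N by exact: card_finNzRing_gt1.
pose yt (t : K) j := if unlift ord_max j is Some j' then y' j' else t.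
pose M t : 'M[K]_r.+1 := \matrix_(i, j) yt t j ^+ (q ^ i).
pose cf i : K := cofactor (M 0) i ord_max.
have cfE t i : cofactor (M t) i ord_max = cf i.
  rewrite /cf /cofactor; congr (_ * \det _); apply/matrixP => a b.
  by rewrite !mxE /yt liftK.
pose P : {poly K} := \sum_(i < r.+1) (cf i) *: 'X^(q ^ i).
have PE t : P.[t] = \det (M t).
  rewrite (expand_det_col _ ord_max) horner_sum; apply: eq_bigr => i _.
  by rewrite hornerZ hornerXn -(cfE t) mxE /yt unlift_none mulrC.
have cf_max : cf ord_max = moore y'.
  rewrite /cf /cofactor -signr_odd addnn odd_double expr0 mul1r; congr (\det _).
  apply/matrixP => a b; rewrite !mxE /yt liftK.
  by rewrite lift_max.
have ME : moore y = P.[y ord_max].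
  rewrite PE; congr (\det _); apply/matrixP => a b; rewrite !mxE /yt.
  by case: unliftP => [b' ->|->].
have size_low : (size (\sum_(i < r) (cf (widen_ord (leqnSn r) i)) *: 'X^(q ^ i) : {poly K})%R <= q ^ r)%N.
  apply: leq_trans (size_sum _ _ _) _; apply/bigmax_leqP => i _.
  apply: leq_trans (size_scale_leq _ _) _.
  by rewrite size_polyXn ltn_exp2l.
have Psplit : P = \sum_(i < r) (cf (widen_ord (leqnSn r) i)) *: 'X^(q ^ i) + moore y' *: 'X^(q ^ r).
  by rewrite /P big_ord_recr /= -/(ord_max) cf_max.
have size_top : size (moore y' *: 'X^(q ^ r) : {poly K}) = (q ^ r).+1.
  by rewrite size_scale // size_polyXn.
have sizeP : size P = (q ^ r).+1.
  by rewrite Psplit addrC size_polyDl size_top // ltnS.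
have leadP : lead_coef P = moore y'.
  rewrite Psplit addrC lead_coefDl ?size_top ?ltnS //.
  by rewrite lead_coefZ lead_coefXn mulr1.
pose rs := [seq kcomb y' c | c <- enum 'rV[k]_r].
have rootP : all (root P) rs.
  apply/allP => _ /mapP[c _ ->]; rewrite /root PE; apply/eqP.
  (* The relation that expresses the last column through the others. *)
  pose v : 'cV[K]_r.+1 := \col_j (if unlift ord_max j is Some j' then - iota (c 0 j') else 1).
  apply/eqP; rewrite -det_tr; apply/det0P; exists v^T.
    apply/eqP => /rowP/(_ ord_max)/eqP.
    by rewrite !mxE unlift_none oner_eq0.
  rewrite -trmx_mul; apply/eqP; rewrite -trmx0 (inj_eq trmx_inj); apply/eqP/colP => i.
  rewrite !mxE (bigD1_ord ord_max) //= !mxE /yt unlift_none mulr1.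
  under eq_bigr => j _ do rewrite !mxE /yt liftK.
  rewrite /kcomb (frobenius_sum iota) -big_split big1 // => j _ /=.
  rewrite exprMn (frobenius_scalar iota) mulrN.
  by apply/eqP; rewrite subr_eq0; apply/eqP; exact: mulrC.
have uniqP : uniq_roots rs.
  rewrite uniq_rootsE map_inj_uniq ?enum_uniq // => c c' e.
  apply/eqP; rewrite -subr_eq0; apply/eqP; apply: fy'.
  by rewrite kcombB e subrr.
have size_rs : size P = (size rs).+1.
  by rewrite sizeP size_map -cardE card_mx mul1n.
have := all_roots_prod_XsubC size_rs rootP uniqP.
rewrite leadP => /(congr1 (fun p : {poly K} => p.[y ord_max])).
rewrite -ME => ->; rewrite hornerZ big_map horner_prod; congr (_ * _).
rewrite big_enum; apply: eq_bigr => c _; exact: hornerXsubC.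
Qed.

Lemma moore_neq0 r (y : 'I_r -> K) : kfree y -> moore y != 0.
Proof.
elim: r y => [|r IH] y fy; first by rewrite /moore det_mx00 oner_eq0.
have fy' := kfree_lift fy; rewrite moore_recr ?IH // mulf_neq0 ?IH //.
apply/prodf_neq0 => c _; apply/eqP => yc.
have /matrixP/(_ 0 ord_max)/eqP : \row_j (if unlift ord_max j is Some j' then - c 0 j' else 1) = 0 :> 'rV[k]_r.+1.
  apply: fy; rewrite /kcomb (bigD1_ord ord_max) //= mxE unlift_none rmorph1 mul1r -[RHS]yc.
  rewrite /kcomb -sumrN; congr (_ + _); apply: eq_bigr => j _.
  by rewrite mxE liftK rmorphN mulNr.
by rewrite !mxE unlift_none oner_eq0.
Qed.
End MooreFormula.

(** * The minors of a Moore matrix *)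

Section MooreSplit.
Variables (k : finFieldType) (n : nat).
Local Notation S := {mpoly k[n.+1]}.
Local Notation F := {fraction S}.
Local Notation L := (@linear_form k n).
Local Notation q := #|k|.

Definition vcomb r (v : 'I_r -> 'rV[k]_n.+1) (c : 'rV[k]_r) := \sum_j c 0 j *: v j.
Definition vfree r (v : 'I_r -> 'rV[k]_n.+1) := forall c, vcomb v c = 0 -> c = 0.

Let iota : {rmorphism k -> F} := (@FracField.tofrac S \o @mpolyC n.+1 k).
Let y r (v : 'I_r -> 'rV[k]_n.+1) j : F := (L (v j))%:F.

Lemma kcomb_linear_form r (v : 'I_r -> 'rV[k]_n.+1) c : kcomb iota (y v) c = (L (vcomb v c))%:F.
Proof.
rewrite /kcomb /vcomb linear_sum rmorph_sum; apply: eq_bigr => j _ /=.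
by rewrite linearZ /= -mul_mpolyC tofracM.
Qed.

Lemma kfree_linear_form r (v : 'I_r -> 'rV[k]_n.+1) : vfree v -> kfree iota (y v).
Proof.
move=> fv c; rewrite kcomb_linear_form => /eqP.
by rewrite tofrac_eq0 linear_form_eq0 => /eqP; exact: fv.
Qed.

Lemma moore_tofrac r (v : 'I_r -> 'rV[k]_n.+1) : (moore k (fun j => L (v j)))%:F = moore k (y v).
Proof.
rewrite /moore -det_map_mx; congr (\det _); apply/matrixP => i j.
by rewrite !mxE rmorphXn.
Qed.

(** The factors of the product formula are linear forms. *)
Lemma moore_split r (v : 'I_r -> 'rV[k]_n.+1) : vfree v -> is_split (moore k (fun j => L (v j))).
Proof.
elim: r v => [|r IH] v fv.
  rewrite /moore det_mx00.
  exact: is_split1.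
pose v' j := v (lift ord_max j).
have fv' : vfree v'.
  move=> c c0; have /matrixP cz : \row_j (if unlift ord_max j is Some j' then c 0 j' else 0) = 0 :> 'rV[k]_r.+1.
    apply: fv; rewrite /vcomb -[RHS]c0 (bigD1_ord ord_max) //= mxE unlift_none scale0r add0r.
    by apply: eq_bigr => j _; rewrite mxE liftK.
  by apply/rowP => j; have := cz 0 (lift ord_max j); rewrite !mxE liftK.
have fy := kfree_linear_form fv'.
have E := moore_recr (iota := iota) (y := y v) fy (moore_neq0 fy).
have -> : moore k (fun j => L (v j)) = moore k (fun j => L (v' j)) *
    \prod_(c : 'rV[k]_r) L (v ord_max - vcomb v' c).
  apply/eqP; rewrite -tofrac_eq tofracM !moore_tofrac rmorph_prod /= E; apply/eqP.
  congr (_ * _); apply: eq_bigr => c _.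
  by rewrite linearB tofracB -kcomb_linear_form.
apply: splitM; first exact: IH.
apply: split_prod => c _; apply: split_linear_form; apply/eqP => v0.
have /matrixP/(_ 0 ord_max)/eqP : \row_j (if unlift ord_max j is Some j' then - c 0 j' else 1) = 0 :> 'rV[k]_r.+1.
  apply: fv; rewrite /vcomb (bigD1_ord ord_max) //= mxE unlift_none scale1r -[RHS]v0.
  rewrite /vcomb -sumrN; congr (_ + _); apply: eq_bigr => j _.
  by rewrite mxE liftK scaleNr.
by rewrite !mxE unlift_none oner_eq0.
Qed.
End MooreSplit.

Section FrobeniusMinors.
Variables (k : finFieldType) (n : nat).
Local Notation q := #|k|.

(** Row [i > 0] is the image of [x] under the Frobenius power [i - 1]. Row 0 is a
    placeholder, as only the cofactors along it matter. *)
Definition frob_mx (R : comNzRingType) (x : 'I_n.+1 -> R) : 'M[R]_n.+1 :=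
  \matrix_(i, j) x j ^+ (q ^ i.-1).

Definition frob_minor (R : comNzRingType) (x : 'I_n.+1 -> R) j : R := cofactor (frob_mx x) 0 j.

Definition with_row0 (R : comNzRingType) (x w : 'I_n.+1 -> R) : 'M[R]_n.+1 :=
  \matrix_(i, j) if i == 0 then w j else x j ^+ (q ^ i.-1).

Section Ring.
Variables (R : comNzRingType) (iota : {rmorphism k -> R}).
Implicit Types x w : 'I_n.+1 -> R.

Lemma cofactor_with_row0 x w j : cofactor (with_row0 x w) 0 j = frob_minor x j.
Proof.
rewrite /frob_minor /cofactor; congr (_ * \det _); apply/matrixP => a b.
by rewrite !mxE eq_sym (negbTE (neq_lift _ _)).
Qed.

Lemma sum_frob_minor x w : \sum_j w j * frob_minor x j = \det (with_row0 x w).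
Proof.
rewrite (expand_det_row _ 0); apply: eq_bigr => j _.
by rewrite cofactor_with_row0 mxE eqxx.
Qed.

(** Expansion of a determinant with two equal rows. *)
Lemma frob_minor_orthogonal x s : (s < n)%N -> \sum_j x j ^+ (q ^ s) * frob_minor x j = 0.
Proof.
move=> sn; rewrite sum_frob_minor.
pose i1 : 'I_n.+1 := lift ord0 (Ordinal sn).
apply: (determinant_alternate (i1 := 0) (i2 := i1)) => [|j]; first exact: neq_lift.
by rewrite !mxE eqxx eq_sym (negbTE (neq_lift _ _)).
Qed.

(** The vector of the [x i ^+ (q ^ n.-1)] is orthogonal to all Frobenius powers
    below [n] of the vector of minors, hence proportional to the minors of the
    minors. Multiplying by an adjugate matrix turns this into an identity that
    is free of genericity assumptions. *)
Lemma frob_minor_twice x i j : (0 < n)%N ->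
  frob_minor (frob_minor x) j * x i ^+ (q ^ n.-1) = frob_minor (frob_minor x) i * x j ^+ (q ^ n.-1).
Proof.
move=> n0; set f := frob_minor x; set Q := (q ^ n.-1)%N.
(* With the unit vector [w] as row 0, the determinant is the minor of index [j]. *)
pose w r : R := (r == j)%:R.
pose B := with_row0 f w; pose X : 'cV[R]_n.+1 := \col_r x r ^+ Q.
have BX : B *m X = x j ^+ Q *: delta_mx 0 0.
  apply/colP => a; rewrite !mxE eqxx andbT.
  have [->|a0] := eqVneq a 0.
    rewrite mulr1 (bigD1 j) //= !mxE eqxx /w eqxx mul1r big1 ?addr0 // => r /negbTE rj.
    by rewrite !mxE eqxx /w rj mul0r.
  rewrite mulr0; have an : (a.-1 < n)%N.
    by rewrite -ltnS prednK ?lt0n //; exact: ltn_ord.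
  have H : \sum_r x r ^+ (q ^ (n.-1 - a.-1)) * frob_minor x r = 0.
    by apply: frob_minor_orthogonal; rewrite -[X in (_ < X)%N](prednK n0) ltnS leq_subr.
  have := congr1 (fun z => z ^+ (q ^ a.-1)) H; rewrite (frobenius_sum iota) expr0n.
  have qa : (0 < q ^ a.-1)%N by rewrite expn_gt0 ltnW // card_finNzRing_gt1.
  rewrite gtn_eqF // => e.
  rewrite -[RHS]e; apply: eq_bigr => r _; rewrite !mxE (negbTE a0) [RHS]exprMn mulrC.
  by rewrite -exprM -expnD subnK // -ltnS (prednK n0).
have := congr1 (mulmx (\adj B)) BX; rewrite mulmxA mul_adj_mx mul_scalar_mx -scalemxAr.
have dB : \det B = frob_minor f j.
  rewrite -sum_frob_minor (bigD1 j) //= /w eqxx mul1r big1 ?addr0 // => r /negbTE rj.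
  by rewrite rj mul0r.
rewrite dB => /colP/(_ i); rewrite !mxE => ->; rewrite mulrC; congr (_ * _).
rewrite (bigD1 0) //= !mxE !eqxx mulr1 big1 ?addr0; last first.
  by move=> r /negbTE r0; rewrite !mxE r0 mulr0.
exact: cofactor_with_row0.
Qed.
End Ring.

Lemma frob_minor_rmorph (R R' : comNzRingType) (phi : {rmorphism R -> R'}) x j :
  phi (frob_minor x j) = frob_minor (fun r => phi (x r)) j.
Proof.
rewrite /frob_minor -cofactor_map_mx; congr cofactor; apply/matrixP => a b.
by rewrite !mxE rmorphXn.
Qed.
End FrobeniusMinors.

Section DualMap.
Variables (k : finFieldType) (n : nat).
Hypothesis n_gt0 : (0 < n)%N.
Local Notation S := {mpoly k[n.+1]}.
Local Notation F := {fraction S}.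
Local Notation L := (@linear_form k n).
Local Notation q := #|k|.
Local Notation Omega := (half_space k n).
Local Notation Q := (q ^ n.-1)%N.

Definition dual_fun : 'I_n.+1 -> S := frob_minor k (fun j => 'X_j).
Definition dual_deg := (\sum_(i < n) q ^ i)%N.

Lemma dual_deg_gt0 : (0 < dual_deg)%N.
Proof.
by rewrite /dual_deg (bigD1 (Ordinal n_gt0)) //= expn0.
Qed.

Lemma dual_homog j : dual_fun j \is dual_deg.-homog.
Proof.
rewrite /dual_fun /frob_minor /cofactor -det_tr.
have H : \det (row' 0 (col' j (frob_mx k (fun j : 'I_n.+1 => 'X_j : S))))^T \is dual_deg.-homog.
  apply: det_homog => a b; rewrite !mxE /=.
  by have := dhomogMn (q ^ b) (X_homog k (lift j a)); rewrite mul1n.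
by rewrite -signr_odd; case: (odd _); rewrite ?expr0 ?expr1 ?mul1r ?mulN1r ?rpredN.
Qed.

Definition dual_gsub : gsub k n := Gsub dual_deg_gt0 dual_homog.
Local Notation phi := (msubst dual_gsub).

(** A change of coordinates over [k] commutes with Frobenius, so that the row [l]
    may be assumed to be a unit vector; the combination is then a Moore
    determinant of independent linear forms. *)
Lemma dual_split l : l != 0 -> is_split (comb dual_gsub l).
Proof.
move=> l0; have [i li] := row_neq0P l0; have [h uh hE] := unitmx_row_delta li.
have dh : \det h != 0 by rewrite -unitfE -unitmxE.
pose v (j : 'I_n) : 'rV[k]_n.+1 := row (lift i j) h^T.
have fv : vfree v.
  move=> c c0; have : (\row_j (if unlift i j is Some j' then c 0 j' else 0)) *m h^T = 0.
    rewrite mulmx_sum_row -[RHS]c0 (bigD1_ord i) //= mxE unlift_none scale0r add0r.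
    by apply: eq_bigr => j _; rewrite mxE liftK.
  move/(congr1 (mulmx^~ (invmx h^T))); rewrite mulmxK ?unitmx_tr // mul0mx => /rowP cz.
  by apply/rowP => j; have := cz (lift i j); rewrite !mxE liftK.
pose w j : S := (l 0 j)%:MP.
have combE : comb dual_gsub l = \det (with_row0 k (fun j => 'X_j) w).
  by rewrite -sum_frob_minor; apply: eq_bigr => j _; rewrite /w mul_mpolyC.
have : (\det h)%:MP * comb dual_gsub l = (-1) ^+ (0 + i) * moore k (fun j => L (v j)).
  rewrite combE -det_map_mx mulrC -det_mulmx (expand_det_row _ 0).
  have row0E j : (with_row0 k (fun j => 'X_j) w *m map_mx (@mpolyC n.+1 k) h) 0 j = (j == i)%:R.
    have /rowP/(_ j) := hE; rewrite !mxE eqxx /= => /(congr1 (@mpolyC n.+1 k)).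
    rewrite mpolyC_nat => <-; rewrite rmorph_sum /=; apply: eq_bigr => r _.
    by rewrite !mxE eqxx mpolyCM.
  rewrite (bigD1 i) //= big1 ?addr0 => [|j /negbTE ji]; last by rewrite row0E ji mul0r.
  rewrite row0E eqxx mul1r /cofactor; congr (_ * \det _); apply/matrixP => a b.
  rewrite !mxE /linear_form (frobenius_sum (@mpolyC n.+1 k)); apply: eq_bigr => r _.
  rewrite !mxE eq_sym (negbTE (neq_lift _ _)) /= -mul_mpolyC exprMn.
  by rewrite (frobenius_scalar (@mpolyC n.+1 k)) mulrC.
move=> E; have sm : is_split ((-1) ^+ (0 + i) * moore k (fun j => L (v j))).
  apply: splitM; last exact: moore_split.
  by apply: splitX; rewrite -mpolyC1 -mpolyCN; apply: splitC; rewrite oppr_eq0 oner_eq0.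
by apply: (@split_factor _ _ _ ((\det h)%:MP)); rewrite mulrC E.
Qed.
End DualMap.

(** * The dual map *)

Section DualMorphism.
Variables (k : finFieldType) (n : nat).
Hypothesis n_gt0 : (0 < n)%N.
Local Notation S := {mpoly k[n.+1]}.
Local Notation F := {fraction S}.
Local Notation L := (@linear_form k n).
Local Notation q := #|k|.
Local Notation Omega := (half_space k n).
Local Notation eta := (generic_point k n).
Local Notation Q := (q ^ n.-1)%N.
Local Notation f := (dual_gsub k n_gt0).
Local Notation phi := (msubst f).
Let g i := phi (f i).

Lemma Q_gt0 : (0 < Q)%N.
Proof. by rewrite expn_gt0 ltnW // card_finNzRing_gt1. Qed.

Lemma dual_linear_form l : phi (L l) = comb f l.
Proof. by rewrite msubst_linear_form. Qed.

Lemma dual_split_neq0 a : is_split a -> phi a != 0.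
Proof.
elim/split_ind => [c c0|t b t0 _ b0]; first by rewrite msubstC mpolyC_eq0.
rewrite rmorphM /=; apply: mulf_neq0 b0.
by rewrite dual_linear_form; exact: split_neq0 (dual_split n_gt0 t0).
Qed.

Lemma dual_fun_split i : is_split (f i).
Proof. by rewrite -(comb_delta f); apply: dual_split; exact: delta_row_neq0. Qed.

Lemma g_neq0 i : g i != 0.
Proof. exact: dual_split_neq0 (dual_fun_split i). Qed.

Lemma g_proportional i j : g j * 'X_i ^+ Q = g i * 'X_j ^+ Q.
Proof.
have gE r : g r = frob_minor k (frob_minor k (fun j => 'X_j)) r.
  rewrite /g [f r]/(dual_fun k r) frob_minor_rmorph; congr (frob_minor k _ r).
  by apply: funext => s; exact: msubstX.
by rewrite !gE; apply: (frob_minor_twice (@mpolyC n.+1 k)).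
Qed.

Lemma msubst_frobenius (a : S) : msubst (fun i => 'X_i ^+ Q) a = a ^+ Q.
Proof.
elim/mpoly_ring_ind: a => [c|i|a b IHa IHb|a b IHa IHb].
- by rewrite msubstC (frobenius_scalar (@mpolyC n.+1 k)).
- by rewrite msubstX.
- by rewrite rmorphD /= IHa IHb (frobeniusD (@mpolyC n.+1 k)).
- by rewrite rmorphM /= IHa IHb exprMn.
Qed.

Lemma msubst_twice a : phi (phi a) = msubst g a.
Proof.
elim/mpoly_ring_ind: a => [c|i|a b IHa IHb|a b IHa IHb].
- by rewrite !msubstC.
- by rewrite !msubstX.
- by rewrite !rmorphD /= IHa IHb.
- by rewrite !rmorphM /= IHa IHb.
Qed.

(** By [g_proportional] the square of the dual map is a power of Frobenius as a
    rational map. *)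
Lemma dual_twice e a : a \is e.-homog ->
  phi (phi a) * ('X_0 ^+ Q) ^+ e = a ^+ Q * g 0 ^+ e.
Proof.
move=> ae; have X0 : ('X_0 : S) ^+ Q != 0 by rewrite expf_neq0 // mpolyX_neq0.
have := feval_dehomog g ae (g_neq0 0).
have -> : (fun i => (g i)%:F / (g 0)%:F) = (fun i => ('X_i ^+ Q)%:F / ('X_0 ^+ Q)%:F).
  apply: funext => i; apply/eqP; rewrite (eq_frac _ _ (g_neq0 0) X0); apply/eqP.
  by rewrite [RHS]mulrC; exact: g_proportional.
rewrite (feval_dehomog _ ae X0) msubst_frobenius -msubst_twice => /eqP.
by rewrite (eq_frac _ _ (expf_neq0 e X0) (expf_neq0 e (g_neq0 0))) => /eqP.
Qed.

Lemma dual_twice_homog_neq0 e a : a \is e.-homog -> a != 0 -> phi (phi a) != 0.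
Proof.
move=> ae a0; have := dual_twice ae; apply: contra_eq_neq => ->.
by rewrite mul0r eq_sym mulf_neq0 // expf_neq0 // g_neq0.
Qed.

Lemma dual_inj a : a != 0 -> phi a != 0.
Proof.
apply: contraNneq => phia; rewrite (pihomog_partition a) big1 // => e _.
apply/eqP; apply: contraT => ae0.
have := dual_twice_homog_neq0 (pihomogP mdeg e a) ae0.
by rewrite -pihomog_msubst phia !raddf0 eqxx.
Qed.

Lemma dual_defined p : Omega p -> defined_at f p.
Proof. by move=> Op; exists 0; apply: split_half_space Op; exact: dual_fun_split. Qed.

Lemma dual_half_space p : Omega p -> Omega (pull f p).
Proof.
move=> Op; apply/half_spaceP => l l0; rewrite pullE; last exact: dual_defined.
by rewrite dual_linear_form; apply: split_half_space Op; exact: dual_split.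
Qed.

Definition dual_morphism : morphism Omega Omega :=
  subst_morphism dual_inj dual_defined dual_half_space.

Lemma dual_morphism_induced : induced f dual_morphism.
Proof. exact: subst_morphism_induced. Qed.

Lemma dual_twice_mem p a : Omega p -> (phi (phi a) \in proj_ideal p) = (a \in proj_ideal p).
Proof.
move=> Op; have OOp := dual_half_space (dual_half_space Op).
have gp : g 0 \notin proj_ideal p.
  have := half_space_X 0 OOp; rewrite !pullE ?msubstX //; try exact: dual_defined.
  by apply: dual_defined; exact: dual_half_space.
have Xp : ('X_0 : S) ^+ Q \notin proj_ideal p by apply: notin_idealX; exact: half_space_X.
have H e b : b \is e.-homog -> (phi (phi b) \in proj_ideal p) = (b \in proj_ideal p).
  move=> be; have := dual_twice be => /(congr1 (fun z => z \in proj_ideal p)).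
  rewrite !idealM (negbTE (notin_idealX e Xp)) (negbTE (notin_idealX e gp)) !orbF => ->.
  by rewrite idealX ?Q_gt0.
have phi2 e : phi (phi (pihomog mdeg e a)) = pihomog mdeg (gsub_deg f * (gsub_deg f * e)) (phi (phi a)).
  by rewrite !pihomog_msubst.
apply/idP/idP => [|/ideal_partsP ap].
  move/ideal_partsP => ap; apply/ideal_partsP => e.
  by rewrite -(H e) ?pihomogP // phi2; exact: ap.
have phiS : phi a = \sum_(e < msize a) phi (pihomog mdeg e a).
  by rewrite {1}(pihomog_partition a); exact: rmorph_sum.
have -> : phi (phi a) = \sum_(e < msize a) phi (phi (pihomog mdeg e a)).
  by rewrite phiS; exact: rmorph_sum.
by apply: ideal_sum => e _; rewrite (H e) ?pihomogP.
Qed.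

(** Frobenius powers fix all points. *)
Lemma pull_dual_twice p : Omega p -> pull f (pull f p) = p.
Proof.
move=> Op; apply: proj_eq => a; rewrite !pullE ?dual_twice_mem //; first exact: dual_defined.
by apply: dual_defined; exact: dual_half_space.
Qed.

Lemma dual_radicial : radicial dual_morphism.
Proof.
split=> [p r Op Or e|p Op x [d [a [b [ad bd bp ->]]]]].
  by rewrite -(pull_dual_twice Op) -(pull_dual_twice Or); congr pull.
have b0 := notin_ideal_neq0 bp.
exists Q, ((a%:F / b%:F) ^+ Q); split.
- have [r pr qr] := finField_pnat_card k; rewrite pnatX; apply/orP; left.
  by apply: sub_in_pnat qr => s _ /eqnP->.
- have pbd := msubst_homog f bd; have pad := msubst_homog f ad.
  pose V := opensI Omega (nonvanishing pbd).
  have VO : V `<=` Omega by move=> r [].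
  have Vb r : V r -> phi b \notin proj_ideal r by move=> [].
  have Vp : V (dual_morphism p).
    split; first exact: dual_half_space.
    have -> : dual_morphism p = pull f p by [].
    by rewrite /= pullE ?dual_twice_mem //; exact: dual_defined.
  exists V, VO, (section_frac pad pbd Vb); split => //.
  have [_ [_ ->]] := dual_morphism_induced; rewrite // section_fracE //.
  rewrite (fsubst_frac dual_inj) ?dual_inj //; apply/eqP; rewrite expr_div_n -!tofracXn.
  have b2 := dual_twice_homog_neq0 bd b0; rewrite eq_frac ?expf_neq0 //.
  have X0 : (('X_0 : S) ^+ Q) ^+ d != 0 by rewrite !expf_neq0 // mpolyX_neq0.
  apply/eqP/(mulIf X0); rewrite -mulrA dual_twice // mulrAC dual_twice //; ring.
- exists 0%N, 0, 1; split; rewrite ?rpred0 ?dhomog1 ?ideal0 ?ideal1 //.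
  by rewrite subrr tofrac0 mul0r.
Qed.

(** The point (1 : 0 : ... : 0), obtained as the image of the generic point under
    the constant rational map. *)
Definition rational_point_fun (i : 'I_n.+1) : S := if i == 0 then 'X_0 else 0.

Lemma rational_point_homog i : rational_point_fun i \is 1.-homog.
Proof. by rewrite /rational_point_fun; case: eqP => _; [exact: X_homog|exact: rpred0]. Qed.

Definition rational_point_gsub := @Gsub k n rational_point_fun 1 isT rational_point_homog.
Definition rational_point := pull rational_point_gsub eta.

Lemma mem_rational_point a : (a \in proj_ideal rational_point) = (msubst rational_point_fun a == 0).
Proof.
rewrite pullE // ; exists 0; rewrite in_generic /= /rational_point_fun eqxx.
exact: mpolyX_neq0.
Qed.

Definition kill_var (i : 'I_n.+1) : S -> S := msubst (fun j => if j == i then 0 else 'X_j).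

Lemma kill_dual i m : kill_var i (f m) =
  frob_minor k (fun j => if j == i then 0 else 'X_j) m.
Proof.
rewrite [f m]/(dual_fun k m) /kill_var /dual_fun frob_minor_rmorph; congr (frob_minor k _ m).
by apply: funext => j; exact: msubstX.
Qed.

Lemma kill_dual_other i m : i != m -> kill_var i (f m) = 0.
Proof.
rewrite kill_dual /frob_minor /cofactor; case: (unliftP m i) => [j ->|->]; last by rewrite eqxx.
move=> _; rewrite (expand_det_col _ j) big1 ?mulr0 // => b _.
rewrite !mxE eqxx expr0n gtn_eqF ?mul0r //.
by rewrite expn_gt0 ltnW // card_finNzRing_gt1.
Qed.

Lemma kill_dual_same i : kill_var i (f i) = f i.
Proof.
rewrite kill_dual [RHS]/(dual_fun k i) /dual_fun /frob_minor /cofactor.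
congr (_ * \det _); apply/matrixP => a b.
by rewrite !mxE eq_sym (negbTE (neq_lift _ _)).
Qed.

Lemma rational_point_kill i a : i != 0 ->
  msubst rational_point_fun (kill_var i a) = msubst rational_point_fun a.
Proof.
move=> i0; elim/mpoly_ring_ind: a => [c|j|a b IHa IHb|a b IHa IHb].
- by rewrite /kill_var !msubstC.
- rewrite /kill_var !msubstX; case: eqP => [->|_]; last by rewrite msubstX.
  by rewrite rmorph0 /rational_point_fun (negbTE i0).
- by rewrite /kill_var !rmorphD /= -!/(kill_var _ _) IHa IHb.
- by rewrite /kill_var !rmorphM /= -!/(kill_var _ _) IHa IHb.
Qed.

(** Setting ['X_i] to zero kills [f m], which involves that variable in a whole
    column, and preserves [f i], from which it is absent; so it kills [b], and
    then [b] vanishes at the rational point. *)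
Lemma dual_not_regular m i a b : i != 0 -> i != m ->
  b \notin proj_ideal rational_point -> f i * b <> a * f m.
Proof.
move=> i0 im bP.
have := split_neq0 (dual_fun_split i); have := kill_dual_same i; have := kill_dual_other im.
move: (f i) (f m) => fi fm fm0 fiK fi0 /(congr1 (kill_var i)).
rewrite /kill_var !rmorphM /= -/(kill_var i fi) -/(kill_var i fm) fiK fm0 mulr0 => /eqP.
rewrite mulf_eq0 (negbTE fi0) /= => /eqP kb.
move/negP: bP; apply; rewrite mem_rational_point -(rational_point_kill b i0) /kill_var kb.
by rewrite rmorph0.
Qed.

(** An extension would make the quotients f_i / f_m regular at the rational point,
    where ['X_m] is a coordinate that does not vanish at its image. *)
Lemma dual_not_extends : (1 < n)%N ->
  ~ exists Psi : morphism (projective_space k n) (projective_space k n),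
      extends Psi dual_morphism.
Proof.
move=> n1 [Psi [PsiE PsiC]].
have [m mP] := proj_relevant (Psi rational_point).
pose V := nonvanishing (X_homog k m).
have Vm p : V p -> ('X_m : S) \notin proj_ideal p by [].
have [i [i0 im]] : exists i : 'I_n.+1, i != 0 /\ i != m.
  have [m1|m1] := eqVneq (m : nat) 1%N.
    by exists (inord 2); rewrite -!val_eqE /= inordK // m1.
  have v1 : (inord 1 : 'I_n.+1) = 1%N :> nat by rewrite inordK // ltnS ltnW.
  by exists (inord 1); split; rewrite -val_eqE /= v1 // eq_sym.
pose s := section_frac (X_homog k i) (X_homog k m) Vm.
pose t := comorph Psi (@subsetT _ V) s.
have tP : (preim_opens (@base_cont _ _ _ _ Psi) V) rational_point by [].
have [_ Veta] := open_generic tP.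
have Oeta := @half_space_generic k n.
have teta : t eta = (f i)%:F / (f m)%:F.
  rewrite /t PsiC //.
  have Wd : opensI Omega V (dual_morphism eta).
    by split; [exact: dual_half_space | rewrite -(PsiE _ Oeta)].
  have [_ [_ ->]] := dual_morphism_induced => //.
  have -> : section_res (U := opensI Omega V) (@subIsetr _ Omega V) s (dual_morphism eta) = ('X_i)%:F / ('X_m)%:F.
    have [_ Vd] := Wd; rewrite /= !mem_set //.
  by rewrite (fsubst_frac dual_inj) ?mpolyX_neq0 // !msubstX.
have := section_stalk t tP; rewrite (section_generic t tP) teta.
move=> [d [a [b [_ _ bP /eqP]]]].
rewrite eq_frac ?(split_neq0 (dual_fun_split m)) ?(notin_ideal_neq0 bP) // => /eqP.
exact: dual_not_regular.
Qed.

End DualMorphism.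

Theorem theorem1p1 (k : finFieldType) (n : nat) (n1 : (1 <= n)%N) :
  (forall psi : morphism (half_space k n) (half_space k n),
    dominant psi -> separable_morphism psi ->
    automorphism psi /\
    exists Psi : morphism (projective_space k n) (projective_space k n),
      automorphism Psi /\ extends Psi psi) /\
  ((2 <= n)%N ->
    exists psi : morphism (half_space k n) (half_space k n),
      radicial psi /\
      ~ exists Psi : morphism (projective_space k n) (projective_space k n),
          extends Psi psi).
Proof.
split=> [psi _|n2]; first exact: separable_endomorphism.
exists (dual_morphism k n1); split; first exact: dual_radicial.
exact: dual_not_extends.
Qed.
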